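(* Let $\sigma_x,\sigma_y>0$, $\gamma>0$, $a>0$ and $C>0$ be constants. For each $n$ let $d=d_n$ and $p=p_n$ be positive integers such that, as $n\to\infty$, $\frac{n}{pd}\to\gamma$ and $\frac{p}{d}\to a$. For each $n$ let $X\in\mathbb{R}^{n\times d}$ be a random matrix with i.i.d. entries and $Y\in\mathbb{R}^{n\times p}$ a random matrix with i.i.d. entries, independent of $X$ (the common law of the entries of $X$ and the common law of the entries of $Y$ do not depend on $n$; all matrices are defined on a common probability space), such that for all $1\le i\le n$, $1\le j\le d$, $1\le \ell\le p$, $$\mathbb{E}[X_{ij}]=0,\quad \mathbb{E}[X_{ij}^2]=\sigma_x^2,\quad \mathbb{E}[X_{ij}^4]\le C,\qquad \mathbb{E}[Y_{i\ell}]=0,\quad \mathbb{E}[Y_{i\ell}^2]=\sigma_y^2,\quad \mathbb{E}[Y_{i\ell}^4]\le C.$$ Let $$M=\frac1d XX^\top\odot\frac1p YY^\top\in\mathbb{R}^{n\times n},$$ and let $\mu_n=\frac1n\sum_{i=1}^n\delta_{\lambda_i}$, where $\lambda_1,\dots,\lambda_n$ are the eigenvalues of $\frac{1}{\sigma_x^2\sigma_y^2}M$. Then, as $n\to\infty$, $\mu_n$ converges weakly in probability to the Marchenko--Pastur distribution $\mu_{\mathrm{MP}_\gamma}$ of shape $\gamma$. If, additionally, all moments of the entries of $X$ and $Y$ are finite, i.e. $\mathbb{E}[|X_{ij}|^k]+\mathbb{E}[|Y_{i\ell}|^k]<\infty$ for every $k\in\mathbb{N}$, then almost surely $\mu_n$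 converges weakly to $\mu_{\mathrm{MP}_\gamma}$.
   Context: $\odot$ denotes the Hadamard (entrywise) product: $(A\odot B)_{ij}=A_{ij}B_{ij}$. The Marchenko--Pastur distribution of shape $\gamma>0$ is the probability measure on $\mathbb{R}$ defined as follows. Put $\lambda_-=(1-\sqrt\gamma)^2$ and $\lambda_+=(1+\sqrt\gamma)^2$. If $\gamma\in(0,1]$, $$\mu_{\mathrm{MP}_\gamma}(\mathrm{d}x)=\frac{\sqrt{(\lambda_+-x)(x-\lambda_-)}}{2\pi\gamma x}\,\mathbf{1}_{x\in[\lambda_-,\lambda_+]}\,\mathrm{d}x.$$ If $\gamma>1$, $\mu_{\mathrm{MP}_\gamma}$ is the sum of $(1-\frac1\gamma)\delta_0$ and the measure with the density given by the same formula. Random probability measures $\mu_n$ converge weakly in probability to $\mu$ if $\int f\,\mathrm{d}\mu_n\to\int f\,\mathrm{d}\mu$ in probability for every bounded continuous $f:\mathbb{R}\to\mathbb{R}$. ''Almost surely $\mu_n$ converges weakly to $\mu$'' means that with probability one $\int f\,\mathrm{d}\mu_n\to\int f\,\mathrm{d}\mu$ for every bounded continuous $f$. *)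

(* Defs.v *)
From HB Require Import structures.
From mathcomp Require Import all_boot all_order all_algebra.
From mathcomp Require Import sesquilinear spectral complex.
From mathcomp Require Import all_classical all_reals all_analysis.
From mathcomp Require Import measurable_realfun.

Set Implicit Arguments.
Unset Strict Implicit.
Unset Printing Implicit Defensive.
Import Order.TTheory GRing.Theory Num.Theory.
Import numFieldNormedType.Exports.
Local Open Scope classical_set_scope.
Local Open Scope ring_scope.

Section independence.
Context d (T : measurableType d) (R : realType) (P : probability T R).

Definition mutually_independent (I : finType) (Z : I -> {RV P >-> R}) : Prop :=
  forall (J : {set I}) (B : I -> set R), (forall i, measurable (B i)) ->
    P (\bigcap_(i in [set` J]) (Z i @^-1` B i)) =
    (\prod_(i in J) P (Z i @^-1` B i))%E.

(* Only measurable sets are compared: [distribution P U A] is meaningless when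
   [A] is not measurable. *)
Definition same_law (U V : {RV P >-> R}) : Prop :=
  forall A : set R, measurable A -> distribution P U A = distribution P V A.

Definition random_matrix (m n : nat) := 'I_m -> 'I_n -> {RV P >-> R}.

Definition rmx_val m n (X : random_matrix m n) (w : T) : 'M[R]_(m, n) :=
  \matrix_(i, j) X i j w.

Definition iid_entries m n (X : random_matrix m n) : Prop :=
  mutually_independent (fun k : 'I_m * 'I_n => X k.1 k.2) /\
  forall i j i' j', same_law (X i j) (X i' j').

Definition rmx_sigma m n (X : random_matrix m n) : set (set T) :=
  <<s [set X k.1 k.2 @^-1` B | k in [set: 'I_m * 'I_n] & B in measurable] >>.

Definition independent_rmx m n m' n'
    (X : random_matrix m n) (Y : random_matrix m' n') : Prop :=
  forall A B, rmx_sigma X A -> rmx_sigma Y B -> P (A `&` B) = (P A * P B)%E.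

End independence.

Definition hadamard (R : pzRingType) m n (A B : 'M[R]_(m, n)) : 'M[R]_(m, n) :=
  \matrix_(i, j) (A i j * B i j).

Section spectral_distribution.
Context (R : realType).

(* A sequence of real eigenvalues counted with algebraic multiplicity; it is
   meaningful when the characteristic polynomial splits over [R], in particular
   for symmetric matrices (see [eigenvaluesP]). The order is unspecified. *)
Definition eigenvalues n (A : 'M[R]_n) : seq R :=
  xget [::] [set s | char_poly A = \prod_(z <- s) ('X - z%:P)].

Definition esd n (A : 'M[R]_n) : {measure set R -> \bar R} :=
  mscale (n%:R^-1)%:nng (msum (fun i => \d_((eigenvalues A)`_i)) n).

End spectral_distribution.

Section marchenko_pastur.
Context (R : realType).
Implicit Types g x : R.

Definition mp_left g : R := (1 - Num.sqrt g) ^+ 2.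
Definition mp_right g : R := (1 + Num.sqrt g) ^+ 2.

Definition mp_pdf g x : R :=
  Num.sqrt ((mp_right g - x) * (x - mp_left g)) / (2 * pi * g * x)
  * \1_(`[mp_left g, mp_right g]) x.

Definition mp_ac g (A : set R) : \bar R :=
  (\int[lebesgue_measure]_(x in A) (mp_pdf g x)%:E)%E.

Definition marchenko_pastur g (A : set R) : \bar R :=
  if g <= 1 then mp_ac g A else ((1 - g^-1)%:E * \d_(0%R : R) A + mp_ac g A)%E.

Lemma mp_pdf_ge0 g x : 0 <= mp_pdf g x.
Proof.
rewrite /mp_pdf indicE; have [|_] := boolP (x \in _); last by rewrite mulr0.
rewrite inE /= in_itv /= => /andP[lx xr]; rewrite mulr1.
have [g0|g0] := leP 0 g.
  rewrite divr_ge0 ?sqrtr_ge0// !mulr_ge0 ?pi_ge0//.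
  by rewrite (le_trans _ lx)// sqr_ge0.
have sg : Num.sqrt g = 0 by apply: ler0_sqrtr; exact: ltW.
move: lx xr; rewrite /mp_left /mp_right sg subr0 addr0 expr1n => lx xr.
have -> : x = 1 by apply/eqP; rewrite eq_le lx xr.
by rewrite subrr mul0r sqrtr0 mul0r.
Qed.

Lemma measurable_mp_pdf g : measurable_fun [set: R] (mp_pdf g).
Proof.
have msqrt : measurable_fun [set: R] (@Num.sqrt R).
  by apply: continuous_measurable_fun; apply: sqrt_continuous.
have minv : measurable_fun [set: R] (@GRing.inv R).
  have oC : open (~` [set (0 : R)]).
    by apply: closed_openC; exact: closed_eq.
  rewrite -(setUv [set (0 : R)]).
  apply/measurable_funU; [exact: measurable_set1|exact: open_measurable|split].
    exact: measurable_fun_set1.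
  apply: open_continuous_measurable_fun => // x /set_mem /eqP x0.
  exact: inv_continuous.
apply: measurable_funM; last exact: measurable_indic.
apply: measurable_funM.
  apply: (measurableT_comp msqrt).
  by apply: measurable_funM; apply: measurable_funB.
by apply: (measurableT_comp minv); exact: measurable_funM.
Qed.

Let mp_ac0 g : mp_ac g set0 = 0%E.
Proof. by rewrite /mp_ac integral_set0. Qed.

Let mp_ac_ge0 g A : (0 <= mp_ac g A)%E.
Proof. by apply: integral_ge0 => x _; rewrite lee_fin mp_pdf_ge0. Qed.

Let mp_ac_sigma_additive g : semi_sigma_additive (mp_ac g).
Proof.
move=> /= F mF tF mUF; rewrite /mp_ac; apply: cvg_toP.
  apply: ereal_nondecreasing_is_cvgn => m n mn.
  apply: lee_sum_nneg_natr => // k _ _.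
  by apply: integral_ge0 => /= x Fkx; rewrite lee_fin mp_pdf_ge0.
rewrite ge0_integral_bigcup//=.
- apply: measurable_funTS; apply: measurableT_comp => //.
  exact: measurable_mp_pdf.
- by move=> x _; rewrite lee_fin mp_pdf_ge0.
Qed.

HB.instance Definition _ g := isMeasure.Build _ _ _ (mp_ac g)
  (mp_ac0 g) (@mp_ac_ge0 g) (@mp_ac_sigma_additive g).

Let marchenko_pasturE g :
  exists m : {measure set R -> \bar R}, marchenko_pastur g = m.
Proof.
have [g1|g1] := leP g 1.
  by exists (mp_ac g); apply/funext => A; rewrite /marchenko_pastur g1.
have c0 : 0 <= 1 - g^-1.
  by rewrite subr_ge0 invf_le1 ?ltW// (lt_trans ltr01).
exists (measure_add (mscale (NngNum c0) (\d_(0 : R))) (mp_ac g)).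
apply/funext => A.
rewrite /marchenko_pastur leNgt g1; symmetry; exact: measure_addE.
Qed.

Let marchenko_pastur0 g : marchenko_pastur g set0 = 0%E.
Proof. by have [m ->] := marchenko_pasturE g. Qed.

Let marchenko_pastur_ge0 g A : (0 <= marchenko_pastur g A)%E.
Proof. by have [m ->] := marchenko_pasturE g. Qed.

Let marchenko_pastur_sigma_additive g :
  semi_sigma_additive (marchenko_pastur g).
Proof.
have [m ->] := marchenko_pasturE g; exact: measure_semi_sigma_additive.
Qed.

HB.instance Definition _ g := isMeasure.Build _ _ _ (marchenko_pastur g)
  (marchenko_pastur0 g) (@marchenko_pastur_ge0 g)
  (@marchenko_pastur_sigma_additive g).

End marchenko_pastur.

Section weak_convergence.
Context (R : realType).

Definition weak_cvg (mu_ : nat -> {measure set R -> \bar R})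
    (mu : {measure set R -> \bar R}) : Prop :=
  forall f : R -> R, continuous f -> bounded_fun f ->
    \int[mu_ n]_x f x @[n --> \oo] --> \int[mu]_x f x.

Context d (T : measurableType d) (P : probability T R).

Definition cvg_in_probability (Z : nat -> T -> R) (c : R) : Prop :=
  forall eps : R, 0 < eps ->
    P [set w | eps < `|Z n w - c|] @[n --> \oo] --> 0%E.

Definition weak_cvg_in_probability
    (mu_ : nat -> T -> {measure set R -> \bar R})
    (mu : {measure set R -> \bar R}) : Prop :=
  forall f : R -> R, continuous f -> bounded_fun f ->
    cvg_in_probability (fun n w => \int[mu_ n w]_x f x) (\int[mu]_x f x).

End weak_convergence.

Section eigenvalues_symmetric.
Context (R : realType).
Local Notation toC := (real_complex R).

Lemma eigenvaluesP n (A : 'M[R]_n) : A^T = A ->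
  char_poly A = \prod_(z <- eigenvalues A) ('X - z%:P).
Proof.
move=> Asym; pose AC := map_mx toC A.
have ACreal : AC \is a mxOver Num.real.
  by apply/mxOverP => i j; rewrite mxE; apply/complex_realP; exists (A i j).
have ACsym : AC \is symmetricmx.
  apply/is_hermitianmxP; rewrite scale1r; apply/matrixP => i j.
  by rewrite !mxE -[in LHS]Asym mxE.
have /orthomx_spectralP ACE := symmetric_normalmx ACsym ACreal.
have Dreal := hermitian_spectral_diag_real (realsym_hermsym ACsym ACreal).
set D := spectral_diag AC in ACE Dreal.
pose s := [seq complex.Re (D 0 i) | i <- enum 'I_n].
suff sP : char_poly A = \prod_(z <- s) ('X - z%:P).
  by rewrite /eigenvalues; case: xgetP => [t _ //|/(_ s)]; rewrite /= sP.
apply: (@map_poly_inj _ _ toC); rewrite map_char_poly -/AC.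
rewrite map_prod_XsubC /s big_map big_enum /=.
have Pu := spectral_unit AC; set Q := spectralmx AC in ACE Pu.
have -> : char_poly AC = char_poly (diag_mx D).
  pose CP := map_mx (@polyC R[i]).
  have QV : CP _ _ (invmx Q) *m CP _ _ Q = 1%:M.
    by rewrite -map_mxM mulVmx// map_mx1.
  rewrite /char_poly.
  have -> : char_poly_mx AC =
      CP _ _ (invmx Q) *m char_poly_mx (diag_mx D) *m CP _ _ Q.
    rewrite /char_poly_mx mulmxBr mulmxBl -!map_mxM -ACE.
    by rewrite scalar_mxC -mulmxA QV mulmx1.
  by rewrite !det_mulmx mulrAC -det_mulmx QV det1 mul1r.
rewrite char_poly_trig ?diag_mx_is_trig//; apply: eq_bigr => i _.
by rewrite mxE eqxx mulr1n RRe_real//; exact: (mxOverP Dreal).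
Qed.

End eigenvalues_symmetric.

(* Main.v *)
Require Import Defs.
From HB Require Import structures.
From mathcomp Require Import all_boot all_order all_algebra.
From mathcomp Require Import sesquilinear spectral complex.
From mathcomp Require Import all_classical all_reals all_analysis.
From mathcomp Require Import measurable_realfun.
From mathcomp Require Import ring lra.

Set Implicit Arguments.
Unset Strict Implicit.
Unset Printing Implicit Defensive.
Import Order.TTheory GRing.Theory Num.Theory.
Import numFieldNormedType.Exports.
Local Open Scope classical_set_scope.
Local Open Scope ring_scope.

(* Let z_i be the tensor product of the i-th rows of X / sx and Y / sy, let Z be
   the n x N matrix with rows z_i, where N = d p, and let S = Z^T Z / N. The
   normalised Hadamard product is Z Z^T / N, so for t > 0 the Stieltjes transform of
   mu_n at - t is an affine function of g = tr (S + t)^-1 / N.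
   - Removing z_i changes tr (S + t)^-1 by at most 1 / t and leaves a resolvent that is
     independent of z_i. Since the quadratic forms of z_i have small variance (fourth
     moments suffice), the Sherman-Morrison formula gives
     1 = t E[g] + (n / N) E[g] / (1 + E[g]) + o(1), which determines lim E[g].
   - By the same rank one bound, g is a function of n independent variables with
     differences O(1 / N), so its deviation probabilities decay exponentially in n
     and g converges almost surely by the Borel-Cantelli lemma. Convergence in
     probability follows from this.
   - The averages over independent rows are computed for finitely supported entries
     (quantise, centre, normalise) and pass to the limit by bounded convergence with n
     fixed.
   - The functions 1 / (x + t), t rational, span enough functions to give weak
     convergence on [0, +oo[; the transform of the Marchenko-Pastur law comes from an
     explicit primitive. *)

(** * Concentration on finite product spaces *)

(** The row z_i has d p coordinates built from only d + p independent variables, so its quadratic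
    forms may fluctuate more than those of a vector with independent coordinates: the variance is
    bounded by a multiple of d p (d + p) instead of d p. Divided by (d p)^2 this is of order 1 / d +
    1 / p, which still vanishes because p / d has a positive limit. The bound is obtained by
    averaging over the row of X with the row of Y frozen, and then over the row of Y. The spectral
    parameter - t with t > 0 keeps everything real and positive: the resolvent exists and is bounded
    by 1 / t, comparisons are inequalities between quadratic forms, and the limiting equation is
    strictly monotone in E[g], so approximate solutions converge without a compactness argument.
    With finite supports, conditional expectations are finite sums. The estimates depend on the law
    of the entries only through the fourth moment bound, hence are uniform in the fineness of the
    discretisation, and its error never has to be balanced against n. *)

Section finite_expectation.
Context (R : realType) (V : finType) (w : V -> R).
Implicit Types f g : V -> R.

Definition fexp f : R := \sum_v w v * f v.

Definition is_pmf := (forall v, 0 <= w v) /\ \sum_v w v = 1.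

Lemma eq_fexp f g : f =1 g -> fexp f = fexp g.
Proof. by move=> fg; apply: eq_bigr => v _; rewrite fg. Qed.

Lemma fexpD f g : fexp (fun v => f v + g v) = fexp f + fexp g.
Proof. by rewrite -big_split; apply: eq_bigr => v _; rewrite mulrDr. Qed.

Lemma fexpZ c f : fexp (fun v => c * f v) = c * fexp f.
Proof. by rewrite mulr_sumr; apply: eq_bigr => v _; rewrite mulrCA. Qed.

Lemma fexpZr c f : fexp (fun v => f v * c) = fexp f * c.
Proof. by rewrite mulr_suml; apply: eq_bigr => v _; rewrite mulrA. Qed.

Lemma fexpN f : fexp (fun v => - f v) = - fexp f.
Proof. by rewrite -sumrN; apply: eq_bigr => v _; rewrite mulrN. Qed.

Lemma fexpB f g : fexp (fun v => f v - g v) = fexp f - fexp g.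
Proof. by rewrite fexpD fexpN. Qed.

Lemma fexp_sum (I : finType) (F : I -> V -> R) :
  fexp (fun v => \sum_i F i v) = \sum_i fexp (F i).
Proof. by rewrite exchange_big; apply: eq_bigr => v _; rewrite mulr_sumr. Qed.

Hypothesis wP : is_pmf.

Lemma fexp_cst c : fexp (fun=> c) = c.
Proof. by rewrite /fexp -mulr_suml wP.2 mul1r. Qed.

Lemma ler_fexp f g : (forall v, f v <= g v) -> fexp f <= fexp g.
Proof. by move=> fg; apply: ler_sum => v _; rewrite ler_wpM2l// wP.1. Qed.

Lemma fexp_ge0 f : (forall v, 0 <= f v) -> 0 <= fexp f.
Proof. by move=> f0; apply: sumr_ge0 => v _; rewrite mulr_ge0// wP.1. Qed.

Lemma ler_norm_fexp f : `|fexp f| <= fexp (fun v => `|f v|).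
Proof.
rewrite (le_trans (ler_norm_sum _ _ _))//; apply: ler_sum => v _.
by rewrite normrM ger0_norm// wP.1.
Qed.

Lemma fexp_var f : fexp (fun v => (f v - fexp f) ^+ 2) = fexp (fun v => f v ^+ 2) - fexp f ^+ 2.
Proof.
transitivity (fexp (fun v => f v ^+ 2 - (2 * fexp f) * f v + fexp f ^+ 2)).
  by apply: eq_fexp => v; ring.
by rewrite fexpD fexpB fexpZ fexp_cst; ring.
Qed.

Lemma fexp_sqr_le f : fexp f ^+ 2 <= fexp (fun v => f v ^+ 2).
Proof. by rewrite -subr_ge0 -fexp_var; apply: fexp_ge0 => v; exact: sqr_ge0. Qed.

Lemma fexp_norm_le_sqrt f : fexp (fun v => `|f v|) <= Num.sqrt (fexp (fun v => f v ^+ 2)).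
Proof.
rewrite -[leLHS]ger0_norm; last exact: fexp_ge0.
rewrite -sqrtr_sqr ler_wsqrtr// (le_trans (fexp_sqr_le _))// ler_fexp// => v.
by rewrite real_normK ?num_real.
Qed.

End finite_expectation.

Section product_expectation.
Context (R : realType) (I V : finType) (w : V -> R).
Hypothesis wP : is_pmf w.
Implicit Types (r : {ffun I -> V}) (F G : {ffun I -> V} -> R).

Definition prod_pmf r : R := \prod_i w (r i).

Definition upd r i e : {ffun I -> V} := [ffun j => if j == i then e else r j].

Lemma upd_upd r i e e' : upd (upd r i e) i e' = upd r i e'.
Proof. by apply/ffunP => j; rewrite !ffunE; case: eqP. Qed.

Lemma upd_id r i : upd r i (r i) = r.
Proof. by apply/ffunP => j; rewrite !ffunE; case: eqP => [->|]. Qed.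

Lemma updC r i j e e' : i != j -> upd (upd r i e) j e' = upd (upd r j e') i e.
Proof.
move=> ij; apply/ffunP => k; rewrite !ffunE.
by case: eqVneq => [->|//]; rewrite eq_sym (negbTE ij).
Qed.

Lemma prod_pmfP : is_pmf prod_pmf.
Proof.
split=> [r|]; first by apply: prodr_ge0 => i _; exact: wP.1.
by rewrite -(bigA_distr_bigA (fun i v => w v)) big1// => i _; exact: wP.2.
Qed.

(* The conditional expectation of F given all coordinates but the i-th. *)
Definition E1 i F r : R := fexp w (fun e => F (upd r i e)).

(** The involution [h] swaps [r i] with an independent copy [e] and preserves the weight
    [prod_pmf r * w e]. *)
Lemma fexp_E1 i F : fexp prod_pmf (E1 i F) = fexp prod_pmf F.
Proof.
rewrite /fexp /E1 /fexp.
transitivity (\sum_(q : {ffun I -> V} * V) (prod_pmf q.1 * w q.2) * F (upd q.1 i q.2)).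
  rewrite -(pair_bigA _ (fun r e => prod_pmf r * w e * F (upd r i e))) /=.
  by apply: eq_bigr => r _; rewrite mulr_sumr; apply: eq_bigr => e _; rewrite mulrA.
pose h (q : {ffun I -> V} * V) := (upd q.1 i q.2, q.1 i).
have hK : involutive h.
  by case=> r e; rewrite /h /= upd_upd upd_id ffunE eqxx.
rewrite (reindex_inj (inv_inj hK)) /=.
transitivity (\sum_(q : {ffun I -> V} * V) (prod_pmf q.1 * w q.2) * F q.1).
  apply: eq_bigr => -[r e] _ /=; rewrite upd_upd upd_id; congr (_ * _).
  rewrite /prod_pmf (bigD1 i)//= [in RHS](bigD1 i)//= ffunE eqxx.
  rewrite (eq_bigr (fun j => w (r j))); last first.
    by move=> j /negbTE ji; rewrite ffunE ji.
  by ring.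
rewrite -(pair_bigA _ (fun r e => prod_pmf r * w e * F r)) /=.
apply: eq_bigr => r _; rewrite -mulr_suml -mulr_sumr wP.2 mulr1//.
Qed.

Lemma E1C i j F r : E1 i (E1 j F) r = E1 j (E1 i F) r.
Proof.
have [->//|ij] := eqVneq i j; rewrite /E1 /fexp.
under eq_bigr do rewrite mulr_sumr.
rewrite exchange_big /=; apply: eq_bigr => e _; rewrite mulr_sumr.
by apply: eq_bigr => e' _; rewrite (updC _ _ _ ij) mulrCA.
Qed.

Lemma E1_upd i F r e : E1 i F (upd r i e) = E1 i F r.
Proof. by apply: eq_bigr => e' _; rewrite upd_upd. Qed.

Lemma fexp_sqr_E1 i F : fexp prod_pmf (fun r => E1 i F r ^+ 2) <= fexp prod_pmf (fun r => F r ^+ 2).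
Proof.
rewrite -[leRHS](fexp_E1 i); apply: (ler_fexp prod_pmfP) => r.
exact: (fexp_sqr_le wP).
Qed.

(** Integrates out the coordinates in [s] one by one. The operators [E1 i] commute, so the
    martingale arguments below become inductions over a list, ending at the full expectation for
    [enum I]. *)
Definition Es (s : seq I) F : {ffun I -> V} -> R := foldr E1 F s.

Lemma eq_E1 i F G : F =1 G -> E1 i F =1 E1 i G.
Proof. by move=> FG r; apply: eq_fexp => e. Qed.

Lemma E1_Es i s F r : E1 i (Es s F) r = Es s (E1 i F) r.
Proof.
elim: s r => //= j s IH r; rewrite E1C; apply: eq_E1 => {}r; exact: IH.
Qed.

Lemma fexp_Es s F : fexp prod_pmf (Es s F) = fexp prod_pmf F.
Proof. by elim: s => //= i s IH; rewrite fexp_E1. Qed.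

Lemma Es_upd s F i r e : i \in s -> Es s F (upd r i e) = Es s F r.
Proof.
elim: s r => //= j s IH r; rewrite inE; have [-> _|ij /= si] := eqVneq i j.
  exact: E1_upd.
apply: eq_bigr => e' _; rewrite updC//; congr (_ * _); exact: IH.
Qed.

Lemma Es_enum F r : Es (enum I) F r = fexp prod_pmf F.
Proof.
rewrite -(fexp_Es (enum I)); set G := Es _ _.
(* From [r] to [r'] one coordinate at a time; each change is invisible to [G] by [Es_upd]. *)
suff cG : forall (l : seq I) r r', (forall j, j \notin l -> r j = r' j) -> G r = G r'.
  rewrite (@eq_fexp _ _ _ G (fun=> G r)); first by rewrite fexp_cst//; exact: prod_pmfP.
  by move=> r'; apply: (cG (enum I)) => j; rewrite mem_enum.
elim=> [|i l IH] {}r r' rr'; first by congr G; apply/ffunP => j; exact: rr'.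
rewrite /G -(@Es_upd _ _ i r (r' i)) ?mem_enum//; apply: IH => j jl; rewrite ffunE.
by case: eqVneq => [->//|ji]; apply: rr'; rewrite inE negb_or ji.
Qed.

Lemma fexpM_E1 i F G : (forall r e, G (upd r i e) = G r) ->
  fexp prod_pmf (fun r => F r * G r) = fexp prod_pmf (fun r => E1 i F r * G r).
Proof.
move=> Gi; rewrite -(fexp_E1 i); apply: eq_fexp => r.
rewrite /E1 -fexpZr; apply: eq_fexp => e; by rewrite Gi.
Qed.

(** [E1 i] is an orthogonal projection, so the squared norms of [F] and [E1 i F] differ by that of
    [F - E1 i F]. The induction continues with [E1 i F], whose differences are [E1 i]-averages of
    those of [F], hence no larger in mean square. *)
Lemma efron_stein_seq s F :
  fexp prod_pmf (fun r => F r ^+ 2) - fexp prod_pmf (fun r => Es s F r ^+ 2) <=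
  \sum_(i <- s) fexp prod_pmf (fun r => (F r - E1 i F r) ^+ 2).
Proof.
elim: s F => [|i s IH] F /=; first by rewrite big_nil subrr.
rewrite big_cons.
have -> : fexp prod_pmf (fun r => E1 i (Es s F) r ^+ 2) =
    fexp prod_pmf (fun r => Es s (E1 i F) r ^+ 2).
  by apply: eq_fexp => r; rewrite E1_Es.
have -> : fexp prod_pmf (fun r => (F r - E1 i F r) ^+ 2) =
    fexp prod_pmf (fun r => F r ^+ 2) - fexp prod_pmf (fun r => E1 i F r ^+ 2).
  transitivity (fexp prod_pmf (fun r => F r ^+ 2 - 2 * (F r * E1 i F r) + E1 i F r ^+ 2)).
    by apply: eq_fexp => r; ring.
  rewrite fexpD fexpB fexpZ (@fexpM_E1 i F (E1 i F)); last by move=> *; exact: E1_upd.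
  rewrite (@eq_fexp _ _ _ (fun r => E1 i F r * E1 i F r) (fun r => E1 i F r ^+ 2))//.
  by ring.
set a := fexp _ _; set b := fexp _ _; set c := fexp _ _.
have -> : a - b = (a - c) + (c - b) by ring.
rewrite lerD2l (le_trans (IH _))//; apply: ler_sum => j _.
rewrite (@eq_fexp _ _ _ _ (fun r => E1 i (fun r => F r - E1 j F r) r ^+ 2)).
  exact: fexp_sqr_E1.
by move=> r; rewrite E1C /E1 -fexpB.
Qed.

Lemma efron_stein F :
  fexp prod_pmf (fun r => (F r - fexp prod_pmf F) ^+ 2) <=
  \sum_i fexp prod_pmf (fun r => (F r - E1 i F r) ^+ 2).
Proof.
rewrite fexp_var; last exact: prod_pmfP.
have := efron_stein_seq (enum I) F; rewrite big_enum /=.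
rewrite (@eq_fexp _ _ _ (fun r => Es _ F r ^+ 2) (fun=> fexp prod_pmf F ^+ 2)).
  by rewrite fexp_cst//; exact: prod_pmfP.
by move=> r; rewrite Es_enum.
Qed.

(** From [1 - x <= expR (- x)] one gets [expR x <= 1 / (1 - x)], and [(1 + x + 2 x^2) (1 - x) = 1 +
    x^2 (1 - 2 x)] is at least 1 for [x <= 1 / 2]. *)
Lemma expR_le_quadratic (x : R) : `|x| <= 2^-1 -> expR x <= 1 + x + 2 * x ^+ 2.
Proof.
rewrite ler_norml => /andP[_ x1].
have h : expR x * (1 - x) <= 1.
  by rewrite -[leRHS](expRxMexpNx_1 x) ler_wpM2l ?expR_ge0// expR_ge1Dx.
have x1' : 0 < 1 - x by lra.
rewrite -(ler_pM2r x1') (le_trans h)//.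
suff : 0 <= x ^+ 2 * (1 - 2 * x) by lra.
by rewrite mulr_ge0 ?sqr_ge0//; lra.
Qed.

(** Given the other coordinates, [F - E1 i F] has mean 0 and is bounded by [c], so its exponential
    moment is at most [1 + 2 (l c)^2]; the smallness of [l c] allows this quadratic bound in place
    of Hoeffding's lemma. The remaining factor does not involve coordinate [i], and [E1 i F]
    inherits the bounded differences. *)
Lemma mcdiarmid_seq s F (c l : R) : 0 <= c -> `|l| * c <= 2^-1 -> uniq s ->
  (forall i r, `|F r - E1 i F r| <= c) ->
  fexp prod_pmf (fun r => expR (l * (F r - Es s F r))) <=
  expR ((size s)%:R * (2 * (l * c) ^+ 2)).
Proof.
move=> c0 lc; elim: s F => [|i s IH] F /=.
  move=> _ _; rewrite mul0r expR0 (@eq_fexp _ _ _ _ (fun=> 1)).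
    by rewrite fexp_cst//; exact: prod_pmfP.
  by move=> r; rewrite subrr mulr0 expR0.
move=> /andP[iNs us] bF.
pose G := E1 i F.
have bG j r : `|G r - E1 j G r| <= c.
  rewrite /G E1C /E1 -fexpB (le_trans (ler_norm_fexp wP _))//.
  rewrite -[leRHS](fexp_cst wP); apply: (ler_fexp wP) => e; exact: bF.
have sGi r e : Es s G (upd r i e) = Es s G r.
  by rewrite /G -!E1_Es E1_upd.
rewrite (@eq_fexp _ _ _ _ (fun r => expR (l * (F r - G r)) * expR (l * (G r - Es s G r)))); last first.
  by move=> r; rewrite -expRD E1_Es -/G; congr expR; ring.
rewrite (@fexpM_E1 i); last by move=> r e; rewrite sGi /G E1_upd.
rewrite -[_.+1]add1n natrD mulrDl mul1r expRD.
apply: (@le_trans _ _ (fexp prod_pmf (fun r => expR (2 * (l * c) ^+ 2) * expR (l * (G r - Es s G r))))).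
  apply: (ler_fexp prod_pmfP) => r; rewrite ler_wpM2r ?expR_ge0//.
  rewrite {1}/E1 /G.
  apply: (@le_trans _ _ (fexp w (fun e => 1 + l * (F (upd r i e) - E1 i F r) + 2 * (l * c) ^+ 2))).
    apply: (ler_fexp wP) => e; rewrite E1_upd; have /= := bF i (upd r i e).
    rewrite E1_upd; set D := F _ - _ => bD.
    have lD : `|l * D| <= `|l| * c by rewrite normrM ler_wpM2l.
    rewrite (le_trans (expR_le_quadratic (le_trans lD lc)))// lerD2l ler_wpM2l//.
    rewrite -[leLHS]real_normK ?num_real// -[leRHS]real_normK ?num_real//.
    rewrite ler_sqr ?nnegrE// (le_trans lD)// normrM ler_wpM2l// ler_norm//.
  rewrite !fexpD !(fexp_cst wP) fexpZ fexpB (fexp_cst wP) /E1 subrr mulr0 addr0.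
  exact: expR_ge1Dx.
by rewrite fexpZ ler_pM2l ?expR_gt0//; exact: IH.
Qed.

Lemma mcdiarmid F (c l : R) : 0 <= c -> `|l| * c <= 2^-1 ->
  (forall i r, `|F r - E1 i F r| <= c) ->
  fexp prod_pmf (fun r => expR (l * (F r - fexp prod_pmf F))) <=
  expR (#|I|%:R * (2 * (l * c) ^+ 2)).
Proof.
move=> c0 lc bF; rewrite cardE.
rewrite (@eq_fexp _ _ _ _ (fun r => expR (l * (F r - Es (enum I) F r)))).
  by apply: mcdiarmid_seq => //; exact: enum_uniq.
by move=> r; rewrite Es_enum.
Qed.

End product_expectation.

(** * Resolvents of Gram matrices *)

Section resolvent.
Context (R : realType) (t : R).
Hypothesis t0 : 0 < t.

Definition qf n (B : 'M[R]_n) (v : 'rV[R]_n) : R := (v *m B *m v^T) 0 0.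

Definition sqn n (v : 'rV[R]_n) : R := (v *m v^T) 0 0.

Definition psd n (B : 'M[R]_n) := B^T = B /\ forall v, 0 <= qf B v.

Definition resolvent n (B : 'M[R]_n) : 'M[R]_n := invmx (B + t%:M).

Lemma sqnE n (v : 'rV[R]_n) : sqn v = \sum_j v 0 j ^+ 2.
Proof. by rewrite /sqn mxE; apply: eq_bigr => j _; rewrite mxE expr2. Qed.

Lemma sqn_ge0 n (v : 'rV[R]_n) : 0 <= sqn v.
Proof. by rewrite sqnE; apply: sumr_ge0 => j _; exact: sqr_ge0. Qed.

Lemma sqn_eq0 n (v : 'rV[R]_n) : sqn v = 0 -> v = 0.
Proof.
rewrite sqnE => /eqP; rewrite psumr_eq0; last by move=> j _; exact: sqr_ge0.
move=> /allP v0; apply/rowP => j; rewrite mxE; apply/eqP; rewrite -sqrf_eq0; exact: (v0 j (mem_index_enum j)).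
Qed.

Lemma sqn_delta n (j : 'I_n) : sqn (delta_mx 0 j) = 1.
Proof. by rewrite /sqn trmx_delta mul_delta_mx mxE !eqxx. Qed.

Lemma qfD n (B B' : 'M[R]_n) v : qf (B + B') v = qf B v + qf B' v.
Proof. by rewrite /qf mulmxDr mulmxDl mxE. Qed.

Lemma qfZ n c (B : 'M[R]_n) v : qf (c *: B) v = c * qf B v.
Proof. by rewrite /qf -scalemxAr -scalemxAl mxE. Qed.

Lemma qf_scalar n (v : 'rV[R]_n) : qf t%:M v = t * sqn v.
Proof. by rewrite /qf mul_mx_scalar -scalemxAl mxE. Qed.

Lemma qf_gram m n (Z : 'M[R]_(m, n)) v : qf (Z^T *m Z) v = sqn (v *m Z^T).
Proof. by rewrite /qf /sqn trmx_mul trmxK !mulmxA. Qed.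

Lemma psd_gram m n (Z : 'M[R]_(m, n)) : psd (Z^T *m Z).
Proof.
by split=> [|v]; [rewrite trmx_mul trmxK|rewrite qf_gram sqn_ge0].
Qed.

Lemma psdD n (B B' : 'M[R]_n) : psd B -> psd B' -> psd (B + B').
Proof.
move=> [sB pB] [sB' pB']; split=> [|v]; first by rewrite raddfD /= sB sB'.
by rewrite qfD addr_ge0.
Qed.

Lemma psdZ n c (B : 'M[R]_n) : 0 <= c -> psd B -> psd (c *: B).
Proof.
move=> c0 [sB pB]; split=> [|v]; first by rewrite linearZ /= sB.
by rewrite qfZ mulr_ge0.
Qed.

Lemma psd0 n : psd (0 : 'M[R]_n).
Proof. by split=> [|v]; rewrite ?trmx0// /qf mulmx0 mul0mx mxE. Qed.

Lemma psd_sum n (I : Type) (s : seq I) (Q : pred I) (B : I -> 'M[R]_n) :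
  (forall i, psd (B i)) -> psd (\sum_(i <- s | Q i) B i).
Proof. by move=> pB; elim/big_ind : _ => //; [exact: psd0|exact: psdD]. Qed.

(** A left kernel vector [v] satisfies [qf B v + t * sqn v = 0], which forces [v = 0]. *)
Lemma resolvent_unit n (B : 'M[R]_n) : psd B -> B + t%:M \in unitmx.
Proof.
move=> [sB pB]; rewrite -row_free_unit -kermx_eq0; apply/eqP/row_matrixP => i.
rewrite row0; set v := row i _; apply: sqn_eq0.
have vB : v *m (B + t%:M) = 0 by apply/sub_kermxP; exact: row_sub.
have : qf (B + t%:M) v = 0 by rewrite /qf vB mul0mx mxE.
rewrite qfD qf_scalar => h; apply/eqP; rewrite eq_le sqn_ge0 andbT.
by rewrite -(pmulr_rle0 _ t0) -h lerDr.
Qed.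

Section fixed.
Context n (B : 'M[R]_n).
Hypothesis pB : psd B.
Let Q := resolvent B.

Lemma resolventVl : Q *m (B + t%:M) = 1%:M.
Proof. by rewrite mulVmx// resolvent_unit. Qed.

Lemma resolventVr : (B + t%:M) *m Q = 1%:M.
Proof. by rewrite mulmxV// resolvent_unit. Qed.

Lemma resolvent_sym : Q^T = Q.
Proof. by rewrite /Q /resolvent trmx_inv raddfD /= tr_scalar_mx pB.1. Qed.

(** With [v = u Q], so that [u = v (B + t)], one has [qf Q u = qf B v + t |v|^2]. The bounds on the
    resolvent below rest on this identity. *)
Lemma resolvent_qf_ge u : t * sqn (u *m Q) <= qf Q u.
Proof.
have -> : qf Q u = qf B (u *m Q) + t * sqn (u *m Q).
  rewrite -qf_scalar -qfD /qf trmx_mul resolvent_sym -!mulmxA.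
  by rewrite (mulmxA (B + _)) resolventVr mul1mx.
by rewrite lerDr pB.2.
Qed.

Lemma resolvent_qf_ge0 u : 0 <= qf Q u.
Proof. by rewrite (le_trans _ (resolvent_qf_ge u))// mulr_ge0 ?sqn_ge0// ltW. Qed.

Lemma qf_le_sqn (v u : 'rV[R]_n) : 2 * (v *m u^T) 0 0 <= t * sqn v + sqn u / t.
Proof.
have : 0 <= t^-1 * sqn (t *: v - u) by rewrite mulr_ge0 ?sqn_ge0// invr_ge0 ltW.
have -> : sqn (t *: v - u) = t ^+ 2 * sqn v - 2 * t * (v *m u^T) 0 0 + sqn u.
  rewrite !sqnE !mxE !mulr_sumr -sumrB -big_split /=; apply: eq_bigr => j _.
  by rewrite !mxE; ring.
move=> h; rewrite -subr_ge0; apply: le_trans h _.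
rewrite le_eqVlt; apply/orP; left; apply/eqP; field; exact: lt0r_neq0.
Qed.

(** [2 t |u Q|^2 <= 2 qf Q u <= t |u Q|^2 + |u|^2 / t]: the operator norm is at most 1 / t, without
    diagonalisation. *)
Lemma sqn_resolvent u : sqn (u *m Q) <= sqn u / t ^+ 2.
Proof.
have h1 := resolvent_qf_ge u.
have h2 : 2 * qf Q u <= t * sqn (u *m Q) + sqn u / t by exact: qf_le_sqn.
have t20 : 0 < t by [].
rewrite -(ler_pM2l t0).
have -> : t * (sqn u / t ^+ 2) = sqn u / t by field; exact: lt0r_neq0.
lra.
Qed.

Lemma qf_delta j : qf Q (delta_mx 0 j) = Q j j.
Proof. by rewrite /qf -rowE trmx_delta -colE !mxE. Qed.

Lemma resolvent_diag_le j : Q j j <= t^-1.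
Proof.
have h2 : 2 * qf Q (delta_mx 0 j) <= t * sqn (delta_mx 0 j *m Q) + sqn (delta_mx 0 j : 'rV[R]_n) / t.
  exact: qf_le_sqn.
have h1 := resolvent_qf_ge (delta_mx 0 j).
move: h1 h2; rewrite sqn_delta qf_delta => h1 h2; rewrite mul1r in h2; lra.
Qed.

Lemma resolvent_trace_ge0 : 0 <= \tr Q.
Proof. by apply: sumr_ge0 => j _; rewrite -qf_delta resolvent_qf_ge0. Qed.

Lemma resolvent_trace_le : \tr Q <= n%:R / t.
Proof.
rewrite (@le_trans _ _ (\sum_(j < n) t^-1))//.
  by apply: ler_sum => j _; exact: resolvent_diag_le.
by rewrite sumr_const card_ord -[leLHS]mulr_natl.
Qed.

End fixed.

Section rank_one.
Context n (B : 'M[R]_n) (c : R) (z : 'rV[R]_n).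
Hypotheses (pB : psd B) (c0 : 0 <= c).
Let B' := B + c *: (z^T *m z).
Let Q := resolvent B.
Let Q' := resolvent B'.
Let q := c * qf Q z.

Lemma psd_rank_one : psd B'.
Proof. by apply: psdD => //; apply: psdZ => //; exact: psd_gram. Qed.

Let q0 : 0 <= q.
Proof. by rewrite mulr_ge0// resolvent_qf_ge0. Qed.

Let QQ' : Q - Q' = c *: (Q *m z^T *m (z *m Q')).
Proof.
transitivity (Q *m ((B' + t%:M) - (B + t%:M)) *m Q').
  rewrite mulmxBr mulmxBl (resolventVl pB) mul1mx -mulmxA.
  by rewrite (resolventVr psd_rank_one) mulmx1.
rewrite /B' opprD addrACA subrr addr0 addrAC subrr add0r.
by rewrite -scalemxAr -scalemxAl !mulmxA.
Qed.

(** The Sherman-Morrison formula multiplied by [z], in a form without division. *)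
Let zQ' : z *m Q = (1 + q) *: (z *m Q').
Proof.
have /(congr1 (mulmx z)) := QQ'.
rewrite mulmxBr -scalemxAr -mulmxA !mulmxA.
rewrite -[z *m Q *m z^T *m z *m Q']mulmxA [z *m Q *m z^T]mx11_scalar -/(qf Q z).
rewrite mul_scalar_mx scalerA -/q => /eqP; rewrite subr_eq => /eqP ->.
by rewrite scalerDl scale1r addrC.
Qed.

Lemma qf_rank_one : c * qf Q' z = q / (1 + q).
Proof.
have /(congr1 (fun u => (u *m z^T) 0 0)) := zQ'.
rewrite -scalemxAl !mxE -/(qf _ _) => h.
have q1 : 1 + q != 0 by rewrite lt0r_neq0// ltr_wpDr.
have -> : q = c * ((1 + q) * qf Q' z) by rewrite /qf [in RHS]mxE -h {1}/q /qf mxE.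
have -> : qf Q' z = qf Q z / (1 + q).
  by rewrite /qf !mxE h mulrAC divff// mul1r.
rewrite [(1 + q) * _]mulrC divfK// -/q mulrA//.
Qed.

(** The difference of the traces is [c |z Q|^2 / (1 + q)], and [t |z Q|^2 <= qf Q z] bounds it by
    [(1 / t) q / (1 + q)]. The bound is uniform in [z], which yields bounded differences for rows of
    arbitrary size. *)
Lemma trace_rank_one : 0 <= \tr Q - \tr Q' <= t^-1.
Proof.
have q1 : 0 < 1 + q by rewrite ltr_wpDr.
have e : \tr Q - \tr Q' = c * sqn (z *m Q) / (1 + q).
  rewrite -raddfB /= QQ' linearZ /= mxtrace_mulC.
  have -> : z *m Q' = (1 + q)^-1 *: (z *m Q).
    by rewrite zQ' scalerA mulVf ?scale1r// gt_eqF.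
  rewrite -scalemxAl linearZ /= trace_mx11 /sqn trmx_mul (resolvent_sym pB).
  by rewrite -/Q -mulrA [_ * (1 + q)^-1]mulrC.
rewrite e; apply/andP; split.
  by rewrite divr_ge0// ?(ltW q1)// mulr_ge0// sqn_ge0.
rewrite ler_pdivrMr// -(ler_pM2l t0) [leRHS]mulrA mulfV ?gt_eqF// mul1r mulrCA.
rewrite (le_trans (ler_wpM2l c0 (resolvent_qf_ge pB z)))//.
by rewrite -/q lerDr.
Qed.

End rank_one.

(** [Z Z^T] and [Z^T Z] share their nonzero spectrum. Here this takes the form of the push-through
    relation [Z^T (A + t)^-1 = (B + t)^-1 Z^T], which equates the traces of [A (A + t)^-1] and
    [(B + t)^-1 B]. *)
Lemma trace_resolvent_gram m n (c : R) (Z : 'M[R]_(m, n)) : 0 <= c ->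
  \tr (resolvent (c *: (Z *m Z^T))) =
  \tr (resolvent (c *: (Z^T *m Z))) + (m%:R - n%:R) / t.
Proof.
move=> c0; set A := c *: (Z *m Z^T); set B := c *: (Z^T *m Z).
have pA : psd A by apply: psdZ => //; rewrite -{1}[Z]trmxK; exact: psd_gram.
have pB : psd B by apply: psdZ => //; exact: psd_gram.
have push : Z^T *m resolvent A = resolvent B *m Z^T.
  have : (B + t%:M) *m Z^T = Z^T *m (A + t%:M).
    rewrite mulmxDl mulmxDr /A /B -scalemxAl -scalemxAr mulmxA.
    by rewrite mul_scalar_mx mul_mx_scalar.
  move=> /(congr1 (fun u => resolvent B *m u *m resolvent A)).
  rewrite !mulmxA (resolventVl pB) mul1mx => ->.
  by rewrite -mulmxA (resolventVr pA) mulmx1.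
have tA : t * \tr (resolvent A) = m%:R - \tr (A *m resolvent A).
  have := resolventVr pA; rewrite mulmxDl => /(congr1 mxtrace).
  by rewrite raddfD /= mxtrace1 mul_scalar_mx linearZ /= => <-; rewrite [_ + t * _]addrC addrK.
have tB : t * \tr (resolvent B) = n%:R - \tr (resolvent B *m B).
  have := resolventVl pB; rewrite mulmxDr => /(congr1 mxtrace).
  by rewrite raddfD /= mxtrace1 mul_mx_scalar mxtraceZ => <-; rewrite [_ + t * _]addrC addrK.
have e : \tr (A *m resolvent A) = \tr (resolvent B *m B).
  rewrite /A /B -scalemxAl -scalemxAr !linearZ /= -mulmxA push.
  by rewrite mxtrace_mulC mulmxA.
apply: (mulfI (lt0r_neq0 t0)).
rewrite tA e mulrDr tB mulrCA mulfV ?gt_eqF//; by ring.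
Qed.

End resolvent.

(** * Variance of quadratic forms of a row *)

(** Lagrange's identity: twice the defect is the double sum of the squares of
    [a i * b j - a j * b i]. *)
Lemma cauchy_schwarz_sum (R : realType) (I : finType) (a b : I -> R) :
  (\sum_i a i * b i) ^+ 2 <= (\sum_i a i ^+ 2) * (\sum_i b i ^+ 2).
Proof.
have : 0 <= \sum_i \sum_j (a i * b j - a j * b i) ^+ 2.
  by apply: sumr_ge0 => i _; apply: sumr_ge0 => j _; exact: sqr_ge0.
have -> : \sum_i \sum_j (a i * b j - a j * b i) ^+ 2 =
   2 * ((\sum_i a i ^+ 2) * (\sum_i b i ^+ 2)) - 2 * (\sum_i a i * b i) ^+ 2.
  transitivity (\sum_i \sum_j (a i ^+ 2 * b j ^+ 2) + \sum_i \sum_j (b i ^+ 2 * a j ^+ 2)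
     - 2 * \sum_i \sum_j ((a i * b i) * (a j * b j))).
    rewrite mulr_sumr -big_split -sumrB /=; apply: eq_bigr => i _.
    rewrite mulr_sumr -big_split -sumrB /=; apply: eq_bigr => j _; ring.
  by rewrite -!big_distrlr /=; ring.
by move=> h; lra.
Qed.

Definition frob (R : realType) m n (A : 'M[R]_(m, n)) : R := \sum_i \sum_j A i j ^+ 2.

(** [b] stands for the squared operator norm; unit vectors pick out the rows. *)
Lemma frob_le_op (R : realType) n (A : 'M[R]_n) (b : R) :
  (forall u, sqn (u *m A) <= sqn u * b) -> frob A <= n%:R * b.
Proof.
move=> Ab; have -> : n%:R * b = \sum_(i < n) b by rewrite sumr_const card_ord mulr_natl.
apply: ler_sum => i _.
have := Ab (delta_mx 0 i); rewrite sqn_delta mul1r; apply: le_trans.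
by rewrite sqnE -rowE; apply: ler_sum => j _; rewrite mxE.
Qed.

Lemma qfE (R : realType) n (B : 'M[R]_n) v : qf B v = \sum_i \sum_j v 0 i * v 0 j * B i j.
Proof.
rewrite /qf mxE; under eq_bigr => j _ do rewrite !mxE mulr_suml.
rewrite exchange_big /=; apply: eq_bigr => i _; apply: eq_bigr => j _; ring.
Qed.

Section quadratic_form_variance.
Context (R : realType) (V : finType) (w : V -> R) (v : V -> R) (C : R) (d : nat).
Hypotheses (wP : is_pmf w) (v1 : fexp w v = 0) (v2 : fexp w (fun e => v e ^+ 2) = 1)
  (v4 : fexp w (fun e => v e ^+ 4) <= C).
Let pw := @prod_pmf R 'I_d V w.
Let pwP : is_pmf pw := prod_pmfP _ wP.
Implicit Types (r : {ffun 'I_d -> V}) (B : 'M[R]_d).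

Definition vals r : 'rV[R]_d := \row_j v (r j).

Lemma fexp_coord i (f : V -> R) : fexp pw (fun r => f (r i)) = fexp w f.
Proof.
rewrite /pw -(fexp_E1 wP i) -[RHS](fexp_cst pwP); apply: eq_fexp => r.
by apply: eq_fexp => e; rewrite ffunE eqxx.
Qed.

Lemma moment4_ge0 : 0 <= C.
Proof.
by apply: le_trans v4; apply: (fexp_ge0 wP) => e; rewrite (exprM _ 2 2) sqr_ge0.
Qed.

Lemma fexp_linear_sqr (b : 'I_d -> R) :
  fexp pw (fun r => (\sum_j b j * v (r j)) ^+ 2) <= \sum_j b j ^+ 2.
Proof.
pose F r := \sum_j b j * v (r j).
have F0 : fexp pw F = 0.
  rewrite fexp_sum big1// => j _; rewrite fexpZ (fexp_coord j v).
  by rewrite v1 mulr0.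
have := efron_stein wP F; rewrite -/pw F0 => h.
rewrite (@eq_fexp _ _ _ _ (fun r => (F r - 0) ^+ 2)); last by move=> r; rewrite subr0.
apply: le_trans h _; apply: ler_sum => j _.
rewrite (@eq_fexp _ _ _ _ (fun r => b j ^+ 2 * v (r j) ^+ 2)).
  by rewrite fexpZ (fexp_coord j (fun e => v e ^+ 2)) v2 mulr1.
move=> r; suff -> : F r - E1 w j F r = b j * v (r j) by rewrite exprMn.
have -> : E1 w j F r = \sum_(k | k != j) b k * v (r k).
  transitivity (fexp w (fun e => b j * v e + \sum_(k | k != j) b k * v (r k))).
    apply: eq_fexp => e; rewrite /F (bigD1 j)//= ffunE eqxx; congr (_ + _).
    by apply: eq_bigr => k /negbTE kj; rewrite ffunE kj.
  by rewrite fexpD fexpZ v1 mulr0 add0r (fexp_cst wP).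
by rewrite /F (bigD1 j)//= addrK.
Qed.

Lemma fexp_qf B : fexp pw (fun r => qf B (vals r)) = \tr B.
Proof.
under eq_fexp do rewrite qfE.
rewrite fexp_sum; apply: eq_bigr => i _; rewrite fexp_sum (bigD1 i)//= big1 ?addr0.
  under eq_fexp do rewrite !mxE -expr2.
  by rewrite fexpZr (fexp_coord i (fun e => v e ^+ 2)) v2 mul1r.
move=> j ji; under eq_fexp do rewrite !mxE.
rewrite fexpZr /pw (fexpM_E1 wP (i := i)); last first.
  by move=> r e; rewrite ffunE (negbTE ji).
rewrite (@eq_fexp _ _ _ _ (fun=> 0)) ?(fexp_cst pwP) ?mul0r// => r.
rewrite (_ : E1 w i _ r = 0) ?mul0r// -[RHS]v1; apply: eq_fexp => e.
by rewrite ffunE eqxx.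
Qed.

Section one_coordinate.
Context B (i : 'I_d).
Hypothesis Bsym : B^T = B.

(** As a function of coordinate [i], [qf B (vals r)] is a quadratic polynomial with coefficients
    [B i i], [2 L] and [K]. Zeroing the diagonal term keeps [L] a sum over all [j], to which
    [fexp_linear_sqr] applies. *)
Let L r := \sum_j (if j == i then 0 else B i j) * v (r j).

Let K r := \sum_(k | k != i) \sum_(j | j != i) v (r k) * v (r j) * B k j.

Let qf_split r : qf B (vals r) = B i i * v (r i) ^+ 2 + 2 * (v (r i) * L r) + K r.
Proof.
rewrite qfE (bigD1 i)//= (bigD1 i)//=.
have LE : L r = \sum_(j | j != i) B i j * v (r j).
  rewrite /L (bigD1 i)//= eqxx mul0r add0r; apply: eq_bigr => j /negbTE ->//.
have -> : \sum_(k | k != i) \sum_j vals r 0 k * vals r 0 j * B k j =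
    v (r i) * L r + K r.
  rewrite LE mulr_sumr /K -big_split /=; apply: eq_bigr => k ki.
  rewrite (bigD1 i)//= !mxE; congr (_ + _).
    by rewrite -[B in LHS]Bsym mxE; ring.
  by apply: eq_bigr => j _; rewrite !mxE.
have -> : \sum_(j | j != i) vals r 0 i * vals r 0 j * B i j = v (r i) * L r.
  by rewrite LE mulr_sumr; apply: eq_bigr => j _; rewrite !mxE; ring.
by rewrite !mxE; ring.
Qed.

Let L_upd r e : L (upd r i e) = L r.
Proof.
by apply: eq_bigr => j _; case: ifP => [|ji]; rewrite ?mul0r// ffunE ji.
Qed.

Let K_upd r e : K (upd r i e) = K r.
Proof.
apply: eq_bigr => k /negbTE ki; apply: eq_bigr => j /negbTE ji.
by rewrite !ffunE ki ji.
Qed.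

Let qf_E1 r : qf B (vals r) - E1 w i (fun r => qf B (vals r)) r =
  B i i * (v (r i) ^+ 2 - 1) + 2 * (v (r i) * L r).
Proof.
have -> : E1 w i (fun r => qf B (vals r)) r = B i i + K r.
  transitivity (fexp w (fun e => B i i * v e ^+ 2 + (2 * L r) * v e + K r)).
    by apply: eq_fexp => e; rewrite qf_split L_upd K_upd ffunE eqxx; ring.
  by rewrite !fexpD !fexpZ v1 v2 (fexp_cst wP); ring.
by rewrite qf_split; ring.
Qed.

(** Subtracting the mean over coordinate [i] leaves [B i i (v^2 - 1) + 2 v L], whose square is at
    most [2 (B i i)^2 (v^2 - 1)^2 + 8 v^2 L^2]. Here [E (v^2 - 1)^2 <= C] and, since [L] does not
    involve coordinate [i], [E (v^2 L^2) = E L^2]; hence the constants [2 C] and 8. *)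
Lemma qf_coordinate_variance :
  fexp pw (fun r => (qf B (vals r) - E1 w i (fun r => qf B (vals r)) r) ^+ 2) <=
  (2 * C + 8) * \sum_j B i j ^+ 2.
Proof.
have C0 := moment4_ge0.
apply: (@le_trans _ _ (fexp pw (fun r =>
    2 * B i i ^+ 2 * (v (r i) ^+ 2 - 1) ^+ 2 + 8 * (v (r i) ^+ 2 * L r ^+ 2)))).
  apply: (ler_fexp pwP) => r; rewrite qf_E1 -subr_ge0.
  set x := v _; set y := L r; set b := B i i.
  have -> : 2 * b ^+ 2 * (x ^+ 2 - 1) ^+ 2 + 8 * (x ^+ 2 * y ^+ 2) -
    (b * (x ^+ 2 - 1) + 2 * (x * y)) ^+ 2 = (b * (x ^+ 2 - 1) - 2 * (x * y)) ^+ 2 by ring.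
  exact: sqr_ge0.
rewrite fexpD !fexpZ (fexp_coord i (fun e => (v e ^+ 2 - 1) ^+ 2)).
have h1 : fexp w (fun e => (v e ^+ 2 - 1) ^+ 2) <= C.
  rewrite (@eq_fexp _ _ _ _ (fun e => v e ^+ 4 - 2 * v e ^+ 2 + 1)); last by move=> e; ring.
  by rewrite fexpD fexpB fexpZ v2 (fexp_cst wP); move: v4; lra.
have h2 : fexp pw (fun r => v (r i) ^+ 2 * L r ^+ 2) <= \sum_(j | j != i) B i j ^+ 2.
  rewrite /pw (fexpM_E1 wP (i := i)); last by move=> r e; rewrite L_upd.
  rewrite (@eq_fexp _ _ _ _ (fun r => L r ^+ 2)).
    apply: le_trans (fexp_linear_sqr _) _; rewrite (bigD1 i)//= eqxx expr0n add0r.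
    by apply: ler_sum => j /negbTE ->.
  move=> r; rewrite (_ : E1 w i _ r = 1) ?mul1r// -[RHS]v2; apply: eq_fexp => e.
  by rewrite ffunE eqxx.
have s0 : 0 <= \sum_(j | j != i) B i j ^+ 2 by apply: sumr_ge0 => j _; exact: sqr_ge0.
rewrite (bigD1 i)//= mulrDr.
set S := \sum_(j | _) _ in h2 s0 *.
set f1 := fexp w _ in h1 *; set f2 := fexp pw _ in h2 *.
have k1 : B i i ^+ 2 * f1 <= B i i ^+ 2 * C by rewrite ler_wpM2l ?sqr_ge0.
have k2 : 0 <= C * S by rewrite mulr_ge0.
have k3 := sqr_ge0 (B i i).
rewrite -mulrA; lra.
Qed.

End one_coordinate.

Lemma qf_variance B : B^T = B ->
  fexp pw (fun r => (qf B (vals r) - \tr B) ^+ 2) <= (2 * C + 8) * frob B.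
Proof.
move=> Bsym; have := efron_stein wP (fun r => qf B (vals r)).
rewrite -/pw fexp_qf => h; apply: le_trans h _; rewrite mulr_sumr.
by apply: ler_sum => i _; exact: qf_coordinate_variance.
Qed.

Lemma fexp_sqn_sqr : fexp pw (fun r => sqn (vals r) ^+ 2) <= C * d%:R ^+ 2.
Proof.
apply: (@le_trans _ _ (fexp pw (fun r => d%:R * \sum_j v (r j) ^+ 4))).
  apply: (ler_fexp pwP) => r; have := cauchy_schwarz_sum (fun=> 1) (fun j => v (r j) ^+ 2).
  rewrite sqnE; under eq_bigr do rewrite mul1r.
  under [\sum_i 1 ^+ 2]eq_bigr do rewrite expr1n.
  rewrite sumr_const card_ord; under [X in _ -> _ <= _ * X]eq_bigr do rewrite (exprM _ 2 2).
  by under [X in _ -> X ^+ 2 <= _]eq_bigr do rewrite mxE.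
rewrite fexpZ fexp_sum expr2 mulrA [C * _]mulrC -mulrA ler_wpM2l//.
under eq_bigr => j _ do rewrite (fexp_coord j (fun e => v e ^+ 4)).
rewrite (@le_trans _ _ (\sum_(j < d) C))//; first exact: ler_sum.
by rewrite sumr_const card_ord -[leLHS]mulr_natr.
Qed.

End quadratic_form_variance.

Section pair_expectation.
Context (R : realType) (U V : finType) (wu : U -> R) (wv : V -> R).
Hypotheses (wuP : is_pmf wu) (wvP : is_pmf wv).

Definition pair_pmf (q : U * V) : R := wu q.1 * wv q.2.

Lemma fexp_pair F :
  fexp pair_pmf F = fexp wv (fun y => fexp wu (fun x => F (x, y))).
Proof.
transitivity (\sum_x \sum_y wu x * wv y * F (x, y)).
  by rewrite pair_bigA; apply: eq_bigr => -[x y].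
rewrite exchange_big /=; apply: eq_bigr => y _; rewrite mulr_sumr.
by apply: eq_bigr => x _; ring.
Qed.

Lemma pair_pmfP : is_pmf pair_pmf.
Proof.
split=> [q|]; first by rewrite mulr_ge0 ?wuP.1 ?wvP.1.
transitivity (fexp pair_pmf (fun=> 1)); first by apply: eq_bigr => q _; rewrite mulr1.
by rewrite fexp_pair !fexp_cst.
Qed.

End pair_expectation.

(** * Quadratic forms of a tensor product of two rows *)

Section row_quadratic_form.
Context (R : realType) (d p : nat).
Implicit Types (A : 'M[R]_(d * p)) (x : 'rV[R]_d) (y : 'rV[R]_p).

Definition outer x y : 'rV[R]_(d * p) := mxvec (x^T *m y).

Lemma outerE x y j l : outer x y 0 (mxvec_index j l) = x 0 j * y 0 l.
Proof. by rewrite mxvecE mxE big_ord1 mxE. Qed.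

Lemma sum_mxvec_index (F : 'I_(d * p) -> R) :
  \sum_k F k = \sum_j \sum_l F (mxvec_index j l).
Proof.
rewrite pair_bigA (reindex (uncurry (@mxvec_index d p)))//=; last exact: curry_mxvec_bij.
by apply: eq_bigr => -[j l].
Qed.

Lemma sqn_outer x y : sqn (outer x y) = sqn x * sqn y.
Proof.
rewrite !sqnE sum_mxvec_index big_distrlr; apply: eq_bigr => j _; apply: eq_bigr => l _.
by rewrite outerE exprMn.
Qed.

(** The matrix of [qf A (outer x y)] as a quadratic form in [x] with [y] frozen. Its mean over [x]
    is its trace, again a quadratic form in [y], whose matrix [partial_tr A] is the partial trace
    over the first factor. *)
Definition partial_qf A y : 'M[R]_d :=
  \matrix_(j, k) \sum_l \sum_m y 0 l * y 0 m * A (mxvec_index j l) (mxvec_index k m).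

Definition partial_tr A : 'M[R]_p :=
  \matrix_(l, m) \sum_j A (mxvec_index j l) (mxvec_index j m).

Lemma qf_outer A x y : qf A (outer x y) = qf (partial_qf A y) x.
Proof.
rewrite !qfE sum_mxvec_index; apply: eq_bigr => j _.
under [LHS]eq_bigr do rewrite sum_mxvec_index.
rewrite exchange_big; apply: eq_bigr => k _; rewrite mxE mulr_sumr; apply: eq_bigr => l _.
by rewrite mulr_sumr; apply: eq_bigr => m _; rewrite !outerE; ring.
Qed.

Lemma tr_partial_qf A y : \tr (partial_qf A y) = qf (partial_tr A) y.
Proof.
rewrite qfE /mxtrace; under eq_bigr do rewrite mxE.
rewrite exchange_big; apply: eq_bigr => l _; rewrite exchange_big; apply: eq_bigr => m _.
by rewrite mxE mulr_sumr.
Qed.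

Lemma tr_partial_tr A : \tr (partial_tr A) = \tr A.
Proof.
rewrite /mxtrace sum_mxvec_index exchange_big; apply: eq_bigr => l _.
by rewrite mxE.
Qed.

Section symmetric.
Context A (b : R).
Hypotheses (b0 : 0 <= b) (Asym : A^T = A) (Ab : forall u, sqn (u *m A) <= sqn u * b).

Let AsymE k m : A k m = A m k.
Proof. by rewrite -[in LHS]Asym mxE. Qed.

Lemma partial_qf_sym y : (partial_qf A y)^T = partial_qf A y.
Proof.
apply/matrixP => j k; rewrite !mxE exchange_big; apply: eq_bigr => l _.
by apply: eq_bigr => m _; rewrite AsymE; ring.
Qed.

Lemma partial_tr_sym : (partial_tr A)^T = partial_tr A.
Proof. by apply/matrixP => j k; rewrite !mxE; apply: eq_bigr => l _; rewrite AsymE. Qed.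

(** Row [j] is the contraction with [y] of [u], the image under [A] of the tensor product of the
    [j]-th unit vector and [y]. The operator bound gives [|u|^2 <= b |y|^2], and Cauchy-Schwarz a
    second factor [|y|^2]. *)
Lemma frob_partial_qf y : frob (partial_qf A y) <= d%:R * b * sqn y ^+ 2.
Proof.
have -> : d%:R * b * sqn y ^+ 2 = \sum_(j < d) b * sqn y ^+ 2.
  by rewrite sumr_const card_ord -[RHS]mulr_natl mulrA.
apply: ler_sum => j _.
pose u := outer (delta_mx 0 j) y *m A.
have uE k m : u 0 (mxvec_index k m) = \sum_l y 0 l * A (mxvec_index j l) (mxvec_index k m).
  rewrite mxE sum_mxvec_index (bigD1 j)//= [X in _ + X]big1 ?addr0.
    by apply: eq_bigr => l _; rewrite outerE mxE !eqxx mul1r.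
  move=> i /negbTE ij; apply: big1 => l _.
  by rewrite outerE mxE ij andbF !mul0r.
have h : sqn u <= b * sqn y.
  by have := Ab (outer (delta_mx 0 j) y); rewrite sqn_outer sqn_delta mul1r mulrC.
apply: (@le_trans _ _ (sqn y * sqn u)); last first.
  by rewrite expr2 mulrA [leRHS]mulrC ler_wpM2l ?sqn_ge0.
rewrite [sqn u]sqnE sum_mxvec_index mulr_sumr; apply: ler_sum => k _.
have -> : partial_qf A y j k = \sum_m y 0 m * u 0 (mxvec_index k m).
  rewrite mxE exchange_big; apply: eq_bigr => m _; rewrite uE mulr_sumr.
  by apply: eq_bigr => l _; ring.
by rewrite sqnE; exact: cauchy_schwarz_sum.
Qed.

(** Cauchy-Schwarz over the [d] diagonal blocks costs a factor [d]; what remains is a part of the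
    sum defining [frob A], which is at most [d p b]. *)
Lemma frob_partial_tr : frob (partial_tr A) <= d%:R ^+ 2 * p%:R * b.
Proof.
apply: (@le_trans _ _ (d%:R * frob A)); last first.
  rewrite expr2 -!mulrA ler_wpM2l// mulrA -natrM; exact: frob_le_op.
rewrite /frob [in leRHS]sum_mxvec_index [in leRHS]exchange_big mulr_sumr.
apply: ler_sum => l _.
under [in leRHS]eq_bigr => j _ do rewrite sum_mxvec_index.
apply: (@le_trans _ _ (\sum_m d%:R * \sum_j A (mxvec_index j l) (mxvec_index j m) ^+ 2)).
  apply: ler_sum => m _; rewrite mxE.
  have := cauchy_schwarz_sum (fun=> 1) (fun j => A (mxvec_index j l) (mxvec_index j m)).
  under eq_bigr do rewrite mul1r.
  by under [\sum_i 1 ^+ 2]eq_bigr do rewrite expr1n; rewrite sumr_const card_ord.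
rewrite -mulr_sumr ler_wpM2l// exchange_big; apply: ler_sum => j _.
rewrite [leRHS](bigD1 j)//= lerDl; apply: sumr_ge0 => k _; apply: sumr_ge0 => m _.
exact: sqr_ge0.
Qed.

Context (U V : finType) (wx : U -> R) (vx : U -> R) (wy : V -> R) (vy : V -> R) (C : R).
Hypotheses (wxP : is_pmf wx) (wyP : is_pmf wy).
Hypotheses (x1 : fexp wx vx = 0) (x2 : fexp wx (fun e => vx e ^+ 2) = 1)
  (x4 : fexp wx (fun e => vx e ^+ 4) <= C).
Hypotheses (y1 : fexp wy vy = 0) (y2 : fexp wy (fun e => vy e ^+ 2) = 1)
  (y4 : fexp wy (fun e => vy e ^+ 4) <= C).

Definition row_pmf : {ffun 'I_d -> U} * {ffun 'I_p -> V} -> R :=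
  pair_pmf (prod_pmf wx) (prod_pmf wy).

Lemma row_pmfP : is_pmf row_pmf.
Proof. by apply: pair_pmfP; exact: prod_pmfP. Qed.

Definition row_val (r : {ffun 'I_d -> U} * {ffun 'I_p -> V}) : 'rV[R]_(d * p) :=
  outer (vals vx r.1) (vals vy r.2).

(** The deviation is split at the conditional mean given [y], which is [\tr (partial_qf A y)]; the
    leading factor 2 comes from squaring this sum. Given [y], the first part has mean square at most
    [(2 C + 8) d b |y|^4], and [E |y|^4 <= C p^2]; the second is a centred quadratic form in [y]
    with matrix [partial_tr A]. *)
Lemma row_qf_variance :
  fexp row_pmf (fun r => (qf A (row_val r) - \tr A) ^+ 2) <=
  2 * (2 * C + 8) * b * (C * d%:R * p%:R ^+ 2 + d%:R ^+ 2 * p%:R).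
Proof.
have C0 := moment4_ge0 wxP x4.
rewrite fexp_pair.
apply: (@le_trans _ _ (fexp (prod_pmf wy) (fun y : {ffun 'I_p -> V} =>
    2 * (2 * C + 8) * (d%:R * b) * sqn (vals vy y) ^+ 2 +
    2 * (qf (partial_tr A) (vals vy y) - \tr (partial_tr A)) ^+ 2))).
  apply: (ler_fexp (prod_pmfP _ wyP)) => y; rewrite tr_partial_tr.
  set B := partial_qf A (vals vy y).
  have e (x : {ffun 'I_d -> U}) : (qf A (row_val (x, y)) - \tr A) ^+ 2 <=
      2 * (qf B (vals vx x) - \tr B) ^+ 2 + 2 * (\tr B - \tr A) ^+ 2.
    rewrite /row_val qf_outer -/B -subr_ge0.
    have -> : 2 * (qf B (vals vx x) - \tr B) ^+ 2 + 2 * (\tr B - \tr A) ^+ 2 -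
      (qf B (vals vx x) - \tr A) ^+ 2 = (qf B (vals vx x) - 2 * \tr B + \tr A) ^+ 2 by ring.
    exact: sqr_ge0.
  apply: (le_trans (ler_fexp (prod_pmfP _ wxP) e)).
  rewrite fexpD fexpZ fexp_cst; last exact: prod_pmfP.
  rewrite -tr_partial_qf lerD2r -!mulrA ler_wpM2l// (le_trans (qf_variance wxP x1 x2 x4 (partial_qf_sym _)))//.
  by rewrite ler_wpM2l ?addr_ge0 ?mulr_ge0// mulrA frob_partial_qf.
rewrite fexpD !fexpZ.
have h1 := fexp_sqn_sqr p wyP y4.
have h2 := le_trans (qf_variance wyP y1 y2 y4 partial_tr_sym)
  (ler_wpM2l (_ : 0 <= 2 * C + 8) frob_partial_tr).
have c8 : 0 <= 2 * C + 8 by rewrite addr_ge0 ?mulr_ge0.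
have k1 : 0 <= 2 * (2 * C + 8) * (d%:R * b) by rewrite !mulr_ge0.
have {}h1 := ler_wpM2l k1 h1.
have {}h2 := ler_wpM2l (_ : 0 <= 2) (h2 c8).
rewrite (le_trans (lerD h1 (h2 _)))//.
by rewrite le_eqVlt; apply/orP; left; apply/eqP; ring.
Qed.

End symmetric.

End row_quadratic_form.

(** * The sample covariance matrix with finitely supported rows *)

Section sample_covariance.
Context (R : realType) (t : R) (n N : nat) (W : finType) (w : W -> R) (z : W -> 'rV[R]_N) (kappa : R).
Hypotheses (t0 : 0 < t) (N0 : (0 < N)%N) (wP : is_pmf w).
Hypothesis qf_var : forall (A : 'M[R]_N) (b : R), 0 <= b -> A^T = A ->
  (forall u, sqn (u *m A) <= sqn u * b) ->
  fexp w (fun r => (qf A (z r) - \tr A) ^+ 2) <= b * kappa.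
Implicit Types (r : {ffun 'I_n -> W}).
Let c : R := N%:R^-1.
Let pw := @prod_pmf R 'I_n W w.
Let pwP : is_pmf pw := prod_pmfP _ wP.

Definition scov r : 'M[R]_N := c *: \sum_i (z (r i))^T *m z (r i).

Definition scov_trace r : R := \tr (resolvent t (scov r)) / N%:R.

Let T i r : 'M[R]_N := c *: \sum_(j | j != i) (z (r j))^T *m z (r j).

Let h i r : R := \tr (resolvent t (T i r)) / N%:R.

Let q i r : R := c * qf (resolvent t (T i r)) (z (r i)).

Let c0 : 0 < c. Proof. by rewrite invr_gt0 ltr0n. Qed.

Let psdS r : psd (scov r).
Proof. by apply: psdZ (ltW c0) _; apply: psd_sum => i; exact: psd_gram. Qed.

Let psdT i r : psd (T i r).
Proof. by apply: psdZ (ltW c0) _; apply: psd_sum => j; exact: psd_gram. Qed.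

Let scovE i r : scov r = T i r + c *: ((z (r i))^T *m z (r i)).
Proof. by rewrite /scov (bigD1 i)//= scalerDr addrC. Qed.

Let T_upd i r e : T i (upd r i e) = T i r.
Proof. by congr (_ *: _); apply: eq_bigr => j /negbTE ji; rewrite ffunE ji. Qed.

Lemma scov_trace_ge0 r : 0 <= scov_trace r.
Proof. by rewrite divr_ge0// resolvent_trace_ge0. Qed.

Lemma scov_trace_le r : scov_trace r <= t^-1.
Proof.
rewrite ler_pdivrMr ?ltr0n// mulrC; exact: resolvent_trace_le.
Qed.

Let h_bound i r : h i r - c / t <= scov_trace r <= h i r.
Proof.
have /andP[] := trace_rank_one t0 (z (r i)) (psdT i r) (ltW c0); rewrite -scovE.
move=> a1 a2; have b1 := ler_wpM2r (ltW c0) a1; have b2 := ler_wpM2r (ltW c0) a2.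
rewrite mul0r mulrBl in b1; rewrite mulrBl [_ * c]mulrC -/c in b2.
rewrite /scov_trace /h -/c; move: b2; rewrite [c * _ in X in X -> _]mulrC => b2.
by apply/andP; split; lra.
Qed.

(** The leave-one-out trace [h i] does not see row [i], and both [scov_trace] and its average over
    row [i] lie between [h i - c / t] and [h i]. *)
Lemma scov_trace_bounded_diff i r : `|scov_trace r - E1 w i scov_trace r| <= c / t.
Proof.
have /andP[a1 a2] := h_bound i r.
have b1 : h i r - c / t <= E1 w i scov_trace r.
  rewrite -[leLHS](fexp_cst wP); apply: (ler_fexp wP) => e.
  by have /andP[+ _] := h_bound i (upd r i e); rewrite {1}/h T_upd.
have b2 : E1 w i scov_trace r <= h i r.
  rewrite -[leRHS](fexp_cst wP); apply: (ler_fexp wP) => e.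
  by have /andP[_ +] := h_bound i (upd r i e); rewrite {1}/h T_upd.
by rewrite ler_norml; apply/andP; split; lra.
Qed.

Lemma scov_trace_concentration l : `|l| * (c / t) <= 2^-1 ->
  fexp pw (fun r => expR (l * (scov_trace r - fexp pw scov_trace))) <=
  expR (n%:R * (2 * (l * (c / t)) ^+ 2)).
Proof.
move=> lc; rewrite -[n in leRHS]card_ord; apply: mcdiarmid => //.
  by rewrite divr_ge0 ?ltW.
exact: scov_trace_bounded_diff.
Qed.

Let q_ge0 i r : 0 <= q i r.
Proof. by rewrite mulr_ge0 ?(ltW c0)// resolvent_qf_ge0. Qed.

Let trace_identity r : 1 = t * scov_trace r + c * \sum_i q i r / (1 + q i r).
Proof.
have /(congr1 mxtrace) := resolventVr t0 (psdS r).
rewrite mulmxDl mxtraceD mul_scalar_mx mxtraceZ mxtrace1.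
have -> : \tr (scov r *m resolvent t (scov r)) = \sum_i q i r / (1 + q i r).
  rewrite /scov -scalemxAl mxtraceZ mulmx_suml raddf_sum mulr_sumr.
  apply: eq_bigr => i _ /=.
  rewrite -(qf_rank_one t0 (z (r i)) (psdT i r) (ltW c0)) -scovE; congr (_ * _).
  by rewrite -mulmxA mxtrace_mulC trace_mx11.
move=> e; have N1 : N%:R != 0 :> R by rewrite pnatr_eq0 -lt0n.
transitivity (c * N%:R); first by rewrite mulVf.
by rewrite -e /scov_trace -/c; ring.
Qed.

Let ratio_lip (x y : R) : 0 <= x -> 0 <= y -> `|x / (1 + x) - y / (1 + y)| <= `|x - y|.
Proof.
move=> x0 y0; have x1 : 0 < 1 + x by lra.
have y1 : 0 < 1 + y by lra.
have -> : x / (1 + x) - y / (1 + y) = (x - y) / ((1 + x) * (1 + y)).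
  by field; rewrite !lt0r_neq0.
have xy : 0 <= (1 + x) * (1 + y) by rewrite mulr_ge0 ?addr_ge0.
rewrite normrM ler_piMr// ger0_norm ?invr_ge0//.
by rewrite invf_le1 ?mulr_gt0// mulrDl mul1r -addrA lerDl addr_ge0// mulr_ge0// addr_ge0.
Qed.

Let m := fexp pw scov_trace.

Let q_sqr i : fexp pw (fun r => (q i r - h i r) ^+ 2) <= (c / t) ^+ 2 * kappa.
Proof.
rewrite /pw -(fexp_E1 wP i) -[leRHS](fexp_cst pwP); apply: (ler_fexp pwP) => r.
rewrite /E1 (@eq_fexp _ _ _ _ (fun e => c ^+ 2 *
    (qf (resolvent t (T i r)) (z e) - \tr (resolvent t (T i r))) ^+ 2)); last first.
  move=> e; rewrite /q /h T_upd ffunE eqxx -/c; ring.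
have -> : (c / t) ^+ 2 * kappa = c ^+ 2 * ((t ^+ 2)^-1 * kappa) by rewrite expr_div_n mulrA.
rewrite fexpZ ler_wpM2l ?sqr_ge0//; apply: (@qf_var _ (t ^+ 2)^-1).
- by rewrite invr_ge0 exprn_ge0// ltW.
- exact: resolvent_sym.
- by move=> u; exact: sqn_resolvent.
Qed.

(* With Q the resolvent of S, Sherman-Morrison writes tr (Q S) in
   N = t tr Q + tr (Q S) as the sum of the q_i / (1 + q_i), where q_i is the value at
   row i of the quadratic form of the resolvent without row i; q_i is close to m. *)
Lemma scov_trace_equation :
  `|1 - t * m - n%:R * c * (m / (1 + m))| <=
  n%:R * c * Num.sqrt (3 * (c / t) ^+ 2 * (kappa + 1 + n%:R)).
Proof.
have m0 : 0 <= m by apply: (fexp_ge0 pwP) => r; exact: scov_trace_ge0.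
have -> : 1 - t * m - n%:R * c * (m / (1 + m)) =
   c * \sum_i fexp pw (fun r => q i r / (1 + q i r) - m / (1 + m)).
  under eq_bigr do rewrite fexpB (fexp_cst pwP).
  rewrite sumrB sumr_const card_ord -fexp_sum -[_ *+ n]mulr_natl.
  have : fexp pw (fun=> 1) = t * m + c * fexp pw (fun r => \sum_i q i r / (1 + q i r)).
    by rewrite (eq_fexp _ trace_identity) fexpD !fexpZ.
  rewrite (fexp_cst pwP); set F := fexp _ _; set x := m / _; move=> key.
  by lra.
rewrite normrM (ger0_norm (ltW c0)) [n%:R * c]mulrC -[leRHS]mulrA ler_wpM2l ?(ltW c0)//.
apply: (le_trans (ler_norm_sum _ _ _)).
set sq := Num.sqrt _; have -> : n%:R * sq = \sum_(i < n) sq by rewrite sumr_const card_ord mulr_natl.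
apply: ler_sum => i _.
apply: (le_trans (ler_norm_fexp pwP _)).
apply: (@le_trans _ _ (fexp pw (fun r => `|q i r - m|))).
  by apply: (ler_fexp pwP) => r; exact: ratio_lip.
(* [q i - m] is the sum of [q i - h i], [h i - scov_trace] and [scov_trace - m]. Their mean squares
   are at most [(c / t)^2] times [kappa], 1 and [n], by the variance of quadratic forms, the rank
   one bound and Efron-Stein. *)
apply: (le_trans (fexp_norm_le_sqrt pwP _)); rewrite ler_wsqrtr//.
have v1 : fexp pw (fun r => (scov_trace r - m) ^+ 2) <= n%:R * (c / t) ^+ 2.
  apply: (le_trans (efron_stein wP _)).
  have -> : n%:R * (c / t) ^+ 2 = \sum_(j < n) (c / t) ^+ 2 by rewrite sumr_const card_ord mulr_natl.
  apply: ler_sum => j _.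
  rewrite -[leRHS](fexp_cst pwP); apply: (ler_fexp pwP) => r.
  rewrite -[leLHS]real_normK ?num_real// ler_sqr ?nnegrE//.
    exact: scov_trace_bounded_diff.
  by rewrite divr_ge0 ?ltW.
have v2 : fexp pw (fun r => (h i r - scov_trace r) ^+ 2) <= (c / t) ^+ 2.
  rewrite -[leRHS](fexp_cst pwP); apply: (ler_fexp pwP) => r.
  have /andP[a1 a2] := h_bound i r.
  by rewrite ler_sqr ?nnegrE; lra.
apply: (@le_trans _ _ (fexp pw (fun r => 3 * ((q i r - h i r) ^+ 2 + (h i r - scov_trace r) ^+ 2
    + (scov_trace r - m) ^+ 2)))).
  apply: (ler_fexp pwP) => r; set x := q i r; set y := h i r; set s := scov_trace r.
  rewrite -subr_ge0.
  have -> : 3 * ((x - y) ^+ 2 + (y - s) ^+ 2 + (s - m) ^+ 2) - (x - m) ^+ 2 =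
    ((x - y) - (y - s)) ^+ 2 + ((y - s) - (s - m)) ^+ 2 + ((x - y) - (s - m)) ^+ 2 by ring.
  by rewrite !addr_ge0 ?sqr_ge0.
rewrite fexpZ !fexpD; have := q_sqr i.
rewrite -mulrA ler_pM2l// !mulrDr mulr1 => v3.
by rewrite lerD ?lerD// mulrC.
Qed.

End sample_covariance.

(** * From finitely supported entries to arbitrary ones *)

Section bounded_convergence.
Context d (T : measurableType d) (R : realType) (P : probability T R).
Implicit Types f g : T -> R.

Lemma integrable_bounded f (M : R) : measurable_fun setT f -> (forall x, `|f x| <= M) ->
  P.-integrable setT (EFin \o f).
Proof.
move=> mf fM; apply: (le_integrable measurableT _ _ (finite_measure_integrable_cst P M measurableT)).
  exact/measurable_EFinP.
by move=> x _; rewrite /= lee_fin (le_trans (fM x))// ler_norm.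
Qed.

Lemma Rintegral_dominated_cvg (F : nat -> T -> R) f g :
  (forall n, measurable_fun setT (F n)) ->
  (forall x, F ^~ x @ \oo --> f x) ->
  P.-integrable setT (EFin \o g) -> (forall n x, `|F n x| <= g x) ->
  P.-integrable setT (EFin \o f) /\ \int[P]_x F n x @[n --> \oo] --> \int[P]_x f x.
Proof.
move=> mF Ff ig Fg.
have mf : measurable_fun setT f.
  by apply: (@measurable_fun_cvg _ _ _ _ F) => // x _; exact: Ff.
have [||||| h1 _ h3] := @dominated_convergence _ T R P setT measurableT
  (fun n => EFin \o F n) (EFin \o f) (EFin \o g).
- by move=> n; exact/measurable_EFinP.
- exact/measurable_EFinP.
- by apply: aeW => x _; apply/fine_cvgP; split; [exact: nearW|exact: Ff].
- exact: ig.
- by apply: aeW => x n _; rewrite /= lee_fin.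
split=> //; have fi : (\int[P]_x (f x)%:E)%E \is a fin_num.
  exact: integrable_fin_num.
move: h3; rewrite -[X in _ --> X](fineK fi) => /fine_cvgP[_]; exact.
Qed.

Lemma Rintegral_bounded_cvg (F : nat -> T -> R) f (M : R) :
  (forall n, measurable_fun setT (F n)) ->
  (forall x, F ^~ x @ \oo --> f x) -> (forall n x, `|F n x| <= M) ->
  \int[P]_x F n x @[n --> \oo] --> \int[P]_x f x.
Proof.
move=> mF Ff FM.
have [] := @Rintegral_dominated_cvg F f (cst M) mF Ff _ _ => //.
exact: finite_measure_integrable_cst.
Qed.

End bounded_convergence.

Section finite_law.
Context d (T : measurableType d) (R : realType) (P : probability T R).
Context (U : finType) (r : T -> U).
Hypothesis mr : forall e, measurable (r @^-1` [set e]).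

Definition fin_law (e : U) : R := fine (P (r @^-1` [set e])).

Let fin_sumE (f : U -> R) w : f (r w) = \sum_e f e * \1_(r @^-1` [set e]) w.
Proof.
rewrite (bigD1 (r w))//= big1 ?addr0; last first.
  by move=> e er; rewrite indicE memNset ?mulr0//= => re; rewrite re eqxx in er.
by rewrite indicE mem_set//= mulr1.
Qed.

Lemma measurable_fin_comp (f : U -> R) : measurable_fun setT (f \o r).
Proof.
rewrite (_ : f \o r = fun w => \sum_e f e * \1_(r @^-1` [set e]) w); last first.
  by apply/funext => w; exact: fin_sumE.
apply: measurable_sum => e; apply: measurable_funM => //.
Qed.

Lemma fexp_fin_law (f : U -> R) : fexp fin_law f = \int[P]_w f (r w).
Proof.
have ii e : P.-integrable setT (fun w => (f e * \1_(r @^-1` [set e]) w)%:E).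
  apply: (@integrable_bounded _ _ _ _ _ (`|f e|)); first exact: measurable_funM.
  by move=> x; rewrite normrM ler_piMr// indicE; case: (_ \in _); rewrite ?normr0 ?normr1.
transitivity (fine (\int[P]_w (\sum_e (f e * \1_(r @^-1` [set e]) w)%:E)))%E; last first.
  by congr fine; apply: eq_integral => w _; rewrite sumEFin -fin_sumE.
rewrite integral_sum// -sum_fine; last by move=> e _; exact: integrable_fin_num.
apply: eq_bigr => e _; rewrite mulrC.
under eq_integral do rewrite EFinM.
rewrite integralZl//; last first.
  exact: integrable_indic.
rewrite integral_indic// setIT fineM//; exact: fin_num_measure.
Qed.

Lemma fin_law_pmf : is_pmf fin_law.
Proof.
split=> [e|]; first by rewrite fine_ge0.
transitivity (fexp fin_law (fun=> 1)); first by apply: eq_bigr => e _; rewrite mulr1.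
rewrite fexp_fin_law Rintegral_cst// mul1r.
by rewrite [X in fine X](probability_setT P).
Qed.

End finite_law.

Lemma near_ger_nat (R : realType) (M : R) : \forall k \near \oo, M <= k.+1%:R.
Proof.
near=> k; rewrite (le_trans (ltW (truncnS_gt M)))// ler_nat ltnS.
by near: k; exact: nbhs_infty_ge.
Unshelve. all: by end_near. Qed.

(** * Discretisation of real random variables *)

Section quantization.
Context (R : realType).
Implicit Types (K : nat) (x : R).

(* A sign and a multiple of 1 / K, truncated at K. *)
Definition qcode K : finType := (bool * 'I_(K ^ 2).+1)%type.

Definition qidx K x : qcode K := (x < 0, inord (minn (Num.truncn (`|x| * K%:R)) (K ^ 2))).

Definition qval K (e : qcode K) : R := (-1) ^+ e.1 * (e.2)%:R / K%:R.

Lemma qvalE K x : qval (qidx K x) =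
  (-1) ^+ (x < 0)%R * (minn (Num.truncn (`|x| * K%:R)) (K ^ 2))%:R / K%:R.
Proof. by rewrite /qval /= inordK// ltnS geq_minr. Qed.

(** Rounding is towards 0, so that [|Z|] dominates all discretisations of [Z]. *)
Lemma qval_le K x : `|qval (qidx K x)| <= `|x|.
Proof.
rewrite qvalE 2!normrM normrX normrN1 expr1n mul1r normfV !normr_nat.
have [->|K0] := posnP K; first by rewrite invr0 mulr0.
rewrite ler_pdivrMr ?ltr0n//.
rewrite (@le_trans _ _ (Num.truncn (`|x| * K%:R))%:R) ?ler_nat ?geq_minl//.
by rewrite truncn_le mulr_ge0.
Qed.

Lemma qval_cvg x : qval (qidx k.+1 x) @[k --> \oo] --> x.
Proof.
apply/cvgrPdist_le => e e0; near=> k.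
have k0 : (0 < k.+1%:R :> R) by [].
have xk : `|x| <= k.+1%:R by near: k; exact: near_ger_nat.
have ek : e^-1 <= k.+1%:R by near: k; exact: near_ger_nat.
have sx : x = (-1) ^+ (x < 0)%R * `|x| by exact: numEsign.
rewrite qvalE {1}sx -mulrA -mulrBr normrM normrX normrN1 expr1n mul1r.
set m := Num.truncn _; have mk : (m <= k.+1 ^ 2)%N.
  by rewrite -(@ler_nat R) natrX expr2 (le_trans _ (ler_wpM2r _ xk))// truncn_le mulr_ge0.
rewrite (minn_idPl mk).
have /truncn_itv : 0 <= `|x| * k.+1%:R by rewrite mulr_ge0.
rewrite -/m => /andP[m1 m2].
have -> : `|x| - m%:R / k.+1%:R = (`|x| * k.+1%:R - m%:R) / k.+1%:R.
  by rewrite mulrBl mulfK// gt_eqF.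
rewrite normrM normfV (ger0_norm (ltW k0)) ler_pdivrMr//.
rewrite (@le_trans _ _ 1)//.
  rewrite ler_norml; rewrite -natr1 in m2; apply/andP; split; lra.
by rewrite -ler_pdivrMl// mulr1.
Unshelve. all: by end_near. Qed.

Lemma measurable_qidx K (e : qcode K) : measurable (qidx K @^-1` [set e]).
Proof.
have -> : qidx K @^-1` [set e] = [set x | (x < 0) = e.1] `&`
   \bigcup_(m in [set m | inord (minn m (K ^ 2)) = e.2])
     [set x | Num.truncn (`|x| * K%:R) = m].
  apply/seteqP; split=> [x /= <-|x [/= x0 [m /= me xm]]].
    by split=> //=; exists (Num.truncn (`|x| * K%:R)).
  by rewrite /qidx x0 xm me; case: e {x0 me}.
apply: measurableI.
  case: e.1.
    rewrite (_ : [set _ | _] = `]-oo, 0[%classic)//.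
  rewrite (_ : [set _ | _] = `[0, +oo[%classic)//.
  by apply/seteqP; split=> x /=; rewrite in_itv /= andbT leNgt; case: (x < 0).
apply: bigcup_measurable => m _.
rewrite (_ : [set _ | _] = (fun x => `|x| * K%:R) @^-1` `[m%:R, m.+1%:R[%classic).
  rewrite -[_ @^-1` _]setTI; apply: measurable_funM => //.
apply/seteqP; split=> x /=; rewrite in_itv /=.
  by move=> <-; apply: truncn_itv; rewrite mulr_ge0.
exact: truncn_def.
Qed.

End quantization.

Section quantized_entry.
Context d (T : measurableType d) (R : realType) (P : probability T R).
Context (Z : {RV P >-> R}) (s C : R).
Hypotheses (s0 : 0 < s) (Z1 : ('E_P[Z] = 0)%E)
  (Z2 : ('E_P[(fun w => Z w ^+ 2)%R] = (s ^+ 2)%:E)%E)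
  (Z4 : ('E_P[(fun w => Z w ^+ 4)%R] <= C%:E)%E).

Let mZ : measurable_fun setT Z. Proof. exact: measurable_funPT. Qed.

Let mZX n : measurable_fun setT (fun w => Z w ^+ n).
Proof. exact: measurable_funX. Qed.

Let pow4_ge0 (x : R) : 0 <= x ^+ 4.
Proof. by rewrite (exprM _ 2 2) sqr_ge0. Qed.

Let iZ4 : P.-integrable setT (fun w => (Z w ^+ 4)%:E).
Proof.
apply/integrableP; split; first exact/measurable_EFinP.
under eq_integral do rewrite gee0_abs ?lee_fin ?pow4_ge0//.
by apply: (@le_lt_trans _ _ C%:E); [move: Z4; rewrite unlock|rewrite ltry].
Qed.

Let B : R := \int[P]_w `|Z w|.

(** One integrable bound for the first, second and fourth powers of any [x] with [|x| <= |Z w| + B],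
    since [(u + B)^4 <= 8 u^4 + 8 B^4]. It applies to the centred codes because [B] bounds the means
    [m k]. *)
Let dom w : R := 8 * Z w ^+ 4 + (8 * B ^+ 4 + 1).

Let idom : P.-integrable setT (EFin \o dom).
Proof.
rewrite (_ : EFin \o dom = fun w => 8%:E * (Z w ^+ 4)%:E + (8 * B ^+ 4 + 1)%:E)%E.
  apply: integrableD => //; first exact: integrableZl.
  exact: finite_measure_integrable_cst.
by apply/funext => w; rewrite /= EFinD EFinM.
Qed.

Let dom_bound w (x : R) : `|x| <= `|Z w| + B -> 1 + x ^+ 4 <= dom w.
Proof.
move=> xZ; have B0 : 0 <= B by apply: Rintegral_ge0.
have pow4_norm (y : R) : y ^+ 4 = `|y| ^+ 4.
  by rewrite -normrX ger0_norm ?pow4_ge0.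
have h : `|x| ^+ 4 <= (`|Z w| + B) ^+ 4 by rewrite lerXn2r// nnegrE addr_ge0.
rewrite /dom pow4_norm (pow4_norm (Z w)); move: h; set a := `|Z w| => h.
suff : 0 <= 8 * a ^+ 4 + 8 * B ^+ 4 - (a + B) ^+ 4 by lra.
have -> : 8 * a ^+ 4 + 8 * B ^+ 4 - (a + B) ^+ 4 =
  4 * (a ^+ 2 - B ^+ 2) ^+ 2 + (a - B) ^+ 2 * (2 * (a ^+ 2 + B ^+ 2) + (a + B) ^+ 2) by ring.
apply: addr_ge0; apply: mulr_ge0; rewrite ?sqr_ge0//.
by rewrite addr_ge0 ?sqr_ge0// mulr_ge0// addr_ge0 ?sqr_ge0.
Qed.

Let dom1 w (x : R) : `|x| <= `|Z w| + B -> `|x| <= dom w.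
Proof.
move=> /dom_bound; apply: le_trans; rewrite -subr_ge0.
have -> : 1 + x ^+ 4 - `|x| = (x ^+ 2 - 2^-1) ^+ 2 + (`|x| - 2^-1) ^+ 2 + 2^-1.
  have := real_normK (num_real x); set y := `|x| => e.
  by rewrite (exprM x 2 2) -e; field.
by rewrite addr_ge0 ?addr_ge0 ?sqr_ge0 ?invr_ge0.
Qed.

Let dom2 w (x : R) : `|x| <= `|Z w| + B -> `|x ^+ 2| <= dom w.
Proof.
move=> /dom_bound; apply: le_trans; rewrite -subr_ge0 ger0_norm ?sqr_ge0//.
have -> : 1 + x ^+ 4 - x ^+ 2 = (x ^+ 2 - 2^-1) ^+ 2 + 3 / 4 by field.
by rewrite addr_ge0 ?sqr_ge0.
Qed.

Let dom4 w (x : R) : `|x| <= `|Z w| + B -> `|x ^+ 4| <= dom w.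
Proof. by move=> /dom_bound; apply: le_trans; rewrite ger0_norm ?pow4_ge0// lerDr. Qed.

Let B0 : 0 <= B. Proof. exact: Rintegral_ge0. Qed.

Let code k w := qidx k.+1 (Z w).

Let mcode k e : measurable (code k @^-1` [set e]).
Proof. by have := mZ measurableT (measurable_qidx e); rewrite setTI. Qed.

Definition code_law k := fin_law P (code k).

Lemma code_law_pmf k : is_pmf (@code_law k).
Proof. exact: fin_law_pmf. Qed.

Let m k : R := fexp (@code_law k) (@qval R k.+1).

Let v2 k : R := fexp (@code_law k) (fun e => (qval R e - m k) ^+ 2).

(** The estimates for finite supports require mean exactly 0 and variance exactly 1. For small [k]
    the variance [v2 k] may vanish and the quotient is then 0, so [code_moments] is stated for large
    [k]. *)
Definition code_val k (e : qcode k.+1) : R := (qval R e - m k) / Num.sqrt (v2 k).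

Let iZ : P.-integrable setT (EFin \o Z).
Proof.
apply: (le_integrable measurableT _ _ idom); first exact/measurable_EFinP.
by move=> w _; rewrite /= lee_fin (le_trans _ (ler_norm _))// dom1// lerDl.
Qed.

Let qle k w : `|qval R (code k w)| <= `|Z w|.
Proof. exact: qval_le. Qed.

Let m_le k : `|m k| <= B.
Proof.
rewrite /m fexp_fin_law//.
apply: le_trans (le_normr_Rintegral measurableT _) _.
  apply: (le_integrable measurableT _ _ iZ); first exact/measurable_EFinP/measurable_fin_comp.
  by move=> w _; rewrite /= lee_fin.
apply: le_Rintegral => //.
  apply: (le_integrable measurableT _ _ iZ).
    apply/measurable_EFinP; apply: measurableT_comp => //; exact: measurable_fin_comp.
  by move=> w _; rewrite /= lee_fin normr_id.
by apply: (le_integrable measurableT _ _ iZ) => [|w _]; rewrite /= ?lee_fin ?normr_id//;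
  apply/measurable_EFinP; exact: measurableT_comp.
Qed.

Let m_cvg : m k @[k --> \oo] --> 0.
Proof.
have -> : 0 = \int[P]_w Z w by rewrite /Rintegral; move: Z1; rewrite unlock => ->.
rewrite (_ : m = fun k => \int[P]_w qval R (code k w)); last first.
  by apply/funext => k; rewrite /m fexp_fin_law.
apply: (Rintegral_dominated_cvg _ _ idom _).2.
- by move=> k; exact: measurable_fin_comp.
- by move=> w; exact: qval_cvg.
- by move=> k w; rewrite dom1// (le_trans (qle k w))// lerDl.
Qed.

Let center_le k w : `|qval R (code k w) - m k| <= `|Z w| + B.
Proof. by rewrite (le_trans (ler_normB _ _))// lerD. Qed.

Let center_cvg x : qval R (qidx k.+1 x) - m k @[k --> \oo] --> x.
Proof. by rewrite -[X in _ --> X]subr0; apply: cvgB; [exact: qval_cvg|exact: m_cvg]. Qed.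

Let v2_cvg : v2 k @[k --> \oo] --> s ^+ 2.
Proof.
have -> : s ^+ 2 = \int[P]_w Z w ^+ 2 by rewrite /Rintegral; move: Z2; rewrite unlock => ->.
rewrite (_ : v2 = fun k => \int[P]_w (qval R (code k w) - m k) ^+ 2); last first.
  by apply/funext => k; rewrite /v2 fexp_fin_law.
apply: (Rintegral_dominated_cvg _ _ idom _).2.
- by move=> k; exact: (measurable_fin_comp (@mcode k) (fun e => (qval R e - m k) ^+ 2)).
- by move=> w; apply: cvgM; exact: center_cvg.
- by move=> k w; exact: dom2.
Qed.

Let v4_cvg : fexp (@code_law k) (fun e => (qval R e - m k) ^+ 4) @[k --> \oo] --> \int[P]_w Z w ^+ 4.
Proof.
rewrite (_ : (fun k => _) = fun k => \int[P]_w (qval R (code k w) - m k) ^+ 4); last first.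
  by apply/funext => k; rewrite fexp_fin_law.
apply: (Rintegral_dominated_cvg _ _ idom _).2.
- by move=> k; exact: (measurable_fin_comp (@mcode k) (fun e => (qval R e - m k) ^+ 4)).
- by move=> w; do 3 (apply: cvgM; first exact: center_cvg); exact: center_cvg.
- by move=> k w; exact: dom4.
Qed.

Lemma code_val_cvg x : code_val (qidx k.+1 x) @[k --> \oo] --> x / s.
Proof.
apply: cvgM; first exact: center_cvg.
apply: cvgV; first by rewrite gt_eqF.
rewrite -[s in _ --> s](ger0_norm (ltW s0)) -sqrtr_sqr.
by apply: continuous_cvg; [exact: sqrt_continuous|exact: v2_cvg].
Qed.

(** The fourth moments converge to [E Z^4 / s^4], which is at most [C / s^4]; the slack 1 turns this
    into an inequality valid for all large [k]. *)
Lemma code_moments : \forall k \near \oo,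
  [/\ fexp (@code_law k) (@code_val k) = 0,
      fexp (@code_law k) (fun e => code_val e ^+ 2) = 1 &
      fexp (@code_law k) (fun e => code_val e ^+ 4) <= C / s ^+ 4 + 1].
Proof.
have e4 : \int[P]_w Z w ^+ 4 <= C.
  rewrite /Rintegral -lee_fin fineK; first by move: Z4; rewrite unlock.
  exact: integrable_fin_num.
have s20 : 0 < s ^+ 2 by rewrite exprn_gt0.
have h : fexp (@code_law k) (fun e => (qval R e - m k) ^+ 4) / v2 k ^+ 2 @[k --> \oo]
    --> \int[P]_w Z w ^+ 4 / s ^+ 4.
  apply: cvgM; first exact: v4_cvg.
  apply: cvgV; first by rewrite gt_eqF// exprn_gt0.
  by rewrite (exprM s 2 2); apply: cvgM; exact: v2_cvg.
near=> k.
have v20 : 0 < v2 k by near: k; exact: (cvgr_gt _ v2_cvg).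
split.
- rewrite fexpZr fexpB -/(m k) fexp_cst ?subrr ?mul0r//; exact: code_law_pmf.
- transitivity (fexp (@code_law k) (fun e => (qval R e - m k) ^+ 2 / v2 k)).
    by apply: eq_fexp => e; rewrite /code_val exprMn exprVn sqr_sqrtr// ltW.
  by rewrite fexpZr -/(v2 k) divff// gt_eqF.
- rewrite (@eq_fexp _ _ _ _ (fun e => (qval R e - m k) ^+ 4 / v2 k ^+ 2)); last first.
    by move=> e; rewrite /code_val exprMn exprVn (exprM (Num.sqrt _) 2 2) sqr_sqrtr// ltW.
  rewrite fexpZr.
  near: k; apply: (cvgr_le _ h); rewrite (@le_lt_trans _ _ (C / s ^+ 4))//.
    by rewrite ler_wpM2r// invr_ge0 exprn_ge0// ltW.
  by rewrite ltrDl.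
Unshelve. all: by end_near. Qed.

End quantized_entry.

(** * The joint law of the discretised entries *)

Section joint_law.
Context d0 (T : measurableType d0) (R : realType) (P : probability T R).
Context (n d p : nat) (X : random_matrix P n d) (Y : random_matrix P n p).
Hypotheses (iidX : iid_entries X) (iidY : iid_entries Y) (XY : independent_rmx X Y).
Context (U V : finType) (ix : R -> U) (iy : R -> V).
Hypotheses (mix : forall e, measurable (ix @^-1` [set e]))
  (miy : forall e, measurable (iy @^-1` [set e])).
Context (i0 : 'I_n) (j0 : 'I_d) (l0 : 'I_p).

Definition row_codes w : {ffun 'I_n -> {ffun 'I_d -> U} * {ffun 'I_p -> V}} :=
  [ffun i => ([ffun j => ix (X i j w)], [ffun l => iy (Y i l w)])].

Let A (rho : {ffun 'I_n -> {ffun 'I_d -> U} * {ffun 'I_p -> V}}) : set T :=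
  \bigcap_(k in [set` [set: 'I_n * 'I_d]%SET]) (X k.1 k.2 @^-1` (ix @^-1` [set (rho k.1).1 k.2])).

Let B (rho : {ffun 'I_n -> {ffun 'I_d -> U} * {ffun 'I_p -> V}}) : set T :=
  \bigcap_(k in [set` [set: 'I_n * 'I_p]%SET]) (Y k.1 k.2 @^-1` (iy @^-1` [set (rho k.1).2 k.2])).

Let row_codesE rho : row_codes @^-1` [set rho] = A rho `&` B rho.
Proof.
apply/seteqP; split=> [w /= <-|w [/= hA hB]].
  by split=> -[i j] _ /=; rewrite !ffunE.
apply/ffunP => i; rewrite ffunE; case e : (rho i) => [f g]; congr (_, _); apply/ffunP => j.
  by rewrite ffunE; have /= := hA (i, j); rewrite e => ->//; rewrite inE.
by rewrite ffunE; have /= := hB (i, j); rewrite e => ->//; rewrite inE.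
Qed.

Let sigmaA rho : rmx_sigma X (A rho).
Proof.
pose G := [set X k.1 k.2 @^-1` S | k in [set: 'I_n * 'I_d] & S in measurable].
have := @fin_bigcap_measurable _ (g_sigma_algebraType G) ('I_n * 'I_d)%type
  [set` [set: 'I_n * 'I_d]%SET] (fun k => X k.1 k.2 @^-1` (ix @^-1` [set (rho k.1).1 k.2])).
apply; first exact: finite_finset.
move=> k _; apply: sub_gen_smallest; exists k => //; exists (ix @^-1` [set (rho k.1).1 k.2]) => //.
Qed.

Let sigmaB rho : rmx_sigma Y (B rho).
Proof.
pose G := [set Y k.1 k.2 @^-1` S | k in [set: 'I_n * 'I_p] & S in measurable].
have := @fin_bigcap_measurable _ (g_sigma_algebraType G) ('I_n * 'I_p)%type
  [set` [set: 'I_n * 'I_p]%SET] (fun k => Y k.1 k.2 @^-1` (iy @^-1` [set (rho k.1).2 k.2])).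
apply; first exact: finite_finset.
move=> k _; apply: sub_gen_smallest; exists k => //; exists (iy @^-1` [set (rho k.1).2 k.2]) => //.
Qed.

Let mXpre i j e : measurable (X i j @^-1` (ix @^-1` [set e])).
Proof. by rewrite -[_ @^-1` _]setTI; exact: (measurable_funPT (X i j)). Qed.

Let mYpre i j e : measurable (Y i j @^-1` (iy @^-1` [set e])).
Proof. by rewrite -[_ @^-1` _]setTI; exact: (measurable_funPT (Y i j)). Qed.

Lemma measurable_row_codes rho : measurable (row_codes @^-1` [set rho]).
Proof.
rewrite row_codesE; apply: measurableI; apply: fin_bigcap_measurable; try exact: finite_finset.
  by move=> k _; exact: mXpre.
by move=> k _; exact: mYpre.
Qed.

(** The event that the codes equal [rho] is the intersection of an event of [rmx_sigma X] and one of
    [rmx_sigma Y], each a finite intersection over entries. The independence hypotheses enter the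
    proof here; [i0], [j0], [l0] name an entry that represents the common law. *)
Lemma row_codes_law rho :
  fin_law P row_codes rho =
  prod_pmf (row_pmf (fin_law P (ix \o X i0 j0)) (fin_law P (iy \o Y i0 l0))) rho.
Proof.
rewrite /fin_law row_codesE XY//.
rewrite (iidX.1 [set: 'I_n * 'I_d]%SET (fun k => ix @^-1` [set (rho k.1).1 k.2])); last by move=> k; exact: mix.
rewrite (iidY.1 [set: 'I_n * 'I_p]%SET (fun k => iy @^-1` [set (rho k.1).2 k.2])); last by move=> k; exact: miy.
have fX (k : 'I_n * 'I_d) : P (X k.1 k.2 @^-1` (ix @^-1` [set (rho k.1).1 k.2])) =
    (fin_law P (ix \o X i0 j0) ((rho k.1).1 k.2))%:E.
  have /= := iidX.2 k.1 k.2 i0 j0 (ix @^-1` [set (rho k.1).1 k.2]) (mix _).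
  rewrite /distribution /pushforward => ->; rewrite fineK//; apply: fin_num_measure; exact: mXpre.
have fY (k : 'I_n * 'I_p) : P (Y k.1 k.2 @^-1` (iy @^-1` [set (rho k.1).2 k.2])) =
    (fin_law P (iy \o Y i0 l0) ((rho k.1).2 k.2))%:E.
  have /= := iidY.2 k.1 k.2 i0 l0 (iy @^-1` [set (rho k.1).2 k.2]) (miy _).
  rewrite /distribution /pushforward => ->; rewrite fineK//; apply: fin_num_measure; exact: mYpre.
rewrite (eq_bigr _ (fun k _ => fX k)) (eq_bigr _ (fun k _ => fY k)).
rewrite !prodEFin -EFinM /=.
under eq_bigl do rewrite inE; under [X in _ * X]eq_bigl do rewrite inE.
rewrite -(pair_bigA _ (fun i j => fin_law P (ix \o X i0 j0) ((rho i).1 j))).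
rewrite -(pair_bigA _ (fun i j => fin_law P (iy \o Y i0 l0) ((rho i).2 j))).
by rewrite -big_split.
Qed.

Lemma fexp_row_codes (F : {ffun 'I_n -> {ffun 'I_d -> U} * {ffun 'I_p -> V}} -> R) :
  fexp (prod_pmf (row_pmf (fin_law P (ix \o X i0 j0)) (fin_law P (iy \o Y i0 l0)))) F =
  \int[P]_w F (row_codes w).
Proof.
rewrite -fexp_fin_law; last exact: measurable_row_codes.
by apply: eq_bigr => rho _; rewrite row_codes_law.
Qed.

End joint_law.

(** * Continuity of the trace of an inverse matrix *)

Section matrix_cvg.
Context (R : realType).

Lemma cvgr_sum (I : Type) (s : seq I) (F : I -> nat -> R) (l : I -> R) :
  (forall i, F i @ \oo --> l i) -> \sum_(i <- s) F i k @[k --> \oo] --> \sum_(i <- s) l i.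
Proof.
move=> Fl; elim: s => [|i s IH].
  rewrite big_nil (_ : (fun k => _) = cst 0); first exact: cvg_cst.
  by apply/funext => k; rewrite big_nil.
rewrite big_cons (_ : (fun k => _) = fun k => F i k + \sum_(j <- s) F j k).
  exact: cvgD.
by apply/funext => k; rewrite big_cons.
Qed.

Lemma cvgr_prod (I : Type) (s : seq I) (F : I -> nat -> R) (l : I -> R) :
  (forall i, F i @ \oo --> l i) -> \prod_(i <- s) F i k @[k --> \oo] --> \prod_(i <- s) l i.
Proof.
move=> Fl; elim: s => [|i s IH].
  rewrite big_nil (_ : (fun k => _) = cst 1); first exact: cvg_cst.
  by apply/funext => k; rewrite big_nil.
rewrite big_cons (_ : (fun k => _) = fun k => F i k * \prod_(j <- s) F j k).
  exact: cvgM.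
by apply/funext => k; rewrite big_cons.
Qed.

Lemma cvg_det n (A : nat -> 'M[R]_n) (B : 'M[R]_n) :
  (forall i j, A k i j @[k --> \oo] --> B i j) -> \det (A k) @[k --> \oo] --> \det B.
Proof.
move=> AB; apply: cvgr_sum => s; apply: cvgM; first exact: cvg_cst.
by apply: cvgr_prod => i; exact: AB.
Qed.

(** By Cramer's rule the trace is a sum of principal minors divided by the determinant, hence
    continuous in the entries. *)
Lemma cvg_tr_invmx n (A : nat -> 'M[R]_n) (B : 'M[R]_n) :
  (forall k, A k \in unitmx) -> B \in unitmx ->
  (forall i j, A k i j @[k --> \oo] --> B i j) ->
  \tr (invmx (A k)) @[k --> \oo] --> \tr (invmx B).
Proof.
move=> uA uB AB.
have trE (M : 'M[R]_n) : M \in unitmx ->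
    \tr (invmx M) = (\det M)^-1 * \sum_(i < n) ((-1) ^+ (i + i) * \det (row' i (col' i M))).
  move=> uM; rewrite /invmx uM linearZ /=; congr (_ * _); apply: eq_bigr => i _.
  by rewrite mxE.
rewrite (trE _ uB) (_ : (fun k => _) = fun k => (\det (A k))^-1 *
   \sum_(i < n) ((-1) ^+ (i + i) * \det (row' i (col' i (A k))))); last first.
  by apply/funext => k; rewrite trE.
apply: cvgM.
  by apply: cvgV; [rewrite -unitfE -unitmxE|exact: cvg_det].
apply: cvgr_sum => i; apply: cvgM; first exact: cvg_cst.
apply: cvg_det => j k; rewrite !mxE (_ : (fun k => _) = fun m => A m (lift i j) (lift i k)) //.
by apply/funext => m; rewrite !mxE.
Qed.

End matrix_cvg.

Section stieltjes_mx.
Context (R : realType) (t : R) (n d p : nat).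
Hypothesis t0 : 0 < t.
Implicit Types (x : 'M[R]_(n, d)) (y : 'M[R]_(n, p)).

Definition row_outer x y i : 'rV[R]_(d * p) := outer (row i x) (row i y).

Definition scov_mx x y : 'M[R]_(d * p) :=
  (d * p)%:R^-1 *: \sum_i (row_outer x y i)^T *m row_outer x y i.

Definition stieltjes_mx x y : R := \tr (resolvent t (scov_mx x y)) / (d * p)%:R.

Lemma psd_scov_mx x y : psd (scov_mx x y).
Proof. by apply: psdZ; [rewrite invr_ge0|apply: psd_sum => i; exact: psd_gram]. Qed.

Lemma scov_mxE x y a b : scov_mx x y a b =
  (d * p)%:R^-1 * \sum_i row_outer x y i 0 a * row_outer x y i 0 b.
Proof.
rewrite mxE summxE; congr (_ * _); apply: eq_bigr => i _.
by rewrite mxE big_ord1 mxE.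
Qed.

Lemma stieltjes_mx_cvg (xk : nat -> 'M[R]_(n, d)) (yk : nat -> 'M[R]_(n, p)) x y :
  (forall i j, xk k i j @[k --> \oo] --> x i j) ->
  (forall i l, yk k i l @[k --> \oo] --> y i l) ->
  stieltjes_mx (xk k) (yk k) @[k --> \oo] --> stieltjes_mx x y.
Proof.
move=> xkx yky; apply: cvgM; last exact: cvg_cst.
apply: cvg_tr_invmx => [k||a b]; try exact/resolvent_unit/psd_scov_mx.
have hz i c : row_outer (xk k) (yk k) i 0 c @[k --> \oo] --> row_outer x y i 0 c.
  case/mxvec_indexP : c => j l; rewrite /row_outer outerE !mxE.
  rewrite (_ : (fun k => _) = fun k => xk k i j * yk k i l); first exact: cvgM.
  by apply/funext => k; rewrite outerE !mxE.
rewrite mxE scov_mxE (_ : (fun k => _) = fun k => (d * p)%:R^-1 *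
    (\sum_i row_outer (xk k) (yk k) i 0 a * row_outer (xk k) (yk k) i 0 b) + (t%:M : 'M[R]__) a b).
  apply: cvgD; last exact: cvg_cst.
  apply: cvgM; first exact: cvg_cst.
  by apply: cvgr_sum => i; apply: cvgM; exact: hz.
by apply/funext => k; rewrite mxE scov_mxE.
Qed.

Lemma scov_traceE (U V : finType) (vx : U -> R) (vy : V -> R)
    (r : {ffun 'I_n -> {ffun 'I_d -> U} * {ffun 'I_p -> V}}) :
  scov_trace t (row_val vx vy) r =
  stieltjes_mx (\matrix_(i, j) vx ((r i).1 j)) (\matrix_(i, l) vy ((r i).2 l)).
Proof.
rewrite /stieltjes_mx /scov_trace /scov /scov_mx.
do 3 congr (_ _ _).
congr (_ *: _); apply: eq_bigr => i _.
have -> : row_val vx vy (r i) = row_outer (\matrix_(i, j) vx ((r i).1 j))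
    (\matrix_(i, l) vy ((r i).2 l)) i.
  by congr outer; apply/rowP => j; rewrite !mxE.
by [].
Qed.

End stieltjes_mx.

(** * Passage to the limit in the discretisation, at fixed n *)

Section fixed_size.
Context d0 (T : measurableType d0) (R : realType) (P : probability T R).
Context (n d p : nat) (X : random_matrix P n d) (Y : random_matrix P n p).
Hypotheses (iidX : iid_entries X) (iidY : iid_entries Y) (XY : independent_rmx X Y).
Context (sx sy C : R).
Hypotheses (sx0 : 0 < sx) (sy0 : 0 < sy) (n0 : (0 < n)%N) (dgt0 : (0 < d)%N) (pgt0 : (0 < p)%N).
Hypothesis hX : forall i j,
    [/\ ('E_P[X i j] = 0)%E,
        ('E_P[(fun w => X i j w ^+ 2)%R] = (sx ^+ 2)%:E)%E
      & ('E_P[(fun w => X i j w ^+ 4)%R] <= C%:E)%E].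
Hypothesis hY : forall i j,
    [/\ ('E_P[Y i j] = 0)%E,
        ('E_P[(fun w => Y i j w ^+ 2)%R] = (sy ^+ 2)%:E)%E
      & ('E_P[(fun w => Y i j w ^+ 4)%R] <= C%:E)%E].
Context (t : R).
Hypothesis t0 : 0 < t.

Definition rstieltjes w : R :=
  stieltjes_mx t (sx^-1 *: rmx_val X w) (sy^-1 *: rmx_val Y w).

Let c : R := (d * p)%:R^-1.

Let dp0 : (0 < d * p)%N. Proof. by rewrite muln_gt0 dgt0. Qed.

Let i0 : 'I_n := Ordinal n0.
Let j0 : 'I_d := Ordinal dgt0.
Let l0 : 'I_p := Ordinal pgt0.
Let X0 := X i0 j0.
Let Y0 := Y i0 l0.

Let wx k := @code_law _ _ _ P X0 k.
Let wy k := @code_law _ _ _ P Y0 k.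
Let vx k := @code_val _ _ _ P X0 k.
Let vy k := @code_val _ _ _ P Y0 k.

Let codes k := row_codes X Y (@qidx R k.+1) (@qidx R k.+1).

Let pw k := prod_pmf (I := 'I_n) (row_pmf (d := d) (p := p) (@wx k) (@wy k)).

Let tr k := scov_trace t (n := n) (row_val (d := d) (p := p) (@vx k) (@vy k)).

Let fexpE k F : fexp (@pw k) F = \int[P]_w F (codes k w).
Proof.
exact: (fexp_row_codes iidX iidY XY (@measurable_qidx R k.+1) (@measurable_qidx R k.+1)).
Qed.

Let mcodes k F : measurable_fun setT (fun w => F (codes k w) : R).
Proof.
apply: (@measurable_fin_comp _ _ _ _ (codes k)).
move=> e; exact: (measurable_row_codes X Y (@measurable_qidx R k.+1) (@measurable_qidx R k.+1)).
Qed.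

Let tr_cvg w : tr (codes k w) @[k --> \oo] --> rstieltjes w.
Proof.
have [X1 X2 X4] := hX i0 j0; have [Y1 Y2 Y4] := hY i0 l0.
rewrite (_ : (fun k => _) = fun k => stieltjes_mx t
    (\matrix_(i, j) @vx k (qidx k.+1 (X i j w))) (\matrix_(i, l) @vy k (qidx k.+1 (Y i l w)))).
  apply: stieltjes_mx_cvg => // i j; rewrite !mxE mulrC.
    rewrite (_ : (fun k => _) = fun k => @vx k (qidx k.+1 (X i j w))); last first.
      by apply/funext => k; rewrite mxE.
    exact: (code_val_cvg sx0 X1 X2 X4).
  rewrite (_ : (fun k => _) = fun k => @vy k (qidx k.+1 (Y i j w))); last first.
    by apply/funext => k; rewrite mxE.
  exact: (code_val_cvg sy0 Y1 Y2 Y4).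
apply/funext => k.
have <- : \matrix_(i, j) @vx k ((codes k w i).1 j) = \matrix_(i, j) @vx k (qidx k.+1 (X i j w)).
  by apply/matrixP => i j; rewrite !mxE ffunE /= ffunE.
have <- : \matrix_(i, j) @vy k ((codes k w i).2 j) = \matrix_(i, j) @vy k (qidx k.+1 (Y i j w)).
  by apply/matrixP => i j; rewrite !mxE ffunE /= ffunE.
exact: scov_traceE.
Qed.

Let tr_bound k r : `|@tr k r| <= t^-1.
Proof.
rewrite ger0_norm; first exact: scov_trace_le.
exact: scov_trace_ge0.
Qed.

Lemma measurable_rstieltjes : measurable_fun setT rstieltjes.
Proof.
apply: (@measurable_fun_cvg _ _ _ _ (fun k w => tr (codes k w))) => [k|w _].
  exact: mcodes.
exact: tr_cvg.
Qed.

Lemma rstieltjes_ge0 w : 0 <= rstieltjes w.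
Proof.
apply: (cvgr_to_ge (tr_cvg (w := w))); apply: nearW => k.
exact: scov_trace_ge0.
Qed.

Let C' : R := C / sx ^+ 4 + C / sy ^+ 4 + 1.

(** The constant [kappa] of [scov_trace_equation], read off [row_qf_variance] by removing the factor
    [b]; [C'] bounds the fourth moments of both families of codes. *)
Definition qf_var_bound : R :=
  2 * (2 * C' + 8) * (C' * d%:R * p%:R ^+ 2 + d%:R ^+ 2 * p%:R).

Let moments : \forall k \near \oo,
  [/\ fexp (@wx k) (@vx k) = 0, fexp (@wx k) (fun e => @vx k e ^+ 2) = 1 &
      fexp (@wx k) (fun e => @vx k e ^+ 4) <= C'] /\
  [/\ fexp (@wy k) (@vy k) = 0, fexp (@wy k) (fun e => @vy k e ^+ 2) = 1 &
      fexp (@wy k) (fun e => @vy k e ^+ 4) <= C'].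
Proof.
have [X1 X2 X4] := hX i0 j0; have [Y1 Y2 Y4] := hY i0 l0.
have C0 : 0 <= C.
  rewrite -lee_fin (le_trans _ X4)//; apply: expectation_ge0 => w.
  by rewrite (exprM _ 2 2) sqr_ge0.
have a0 : 0 <= C / sx ^+ 4 by rewrite divr_ge0// exprn_ge0// ltW.
have b0 : 0 <= C / sy ^+ 4 by rewrite divr_ge0// exprn_ge0// ltW.
have := code_moments sx0 X1 X2 X4; apply: filterS2 (code_moments sy0 Y1 Y2 Y4).
move=> k [y1 y2 y4] [x1 x2 x4]; split; split=> //.
  by apply: le_trans x4 _; rewrite /C'; lra.
by apply: le_trans y4 _; rewrite /C'; lra.
Qed.

Let wxP k : is_pmf (@wx k). Proof. exact: code_law_pmf. Qed.
Let wyP k : is_pmf (@wy k). Proof. exact: code_law_pmf. Qed.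

Let rowP k : is_pmf (row_pmf (d := d) (p := p) (@wx k) (@wy k)).
Proof. exact: row_pmfP. Qed.

Let m : R := \int[P]_w rstieltjes w.

Let mk_cvg : fexp (@pw k) (@tr k) @[k --> \oo] --> m.
Proof.
rewrite (_ : (fun k => _) = fun k => \int[P]_w tr (codes k w)); last first.
  by apply/funext => k; rewrite fexpE.
apply: (@Rintegral_bounded_cvg _ _ _ _ _ _ t^-1).
- by move=> k; exact: mcodes.
- exact: tr_cvg.
- by move=> k w; exact: tr_bound.
Qed.

(** The inequality holds for the discretised matrices with a right-hand side independent of [k]. The
    left-hand side is continuous in the mean, which converges by bounded convergence. *)
Lemma rstieltjes_equation :
  `|1 - t * m - n%:R * c * (m / (1 + m))| <=
  n%:R * c * Num.sqrt (3 * (c / t) ^+ 2 * (qf_var_bound + 1 + n%:R)).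
Proof.
have m0 : 0 <= m by apply: Rintegral_ge0 => w _; exact: rstieltjes_ge0.
pose f x := `|1 - t * x - n%:R * c * (x / (1 + x))|.
have h : f (fexp (@pw k) (@tr k)) @[k --> \oo] --> f m.
  apply: cvg_norm; apply: cvgB.
    by apply: cvgB; [exact: cvg_cst|apply: cvgM; [exact: cvg_cst|exact: mk_cvg]].
  apply: cvgM; first exact: cvg_cst.
  apply: cvgM; first exact: mk_cvg.
  apply: cvgV; first by rewrite gt_eqF// ltr_pwDl.
  by apply: cvgD; [exact: cvg_cst|exact: mk_cvg].
apply: (cvgr_to_le h); apply: filterS moments => k [[x1 x2 x4] [y1 y2 y4]].
apply: scov_trace_equation => // A b b0 Asym Ab.
have := row_qf_variance b0 Asym Ab (wxP k) (wyP k) x1 x2 x4 y1 y2 y4.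
by move=> hv; apply: le_trans hv _; rewrite /qf_var_bound le_eqVlt; apply/orP; left; apply/eqP; ring.
Qed.

Lemma rstieltjes_concentration l : `|l| * (c / t) <= 2^-1 ->
  \int[P]_w expR (l * (rstieltjes w - m)) <= expR (n%:R * (2 * (l * (c / t)) ^+ 2)).
Proof.
move=> lc.
pose mk k := fexp (@pw k) (@tr k).
have h : \int[P]_w expR (l * (tr (codes k w) - mk k)) @[k --> \oo]
   --> \int[P]_w expR (l * (rstieltjes w - m)).
  have m0 k : `|mk k| <= t^-1.
    rewrite (le_trans (ler_norm_fexp _ _))//; first exact: (prod_pmfP _ (rowP k)).
    rewrite -[leRHS](fexp_cst (prod_pmfP 'I_n (rowP k))).
    by apply: (ler_fexp (prod_pmfP 'I_n (rowP k))) => r; exact: tr_bound.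
  apply: (@Rintegral_bounded_cvg _ _ _ _ _ _ (expR (`|l| * (t^-1 + t^-1)))).
  - by move=> k; exact: (mcodes (fun r => expR (l * (tr r - mk k)))).
  - move=> w; apply: continuous_cvg; first exact: continuous_expR.
    apply: cvgM; first exact: cvg_cst.
    by apply: cvgB; [exact: tr_cvg|exact: mk_cvg].
  - move=> k w; rewrite ger0_norm ?expR_ge0// ler_expR.
    rewrite (le_trans (ler_norm _))// normrM ler_wpM2l//.
    by rewrite (le_trans (ler_normB _ _))// lerD// tr_bound.
apply: (cvgr_to_le h); apply: nearW => k.
rewrite -(fexpE (fun r => expR (l * (tr r - mk k)))).
apply: scov_trace_concentration => //.
Qed.

End fixed_size.

(** * Eigenvalues and the empirical spectral distribution *)

Lemma prod_XsubC_perm (F : fieldType) (s u : seq F) :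
  \prod_(x <- s) ('X - x%:P) = \prod_(x <- u) ('X - x%:P) -> perm_eq s u.
Proof.
by move=> e; apply/allP => x _ /=; rewrite -!mu_prod_XsubC e.
Qed.

Section eigenvalues_resolvent.
Context (R : realType) (n : nat) (A : 'M[R]_n).
Hypothesis pA : psd A.
Local Notation toC := (real_complex R).

Let Asym : A^T = A := pA.1.

Lemma size_eigenvalues : size (eigenvalues A) = n.
Proof.
by apply/eqP; rewrite -eqSS -(size_char_poly A) (eigenvaluesP Asym) size_prod_XsubC.
Qed.

Lemma eigenvalues_ge0 x : x \in eigenvalues A -> 0 <= x.
Proof.
rewrite -root_prod_XsubC -(eigenvaluesP Asym) -eigenvalue_root_char.
move=> /eigenvalueP[v vA v0].
have h : qf A v = x * sqn v by rewrite /qf vA -scalemxAl mxE.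
have v1 : 0 < sqn v.
  rewrite lt_def sqn_ge0 andbT; apply: contra_neq v0; exact: sqn_eq0.
by rewrite -(pmulr_lge0 _ v1) -h pA.2.
Qed.

(** [eigenvalues] is specified only through the characteristic polynomial. The diagonal of a unitary
    diagonalisation over [R[i]] has the same one, hence is a permutation of the eigenvalues, and the
    trace is read off that diagonal. *)
Lemma trace_resolvent_eigenvalues t : 0 < t ->
  \tr (resolvent t A) = \sum_(x <- eigenvalues A) (x + t)^-1.
Proof.
move=> t0; pose AC := map_mx toC A.
have ACreal : AC \is a mxOver Num.real.
  by apply/mxOverP => i j; rewrite mxE; apply/complex_realP; exists (A i j).
have ACsym : AC \is symmetricmx.
  apply/is_hermitianmxP; rewrite scale1r; apply/matrixP => i j.
  by rewrite !mxE -[in LHS]Asym mxE.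
have /orthomx_spectralP ACE := symmetric_normalmx ACsym ACreal.
set D := spectral_diag AC in ACE.
have uQ := spectral_unit AC; set Q := spectralmx AC in ACE uQ.
have charD : char_poly AC = \prod_(x <- [seq D 0 i | i <- enum 'I_n]) ('X - x%:P).
  rewrite big_map big_enum /=.
  transitivity (char_poly (diag_mx D)); last first.
    by rewrite char_poly_trig ?diag_mx_is_trig//; apply: eq_bigr => i _; rewrite mxE eqxx mulr1n.
  pose polyQ := map_mx (@polyC R[i]) Q; pose polyV := map_mx (@polyC R[i]) (invmx Q).
  have VQ : polyV *m polyQ = 1%:M by rewrite -map_mxM mulVmx// map_mx1.
  rewrite /char_poly (_ : char_poly_mx AC = polyV *m char_poly_mx (diag_mx D) *m polyQ).
    by rewrite !det_mulmx mulrAC -det_mulmx VQ det1 mul1r.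
  rewrite /char_poly_mx mulmxBr mulmxBl -!map_mxM -ACE.
  by rewrite scalar_mxC -mulmxA VQ mulmx1.
have DE : perm_eq [seq toC x | x <- eigenvalues A] [seq D 0 i | i <- enum 'I_n].
  apply: prod_XsubC_perm; rewrite -charD big_map -map_char_poly (eigenvaluesP Asym).
  by rewrite rmorph_prod; apply: eq_bigr => x _; rewrite /= map_polyXsubC.
have D0 i : D 0 i + toC t != 0.
  have : D 0 i \in [seq D 0 i | i <- enum 'I_n] by rewrite map_f// mem_enum.
  rewrite -(perm_mem DE) => /mapP[x /eigenvalues_ge0 x0 ->].
  by rewrite -rmorphD /= fmorph_eq0 gt_eqF// ltr_wpDl.
have invE : map_mx toC (resolvent t A) =
    invmx Q *m diag_mx (\row_i (D 0 i + toC t)^-1) *m Q.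
  rewrite /resolvent map_invmx map_mxD map_scalar_mx /= -/AC.
  set M := AC + _; set N := _ *m _ *m Q.
  have NM : N *m M = 1%:M.
    have -> : M = invmx Q *m diag_mx (\row_i (D 0 i + toC t)) *m Q.
      rewrite (_ : diag_mx (\row_i (D 0 i + toC t)) = diag_mx D + (toC t)%:M).
        rewrite mulmxDr mulmxDl -ACE; congr (_ + _).
        by rewrite scalar_mxC -mulmxA mulVmx// mulmx1.
      by apply/matrixP => i j; rewrite !mxE; case: eqP => [->|]; rewrite ?mulr1n ?mulr0n ?addr0.
    rewrite /N !mulmxA mulmxK//.
    rewrite -(mulmxA (invmx Q)) (_ : diag_mx _ *m diag_mx _ = 1%:M) ?mulmx1 ?mulVmx//.
    rewrite mulmx_diag; apply/matrixP => i j; rewrite !mxE.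
    by rewrite mulVf.
  have uM : M \in unitmx by case/mulmx1_unit: NM.
  by rewrite -[LHS]mul1mx -NM mulmxK.
apply: (fmorph_inj toC).
rewrite -[LHS]/(toC _) -trace_map_mx invE mxtrace_mulC mulmxA mulmxV// mul1mx mxtrace_diag.
transitivity (\sum_(x <- [seq D 0 i | i <- enum 'I_n]) (x + toC t)^-1).
  by rewrite big_map big_enum; apply: eq_bigr => i _; rewrite mxE.
rewrite -(perm_big _ DE) big_map rmorph_sum; apply: eq_bigr => x _.
by rewrite fmorphV rmorphD.
Qed.

Lemma integral_esd (f : R -> \bar R) : measurable_fun setT f ->
  (forall x, 0 <= f x)%E ->
  (\int[esd A]_x f x = (n%:R^-1)%:E * \sum_(x <- eigenvalues A) f x)%E.
Proof.
move=> mf f0; rewrite ge0_integral_mscale//; congr (_ * _)%E.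
rewrite ge0_integral_measure_sum//.
rewrite (big_nth 0) size_eigenvalues big_mkord; apply: eq_bigr => i _.
by rewrite integral_dirac// diracT mul1e.
Qed.

Lemma Rintegral_esd (f : R -> R) : measurable_fun setT f ->
  \int[esd A]_x f x = n%:R^-1 * \sum_(x <- eigenvalues A) f x.
Proof.
move=> mf; have mfE : measurable_fun setT (EFin \o f) by exact/measurable_EFinP.
have pos : ((fun x => (f x)%:E)^\+ = fun x => (Num.max (f x) 0)%:E)%E.
  by apply/funext => x; rewrite funeposE EFin_max.
have neg : ((fun x => (f x)%:E)^\- = fun x => (Num.max (- f x) 0)%:E)%E.
  by apply/funext => x; rewrite funenegE EFin_max.
rewrite /Rintegral integralE.
rewrite integral_esd; [|exact: measurable_funepos|by move=> x; exact: funepos_ge0].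
rewrite integral_esd; [|exact: measurable_funeneg|by move=> x; exact: funeneg_ge0].
rewrite pos neg !sumEFin -!EFinM -EFinB /= -mulrBr -sumrB; congr (_ * _).
apply: eq_bigr => x _; have [f0|f0] := leP 0 (f x).
  by rewrite max_r ?subr0// oppr_le0.
by rewrite max_l ?sub0r ?opprK// oppr_ge0 ltW.
Qed.

End eigenvalues_resolvent.

(** * Test functions generated by resolvents *)

Section weierstrass.
Context (R : realType).

Lemma continuous_uniform_itv (f : R -> R) (e : R) : continuous f -> 0 < e ->
  exists2 dl : R, 0 < dl &
    forall u v, 0 <= u <= 1 -> `|v - u| < dl -> `|f v - f u| <= e.
Proof.
move=> cf e0.
have /compact_near_coveringP ncK : compact `[(0 : R), 1] by exact: segment_compact.
have := ncK R (0 : R)^'+ (fun dl u => forall v, `|v - u| < dl -> `|f v - f u| <= e).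
case.
  move=> u _.
  have /cvgrPdist_lt/(_ (e / 2)) := cf u; rewrite divr_gt0// => /(_ isT) /nbhs_ballP[eta /= eta0 he].
  near=> u' dl => /= v vu.
  have hu' : `|f u - f u'| < e / 2.
    apply: he; rewrite /ball /=; near: u'; apply/nbhs_ballP; exists eta => //.
  have hv : `|f u - f v| < e / 2.
    apply: he; rewrite /ball /=.
    have h1 : `|u - u'| < eta / 2.
      by near: u'; apply/nbhs_ballP; exists (eta / 2) => //=; rewrite divr_gt0.
    have h2 : dl < eta / 2.
      by near: dl; apply: nbhs_right_lt; rewrite divr_gt0.
    rewrite (_ : u - v = (u - u') - (v - u')); last by ring.
    by rewrite (le_lt_trans (ler_normB _ _))// [eta]splitr ltrD// (lt_trans vu).
  rewrite (_ : f v - f u' = (f u - f u') - (f u - f v)); last by ring.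
  by rewrite (le_trans (ler_normB _ _))// [e]splitr lerD// ltW.
move=> x /= x0 hx; exists (x / 2); first by rewrite divr_gt0.
have x20 : 0 < x / 2 by rewrite divr_gt0.
have xb : `|0 - x / 2| < x by rewrite sub0r normrN gtr0_norm// ltr_pdivrMr// ltr_pMr// ltr1n.
by move=> u v u01; apply: (hx _ xb x20); rewrite /= in_itv.
Unshelve. all: by end_near. Qed.

Section bernstein.
Context (u : R) (n : nat).
Hypotheses (u01 : 0 <= u <= 1) (n0 : (0 < n)%N).

Definition coin (b : bool) : R := if b then u else 1 - u.

Lemma coin_pmf : is_pmf coin.
Proof.
have /andP[u0 u1] := u01; split=> [[]|]; rewrite /coin ?subr_ge0//.
by rewrite big_bool /=; ring.
Qed.

Definition heads (r : {ffun 'I_n -> bool}) : nat := \sum_i r i.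

Let freq (r : {ffun 'I_n -> bool}) : R := (heads r)%:R / n%:R.

Let freqE r : freq r = n%:R^-1 * \sum_i (r i)%:R.
Proof. by rewrite /freq /heads natr_sum mulrC. Qed.

Let nR0 : (n%:R : R) != 0. Proof. by rewrite pnatr_eq0 -lt0n. Qed.

Let freq_mean : fexp (prod_pmf coin) freq = u.
Proof.
under eq_fexp do rewrite freqE.
rewrite fexpZ fexp_sum (eq_bigr (fun=> u)); last first.
  move=> i _; rewrite (fexp_coord coin_pmf i (fun b => b%:R)).
  by rewrite /fexp big_bool /= mulr1 mulr0 addr0.
by rewrite sumr_const card_ord -[u *+ n]mulr_natl mulrA mulVf// mul1r.
Qed.

(** One toss moves the frequency by at most 1 / n, and Efron-Stein adds up n squares. *)
Lemma freq_variance : fexp (prod_pmf coin) (fun r => (freq r - u) ^+ 2) <= n%:R^-1.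
Proof.
have := efron_stein (I := 'I_n) coin_pmf freq; rewrite freq_mean.
move=> h; apply: (le_trans h).
have -> : (n%:R^-1 : R) = \sum_(i < n) n%:R^-1 ^+ 2.
  by rewrite sumr_const card_ord -[RHS]mulr_natl expr2 mulrA mulfV// mul1r.
apply: ler_sum => i _.
rewrite -[leRHS](fexp_cst (prod_pmfP 'I_n coin_pmf)); apply: (ler_fexp (prod_pmfP _ coin_pmf)) => r.
have -> : freq r - E1 coin i freq r = fexp coin (fun b => ((r i)%:R - b%:R) / n%:R).
  rewrite -[freq r in LHS](fexp_cst coin_pmf) /E1 -fexpB; apply: eq_fexp => b.
  rewrite !freqE -mulrBr mulrC; congr (_ / _).
  rewrite (bigD1 i)//= [X in _ - X](bigD1 i)//= ffunE eqxx.
  rewrite [X in _ - (_ + X)](eq_bigr (fun j => (r j)%:R)); first by ring.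
  by move=> j /negbTE ji; rewrite ffunE ji.
apply: (le_trans (fexp_sqr_le coin_pmf _)).
rewrite -[leRHS](fexp_cst coin_pmf); apply: (ler_fexp coin_pmf) => b.
rewrite exprMn ler_piMl ?sqr_ge0//.
by case: (r i); case: b; rewrite ?subrr ?subr0 ?sub0r ?sqrrN ?expr0n ?expr1n.
Qed.

(** Indexed by the outcomes of [n] tosses instead of the number of heads, so that the value at [u]
    is an expectation over coins of bias [u] and no binomial coefficient appears. *)
Definition bernstein (f : R -> R) : {poly R} :=
  \sum_(r : {ffun 'I_n -> bool})
    f ((heads r)%:R / n%:R) *: ('X ^+ heads r * (1 - 'X) ^+ (n - heads r)).

Lemma bernsteinE f : (bernstein f).[u] = fexp (prod_pmf coin) (fun r => f (freq r)).
Proof.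
rewrite /bernstein horner_sum; apply: eq_bigr => r _.
have X1 : (1 - 'X : {poly R}).[u] = 1 - u by rewrite !hornerE.
rewrite hornerZ hornerM !horner_exp hornerX X1 [LHS]mulrC; congr (_ * _).
rewrite /prod_pmf (bigID (fun i => r i)) /=.
have h1 : heads r = #|[set i | r i]%SET|.
  by rewrite /heads -sum1_card big_mkcond [RHS]big_mkcond; apply: eq_bigr => i _; rewrite inE; case: (r i).
rewrite (eq_bigr (fun=> u)); last by move=> i; rewrite /coin => ->.
rewrite [X in _ = _ * X](eq_bigr (fun=> 1 - u)); last by move=> i /negbTE; rewrite /coin => ->.
rewrite !prodr_const h1; congr (_ * _); congr (_ ^+ _).
  by apply: eq_card => i; rewrite !inE.
rewrite -{1}(card_ord n) -(cardsC [set i | r i]%SET) addKn.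
by apply: eq_card => i; rewrite !inE.
Qed.

End bernstein.

Theorem weierstrass_approximation (f : R -> R) (e : R) : continuous f -> 0 < e ->
  exists q : {poly R}, forall u, 0 <= u <= 1 -> `|f u - q.[u]| <= e.
Proof.
move=> cf e0.
have [dl dl0 hd] := @continuous_uniform_itv f (e / 2) cf (divr_gt0 e0 (ltr0n _ 2)).
have [c _ hc] : exists2 c, c \in `[(0 : R), 1] & forall v, v \in `[(0 : R), 1] -> `|f v| <= `|f c|.
  apply: EVT_max => //; apply: continuous_subspaceT => x.
  by apply: continuous_comp; [exact: cf|exact: norm_continuous].
(* [K (v - u)^2] is at least the oscillation bound [2 M] once [|v - u| >= dl]: Chebyshev's
   inequality before integration. *)
pose M : R := `|f c|; pose K : R := 2 * M / dl ^+ 2.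
have M0 : 0 <= M by exact: normr_ge0.
have dl20 : 0 < dl ^+ 2 by rewrite exprn_gt0.
have K0 : 0 <= K by rewrite divr_ge0 ?(ltW dl20)// mulr_ge0.
have fK u v : 0 <= u <= 1 -> 0 <= v <= 1 -> `|f v - f u| <= e / 2 + K * (v - u) ^+ 2.
  move=> u01 v01; have [vu|vu] := ltP `|v - u| dl.
    by rewrite (le_trans (hd _ _ u01 vu))// lerDl mulr_ge0 ?sqr_ge0.
  apply: (@le_trans _ _ (2 * M)).
    rewrite (le_trans (ler_normB _ _))// mulrDl !mul1r lerD//; apply: hc; rewrite in_itv//.
  apply: (@le_trans _ _ (K * (v - u) ^+ 2)); last by rewrite lerDr divr_ge0// ltW.
  rewrite /K -mulrA ler_peMr ?mulr_ge0// mulrC ler_pdivlMr// mul1r.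
  by rewrite -[leRHS]real_normK ?num_real// lerXn2r// nnegrE// ltW.
clearbody K.
pose n := (Num.truncn (2 * K / e)).+1.
have n0 : (0 < n)%N by [].
have nK : K / n%:R <= e / 2.
  have : 2 * K / e <= n%:R by rewrite ltW// truncnS_gt.
  by rewrite !ler_pdivrMr ?ltr0n// => h; lra.
exists (bernstein n f) => u u01; rewrite bernsteinE//.
have pP := prod_pmfP 'I_n (coin_pmf u01).
rewrite -[f u in X in X <= _](fexp_cst pP) -fexpB.
apply: (le_trans (ler_norm_fexp pP _)).
apply: (@le_trans _ _ (fexp (prod_pmf (coin u)) (fun r : {ffun 'I_n -> bool} =>
    e / 2 + K * ((heads r)%:R / n%:R - u) ^+ 2))).
  apply: (ler_fexp pP) => r; rewrite distrC; apply: fK => //.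
  rewrite divr_ge0//= ler_pdivrMr ?ltr0n// mul1r ler_nat.
  by rewrite -[leqRHS](card_ord n) -sum1_card leq_sum// => i _; exact: leq_b1.
rewrite fexpD (fexp_cst pP) fexpZ [leRHS]splitr lerD2l.
apply: le_trans nK; rewrite ler_wpM2l//; exact: freq_variance.
Qed.

End weierstrass.

(** * Function classes closed under linear combinations and uniform limits on the half-line *)

Section resolvent_class.
Context (R : realType) (A : (R -> R) -> Prop).
Hypotheses (A_cst : A (fun=> 1))
  (A_lin : forall a f b g, A f -> A g -> A (fun x => a * f x + b * g x))
  (A_lim : forall f, (forall e, 0 < e ->
     exists2 g, A g & forall x, 0 <= x -> `|f x - g x| <= e) -> A f)
  (A_res : forall i j : nat, A (fun x => (x + i.+1%:R / j.+1%:R)^-1)).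

Let eqA f g : A g -> (forall x, 0 <= x -> f x = g x) -> A f.
Proof.
move=> Ag fg; apply: A_lim => e e0; exists g => // x x0.
by rewrite fg// subrr normr0 ltW.
Qed.

Let D (t : R) := exists i j : nat, t = i.+1%:R / j.+1%:R.

Let D_gt0 t : D t -> 0 < t.
Proof. by move=> [i [j ->]]; rewrite divr_gt0. Qed.

(* Partial fractions reduce a product of simple poles to shorter products. *)
Let A_poles (s : seq R) : uniq s -> (forall t, t \in s -> D t) ->
  A (fun x => \prod_(t <- s) (x + t)^-1).
Proof.
move: {2}(size s).+1 (ltnSn (size s)) => N; elim: N s => // N IH [|t1 [|t2 s]] sN us sD.
- by apply: (eqA A_cst) => x _; rewrite big_nil.
- have [i [j tE]] := sD _ (mem_head _ _).
  by apply: (eqA (A_res i j)) => x _; rewrite big_seq1 tE.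
have [t1D t2D] : D t1 /\ D t2 by split; apply: sD; rewrite !inE eqxx ?orbT.
have t12 : t2 - t1 != 0.
  by rewrite subr_eq0; apply: contraTneq us => ->; rewrite /= mem_head.
have A1 : A (fun x => \prod_(t <- t1 :: s) (x + t)^-1).
  apply: IH => //.
    by move: us => /= /andP[]; rewrite inE negb_or => /andP[_ ->] /andP[_ ->].
  by move=> t; rewrite inE => ts; apply: sD; rewrite !inE; case/orP: ts => ->; rewrite ?orbT.
have A2 : A (fun x => \prod_(t <- t2 :: s) (x + t)^-1).
  apply: IH => //; first by move: us => /= /andP[].
  by move=> t ts; apply: sD; rewrite inE ts orbT.
apply: (eqA (A_lin (t2 - t1)^-1 (- (t2 - t1)^-1) A1 A2)) => x x0.
rewrite !big_cons; set Q := \prod_(_ <- _) _.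
have x1 : x + t1 != 0 by rewrite gt_eqF// ltr_wpDl// D_gt0.
have x2 : x + t2 != 0 by rewrite gt_eqF// ltr_wpDl// D_gt0.
by field; rewrite x1 x2 t12.
Qed.

(** Partial fractions need distinct poles, so the multiple pole is split into [m] rational ones,
    shifted by at most [m / (k + 1)]. All factors lie in [0, 1], so the products differ by at most
    [m] times that shift. *)
Let A_pow (c m : nat) : A (fun x => ((x + c.+1%:R)^-1) ^+ m).
Proof.
apply: A_lim => e e0.
pose t (k i : nat) : R := c.+1%:R + i.+1%:R / k.+1%:R.
have tD k i : D (t k i).
  exists (c.+1 * k.+1 + i)%N, k; rewrite /t -addnS natrD natrM mulrDl mulfK//.
have [k hk] : exists k : nat, m%:R * (m%:R / k.+1%:R) <= e.
  exists (Num.truncn (m%:R * m%:R / e)); rewrite mulrA ler_pdivrMr//.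
  by rewrite -ler_pdivrMl// mulrC ltW// truncnS_gt.
exists (fun x => \prod_(u <- [seq t k i | i <- index_iota 0 m]) (x + u)^-1).
  apply: A_poles.
    have kV : (k.+1%:R^-1 : R) != 0 by rewrite invr_eq0 pnatr_eq0.
    by rewrite map_inj_uniq ?iota_uniq// => i j /addrI /(mulIf kV) /eqP; rewrite eqr_nat => /eqP[].
  by move=> u /mapP[i _ ->].
move=> x x0; rewrite big_map distrC; apply: le_trans hk.
set b := m%:R / k.+1%:R; set y := (x + c.+1%:R)^-1.
have b0 : 0 <= b by rewrite divr_ge0.
have y01 : 0 <= y <= 1.
  by rewrite invr_ge0 invf_le1 ?addr_ge0 ?ltr_wpDl//= (le_trans _ (_ : c.+1%:R <= _)) ?lerDr// ler1n.
have /andP[y0 y1] := y01.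
have yk i : (i < m)%N -> 0 <= (x + t k i)^-1 <= 1 /\ `|(x + t k i)^-1 - y| <= b.
  move=> im; pose a : R := i.+1%:R / k.+1%:R.
  have a0 : 0 <= a by rewrite divr_ge0.
  have ab : a <= b by rewrite ler_wpM2r ?invr_ge0// ler_nat.
  have X1 : 1 <= x + c.+1%:R by rewrite (@le_trans _ _ c.+1%:R) ?ler1n// lerDr.
  rewrite /t addrA -/a /y; move: X1; set X0 := x + c.+1%:R => X1.
  have X2 : 1 <= X0 + a by rewrite (le_trans X1)// lerDl.
  have [p1 p2] : 0 < X0 /\ 0 < X0 + a by split; apply: lt_le_trans ltr01 _.
  split; first by rewrite invr_ge0 (ltW p2) invf_le1.
  rewrite (_ : (X0 + a)^-1 - X0^-1 = - (a / ((X0 + a) * X0))).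
    rewrite normrN ger0_norm ?divr_ge0 ?mulr_ge0 ?(ltW p1) ?(ltW p2)//.
    by rewrite (le_trans _ ab)// ler_pdivrMr ?mulr_gt0// ler_peMr// mulr_ege1.
  by field; rewrite !gt_eqF.
have ind j : (j <= m)%N -> `|\prod_(0 <= i < j) (x + t k i)^-1 - y ^+ j| <= j%:R * b.
  elim: j => [_|j IH jm]; first by rewrite big_nil expr0 subrr normr0 mul0r.
  have [/andP[z0 z1] zy] := yk _ jm.
  rewrite big_nat_recr//= exprSr.
  set F := \prod_(_ <= _ < _) _; set z := (x + t k j)^-1.
  rewrite (_ : F * z - y ^+ j * y = (F - y ^+ j) * z + y ^+ j * (z - y)); last by ring.
  have -> : j.+1%:R * b = j%:R * b + b by rewrite -natr1 mulrDl mul1r.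
  rewrite (le_trans (ler_normD _ _))// !normrM lerD//.
    by rewrite (le_trans _ (IH (ltnW jm)))// ler_piMr// ger0_norm.
  by rewrite (le_trans _ zy)// ler_piMl// ger0_norm ?exprn_ge0// exprn_ile1.
exact: ind.
Qed.

Let A_sum (I : Type) (s : seq I) (a : I -> R) (f : I -> R -> R) :
  (forall i, A (f i)) -> A (fun x => \sum_(i <- s) a i * f i x).
Proof.
move=> Af; elim: s => [|i s IH].
  by apply: (eqA (A_lin 0 0 A_cst A_cst)) => x _; rewrite big_nil; ring.
by apply: (eqA (A_lin (a i) 1 (Af i) IH)) => x _; rewrite big_cons mul1r.
Qed.

(** With [k = c + 1], the map [u = k / (x + k)] sends [0, +oo[ onto ]0, 1] and the function becomes
    [g u = u f (k / u - k)]. The factor [u] makes [g] continuous at 0 although [f] may have no limit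
    at infinity; a polynomial close to [g] is a combination of powers of [(x + k)^-1]. *)
Lemma resolvent_class_cutoff (f : R -> R) (M : R) (c : nat) :
  continuous f -> (forall x, `|f x| <= M) ->
  A (fun x => f x * (c.+1%:R / (x + c.+1%:R))).
Proof.
move=> cf fM; have M0 : 0 <= M by exact: le_trans (fM 0).
pose k : R := c.+1%:R; have k0 : 0 < k by [].
pose g u := u * f (k / u - k).
have cg : continuous g.
  move=> u; have [->|u0] := eqVneq u 0.
    apply/cvgrPdist_le => e e0; near=> v.
    rewrite /g mul0r sub0r normrN normrM.
    rewrite (@le_trans _ _ (`|v| * (M + 1)))//.
      by rewrite ler_wpM2l// (le_trans (fM _))// lerDl.
    rewrite -ler_pdivlMr; last by rewrite ltr_wpDl.
    near: v; apply/nbhs_ballP; exists (e / (M + 1)) => /=.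
      by rewrite divr_gt0// ltr_wpDl.
    by move=> v; rewrite /ball /= sub0r normrN => /ltW.
  apply: cvgM; first exact: cvg_id.
  apply: continuous_cvg; first exact: cf.
  apply: cvgB; last exact: cvg_cst.
  apply: cvgM; first exact: cvg_cst.
  by apply: cvgV; [exact: u0|exact: cvg_id].
apply: A_lim => e e0; have [q hq] := weierstrass_approximation cg e0.
exists (fun x => \sum_(i <- index_iota 0 (size q)) (q`_i * k ^+ i) * ((x + k)^-1) ^+ i).
  by apply: A_sum => i; exact: A_pow.
move=> x x0; have xk : 0 < x + k by rewrite ltr_wpDl.
rewrite (_ : f x * _ = g (k / (x + k))).
  rewrite (_ : \sum_(_ <- _) _ = q.[k / (x + k)]).
    by apply: hq; rewrite divr_ge0 ?(ltW xk)//= ler_pdivrMr// mul1r lerDr.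
  rewrite horner_coef big_mkord; apply: eq_bigr => i _.
  by rewrite exprMn mulrA.
rewrite /g -/k [LHS]mulrC; congr (_ * f _).
by rewrite invfM invrK mulrA divff ?gt_eqF// mul1r addrK.
Unshelve. all: by end_near. Qed.

End resolvent_class.

(** * From resolvents to weak convergence *)

Section resolvent_convergence.
Context (R : realType) (s : nat -> seq R) (mu : probability R R).
Hypotheses (size_s : forall n, size (s n) = n)
  (s_ge0 : forall n x, x \in s n -> 0 <= x) (mu_neg : mu `]-oo, 0[%classic = 0%E)
  (res_cvg : forall i j : nat,
    n%:R^-1 * \sum_(x <- s n) (x + i.+1%:R / j.+1%:R)^-1 @[n --> \oo] -->
    \int[mu]_x (`|x| + i.+1%:R / j.+1%:R)^-1).

Let L n (f : R -> R) := n%:R^-1 * \sum_(x <- s n) f x.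

Let L_lin n a f b g : L n (fun x => a * f x + b * g x) = a * L n f + b * L n g.
Proof. by rewrite /L big_split /= -!mulr_sumr; ring. Qed.

Let L_norm_le n f g : (forall x, 0 <= x -> `|f x| <= g x) -> `|L n f| <= L n g.
Proof.
move=> fg; rewrite /L normrM ger0_norm ?invr_ge0// ler_wpM2l ?invr_ge0//.
rewrite (le_trans (ler_norm_sum _ _ _))// big_seq [leRHS]big_seq.
by apply: ler_sum => x /s_ge0; exact: fg.
Qed.

Let L_cst n a : (0 < n)%N -> L n (fun=> a) = a.
Proof.
move=> n0; rewrite /L big_const_seq count_predT size_s iter_addr_0 -[a *+ n]mulr_natl.
by rewrite mulrA mulVf ?mul1r// pnatr_eq0 -lt0n.
Qed.

Let LB n f g : L n f - L n g = L n (fun x => f x - g x).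
Proof. by rewrite /L -mulrBr -sumrB. Qed.

(** Functions are controlled on [0, +oo[ only, and the absolute value hides the rest of the line.
    [I_abs] removes it, because [mu] does not charge the negative half-line. *)
Let I (f : R -> R) := \int[mu]_x f `|x|.

Definition resolvent_cvg_class (f : R -> R) := [/\ measurable_fun [set: R] (fun x : R => f `|x|),
  exists M, forall x, 0 <= x -> `|f x| <= M & L n f @[n --> \oo] --> I f].
Let A := resolvent_cvg_class.

Let A_int f : A f -> mu.-integrable [set: R] (fun x : R => (f `|x|)%:E).
Proof. by move=> [mf [M fM] _]; apply: (@integrable_bounded _ _ _ _ _ M) => // x; exact: fM. Qed.

Let A_cst : A (fun=> 1).
Proof.
split=> //; first by exists 1 => x _; rewrite normr1.
rewrite /I Rintegral_cst// mul1r [X in fine X](probability_setT mu).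
apply: cvg_near_cst; near=> n; apply: L_cst; near: n; exact: nbhs_infty_gt.
Unshelve. all: by end_near. Qed.

Let I_lin a f b g : mu.-integrable [set: R] (fun x : R => (f `|x|)%:E) ->
  mu.-integrable [set: R] (fun x : R => (g `|x|)%:E) ->
  I (fun x => a * f x + b * g x) = a * I f + b * I g.
Proof.
move=> iF iG; rewrite /I RintegralD//; last 2 first.
- by apply: (eq_integrable _ (fun x : R => a%:E * (f `|x|)%:E)%E) => //; exact/integrableZl.
- by apply: (eq_integrable _ (fun x : R => b%:E * (g `|x|)%:E)%E) => //; exact/integrableZl.
by rewrite !RintegralZl.
Qed.

Let A_lin a f b g : A f -> A g -> A (fun x => a * f x + b * g x).
Proof.
move=> Af Ag; have [mf [M fM] fl] := Af; have [mg [N gN] gl] := Ag; split.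
- by apply: measurable_funD; apply: measurable_funM.
- exists (`|a| * M + `|b| * N) => x x0; rewrite (le_trans (ler_normD _ _))// !normrM.
  by rewrite lerD// ler_wpM2l// ?fM ?gN.
- rewrite (I_lin _ _ (A_int Af) (A_int Ag)).
  rewrite (_ : (fun n => _) = fun n => a * L n f + b * L n g); last first.
    by apply/funext => n; rewrite L_lin.
  by apply: cvgD; apply: cvgM => //; exact: cvg_cst.
Qed.

Let I_norm_le f g : mu.-integrable [set: R] (fun x : R => (f `|x|)%:E) ->
  mu.-integrable [set: R] (fun x : R => (g `|x|)%:E) ->
  (forall x, 0 <= x -> `|f x| <= g x) -> `|I f| <= I g.
Proof.
move=> iF iG fg; rewrite (le_trans (le_normr_Rintegral _ iF))//.
apply: le_Rintegral => //; first exact: (integrable_norm iF).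
by move=> x _; exact: fg.
Qed.

Let IB f g : mu.-integrable [set: R] (fun x : R => (f `|x|)%:E) ->
  mu.-integrable [set: R] (fun x : R => (g `|x|)%:E) ->
  I f - I g = I (fun x => f x - g x).
Proof. by move=> iF iG; rewrite /I RintegralB. Qed.

Let iB f g : mu.-integrable [set: R] (fun x : R => (f `|x|)%:E) ->
  mu.-integrable [set: R] (fun x : R => (g `|x|)%:E) ->
  mu.-integrable [set: R] (fun x : R => (f `|x| - g `|x|)%:E).
Proof.
move=> iF iG.
by apply: (eq_integrable _ (fun x : R => (f `|x|)%:E - (g `|x|)%:E)%E) => //; exact: integrableB.
Qed.

Let I_cst a : I (fun=> a) = a.
Proof. by rewrite /I Rintegral_cst// [X in fine X](probability_setT mu) mulr1. Qed.

Let A_lim f : (forall e, 0 < e ->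
     exists2 g, A g & forall x, 0 <= x -> `|f x - g x| <= e) -> A f.
Proof.
move=> h; have mf : measurable_fun [set: R] (fun x : R => f `|x|).
  have /choice[G hG] : forall k : nat, exists g, A g /\ forall x, 0 <= x -> `|f x - g x| <= k.+1%:R^-1.
    by move=> k; have [|g Ag gk] := h k.+1%:R^-1; [rewrite invr_gt0|exists g].
  apply: (@measurable_fun_cvg _ _ _ _ (fun (k : nat) (x : R) => G k `|x|)).
    by move=> k; have [[]] := hG k.
  move=> x _; apply/cvgrPdist_le => e e0; near=> k.
  rewrite (le_trans ((hG k).2 _ _))//.
  by rewrite invf_ple ?posrE//; near: k; exact: near_ger_nat.
have [M fM] : exists M, forall x, 0 <= x -> `|f x| <= M.
  have [g [_ [M gM] _] fg] := h 1 ltr01; exists (M + 1) => x x0.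
  rewrite -[f x](subrK (g x)) addrC (le_trans (ler_normD _ _))// lerD ?gM ?fg//.
split=> //; first by exists M.
have iF : mu.-integrable [set: R] (fun x : R => (f `|x|)%:E).
  by apply: (@integrable_bounded _ _ _ _ _ M) => // x; exact: fM.
apply/cvgrPdist_le => e e0; have e30 : 0 < e / 3 by rewrite divr_gt0.
have [g Ag fg] := h _ e30; have [_ _ /cvgrPdist_le/(_ _ e30) gl] := Ag.
near=> n; have n0 : (0 < n)%N by near: n; exact: nbhs_infty_gt.
have d1 : `|I f - I g| <= e / 3.
  rewrite (IB iF (A_int Ag)) -[leRHS]I_cst.
  by apply: I_norm_le => //; [exact: iB (A_int Ag)|exact: finite_measure_integrable_cst].
have d2 : `|L n g - L n f| <= e / 3.
  rewrite distrC LB -[leRHS](L_cst _ n0); exact: L_norm_le.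
have d3 : `|I g - L n g| <= e / 3 by near: n.
rewrite (_ : I f - L n f = (I f - I g) + (I g - L n g) + (L n g - L n f)); last by ring.
rewrite (le_trans (ler_normD _ _))// (le_trans (lerD (ler_normD _ _) (lexx _)))//.
rewrite (_ : e = e / 3 + e / 3 + e / 3); last by field.
by rewrite !lerD.
Unshelve. all: by end_near. Qed.

Let A_res i j : A (fun x => (x + i.+1%:R / j.+1%:R)^-1).
Proof.
have t0 : 0 < i.+1%:R / j.+1%:R :> R by rewrite divr_gt0.
split; last exact: res_cvg.
- apply: continuous_measurable_fun => x; apply: cvgV.
    by rewrite gt_eqF// ltr_wpDl.
  by apply: cvgD; [exact: norm_continuous|exact: cvg_cst].
- exists (i.+1%:R / j.+1%:R)^-1 => x x0; rewrite ger0_norm ?invr_ge0 ?addr_ge0// ?(ltW t0)//.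
  by rewrite lef_pV2 ?posrE ?ltr_wpDl// lerDr.
Qed.

Let cutoff (c : nat) (x : R) := c.+1%:R / (x + c.+1%:R).

Let cutoff01 c x : 0 <= x -> 0 <= cutoff c x <= 1.
Proof.
move=> x0; have xc : 0 < x + c.+1%:R by rewrite ltr_wpDl.
by rewrite divr_ge0 ?(ltW xc)//= ler_pdivrMr// mul1r lerDr.
Qed.

Let A_cutoff (f : R -> R) (M : R) (c : nat) : continuous f -> (forall x, `|f x| <= M) ->
  A (fun x => f x * cutoff c x).
Proof. by move=> cf fM; exact: (resolvent_class_cutoff A_cst A_lin A_lim A_res c cf fM). Qed.

Let I_cutoff : I (fun x => 1 * cutoff c x) @[c --> \oo] --> (1 : R).
Proof.
rewrite -[X in _ --> X](I_cst 1).
apply: (@Rintegral_bounded_cvg _ _ _ _ _ _ 1).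
- move=> c; have [] := @A_cutoff (fun=> 1) 1 c => //; first by move=> x; exact: cvg_cst.
  by move=> x; rewrite normr1.
- move=> x; apply/cvgrPdist_le => e e0; near=> c.
  have xc : 0 < `|x| + c.+1%:R by rewrite ltr_wpDl.
  rewrite /cutoff mul1r (_ : 1 - _ = `|x| / (`|x| + c.+1%:R)); last first.
    by field; rewrite gt_eqF.
  rewrite ger0_norm ?divr_ge0 ?(ltW xc)// ler_pdivrMr// -ler_pdivrMl//.
  rewrite mulrC (@le_trans _ _ c.+1%:R)// ?lerDr//.
  by near: c; exact: near_ger_nat.
- by move=> c x; rewrite mul1r; have /andP[h0 h1] := cutoff01 c (normr_ge0 x); rewrite ger0_norm.
Unshelve. all: by end_near. Qed.

Let I_abs (f : R -> R) (M : R) : continuous f -> (forall x, `|f x| <= M) -> I f = \int[mu]_x f x.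
Proof.
move=> cf fM; have mf : measurable_fun [set: R] f by exact: continuous_measurable_fun.
have mfa : measurable_fun [set: R] (fun x : R => f `|x|).
  apply: continuous_measurable_fun => x.
  by apply: continuous_comp; [exact: norm_continuous|exact: cf].
congr fine; apply: ae_eq_integral => //; [exact/measurable_EFinP|exact/measurable_EFinP|].
exists `]-oo, 0[%classic; split => // x /= h; rewrite in_itv /= ltNge; apply/negP => x0.
by apply: h => _; rewrite ger0_norm.
Qed.

(** Tightness comes from the total masses: [f] differs from its cutoff by at most [M (1 - cutoff)],
    and the means of [1 - cutoff] converge to [1 - I cutoff], which is small for large [c] since
    [mu] has mass 1. *)
Theorem resolvent_weak_cvg (f : R -> R) : continuous f -> bounded_fun f ->
  n%:R^-1 * \sum_(x <- s n) f x @[n --> \oo] --> \int[mu]_x f x.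
Proof.
move=> cf [B [_ hB]]; pose M := `|B| + 1.
have fM x : `|f x| <= M by apply: hB => //; rewrite /M (le_lt_trans (ler_norm _))// ltrDl.
have M0 : 0 < M by rewrite /M ltr_wpDl.
rewrite -(I_abs cf fM).
apply/cvgrPdist_le => e e0; have e40 : 0 < e / (4 * M) by rewrite divr_gt0// mulr_gt0.
have [c hc] : exists c, `|1 - I (fun x => 1 * cutoff c x)| <= e / (4 * M).
  by have /cvgrPdist_le/(_ _ e40)[c _ hc] := I_cutoff; exists c; apply: hc => /=.
have A1 : A (fun x => 1 * cutoff c x).
  by apply: (@A_cutoff (fun=> 1) 1) => x; [exact: cvg_cst|rewrite normr1].
have Af := A_cutoff c cf fM.
have [_ _ /cvgrPdist_le/(_ _ e40) l1] := A1.
have e20 : 0 < e / 4 by rewrite divr_gt0.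
have [_ _ /cvgrPdist_le/(_ _ e20) l2] := Af.
have iF : mu.-integrable [set: R] (fun x : R => (f `|x|)%:E).
  apply: (@integrable_bounded _ _ _ _ _ M) => //.
  apply: continuous_measurable_fun => x.
  by apply: continuous_comp; [exact: norm_continuous|exact: cf].
pose h x := 1 * cutoff c x; pose fh x := f x * cutoff c x.
pose tail x := M * 1 + (- M) * h x.
have ftail x : 0 <= x -> `|f x - fh x| <= tail x.
  move=> x0; have /andP[h0 h1] := cutoff01 c x0.
  rewrite (_ : f x - fh x = f x * (1 - cutoff c x)); last by rewrite /fh; ring.
  rewrite (_ : tail x = M * (1 - cutoff c x)); last by rewrite /tail /h; ring.
  by rewrite normrM (ger0_norm (_ : 0 <= 1 - cutoff c x)) ?subr_ge0// ler_wpM2r// subr_ge0.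
have Itail : I tail = M * (1 - I h).
  by rewrite (I_lin _ _ (A_int A_cst) (A_int A1)) I_cst; ring.
have Me : M * (e / (4 * M)) = e / 4 by field; rewrite gt_eqF.
have b1 : `|I f - I fh| <= e / 4.
  rewrite (IB iF (A_int Af)); apply: (@le_trans _ _ (I tail)).
    by apply: I_norm_le => //; [exact: iB (A_int Af)|exact/A_int/A_lin].
  by rewrite Itail -Me ler_wpM2l ?(ltW M0)// (le_trans (ler_norm _)).
near=> n; have n0 : (0 < n)%N by near: n; exact: nbhs_infty_gt.
have b2 : `|I fh - L n fh| <= e / 4 by near: n.
have b3 : `|L n fh - L n f| <= e / 2.
  rewrite distrC LB (le_trans (L_norm_le n ftail))// L_lin L_cst//.
  have k1 : `|I h - L n h| <= e / (4 * M) by near: n.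
  have k2 : 1 - L n h <= e / (4 * M) + e / (4 * M).
    rewrite (_ : 1 - L n h = (1 - I h) + (I h - L n h)); last by ring.
    by rewrite lerD// (le_trans (ler_norm _)).
  have := ler_wpM2l (ltW M0) k2; rewrite [in leRHS]mulrDr Me; set z := L n h; lra.
rewrite -/(L n f) (_ : I f - L n f = (I f - I fh) + (I fh - L n fh) + (L n fh - L n f)); last by ring.
rewrite (le_trans (ler_normD _ _))// (le_trans (lerD (ler_normD _ _) (lexx _)))//.
lra.
Unshelve. all: by end_near. Qed.

End resolvent_convergence.

(** * Measurability of linear statistics of the eigenvalues *)

Section measurable_statistics.
Context d (T : measurableType d) (R : realType) (n : nat) (s : T -> seq R).
Hypotheses (size_s : forall w, size (s w) = n)
  (s_ge0 : forall w x, x \in s w -> 0 <= x)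
  (mres : forall i j : nat,
    measurable_fun setT (fun w => \sum_(x <- s w) (x + i.+1%:R / j.+1%:R)^-1)).

Let A (f : R -> R) := measurable_fun setT (fun w => \sum_(x <- s w) f x).

Let A_cst : A (fun=> 1).
Proof.
rewrite /A (_ : (fun w => _) = cst (n%:R : R)); first exact: measurable_cst.
by apply/funext => w; rewrite big_const_seq count_predT size_s iter_addr_0.
Qed.

Let A_lin a f b g : A f -> A g -> A (fun x => a * f x + b * g x).
Proof.
move=> Af Ag; rewrite /A (_ : (fun w => _) =
  fun w => a * (\sum_(x <- s w) f x) + b * (\sum_(x <- s w) g x)).
  by apply: measurable_funD; apply: measurable_funM.
by apply/funext => w; rewrite big_split /= -!mulr_sumr.
Qed.

Let A_lim f : (forall e, 0 < e ->
     exists2 g, A g & forall x, 0 <= x -> `|f x - g x| <= e) -> A f.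
Proof.
move=> h.
have /choice[G hG] : forall k : nat, exists g, A g /\ forall x, 0 <= x -> `|f x - g x| <= k.+1%:R^-1.
  by move=> k; have [|g Ag gk] := h k.+1%:R^-1; [rewrite invr_gt0|exists g].
apply: (@measurable_fun_cvg _ _ _ _ (fun k w => \sum_(x <- s w) G k x)).
  by move=> k; have [] := hG k.
move=> w _; apply/cvgrPdist_le => e e0; near=> k.
rewrite -sumrB (le_trans (ler_norm_sum _ _ _))//.
apply: (@le_trans _ _ (\sum_(x <- s w) k.+1%:R^-1)).
  rewrite big_seq [leRHS]big_seq; apply: ler_sum => x /s_ge0 x0.
  exact: (hG k).2.
rewrite big_const_seq count_predT size_s iter_addr_0 -[leLHS]mulr_natl.
rewrite ler_pdivrMr// -ler_pdivrMl//.
by near: k; exact: near_ger_nat.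
Unshelve. all: by end_near. Qed.

(** The list [s w] comes with no measurable choice of its members, so measurability is carried over
    from the resolvent sums by approximation. For fixed [w] the cutoffs converge because the list is
    finite. *)
Theorem measurable_statistic (f : R -> R) : continuous f -> bounded_fun f ->
  measurable_fun setT (fun w => \sum_(x <- s w) f x).
Proof.
move=> cf [B [_ hB]]; pose M := `|B| + 1.
have fM x : `|f x| <= M by apply: hB => //; rewrite /M (le_lt_trans (ler_norm _))// ltrDl.
apply: (@measurable_fun_cvg _ _ _ _
    (fun c w => \sum_(x <- s w) f x * (c.+1%:R / (x + c.+1%:R)))).
  by move=> c; exact: (resolvent_class_cutoff A_cst A_lin A_lim mres c cf fM).
move=> w _; apply/cvgrPdist_le => e e0; near=> c.
rewrite -sumrB (le_trans (ler_norm_sum _ _ _))//.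
apply: (@le_trans _ _ (\sum_(x <- s w) M / c.+1%:R * x)).
  rewrite big_seq [leRHS]big_seq; apply: ler_sum => x /s_ge0 x0.
  have xc : 0 < x + c.+1%:R by rewrite ltr_wpDl.
  rewrite (_ : f x - _ = f x * (x / (x + c.+1%:R))); last first.
    have xc0 : x + c.+1%:R != 0 by rewrite gt_eqF.
    by rewrite -{1}[f x]mulr1 -mulrBr -{1}(divff xc0) -mulrBl addrK.
  rewrite normrM -mulrA (ger0_norm (_ : 0 <= x / _)) ?divr_ge0 ?(ltW xc)//.
  apply: ler_pM => //; first by rewrite divr_ge0 ?(ltW xc).
  by rewrite mulrC ler_wpM2r// lef_pV2 ?posrE// lerDr.
rewrite -mulr_sumr mulrAC ler_pdivrMr// -ler_pdivrMl//.
by near: c; exact: near_ger_nat.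
Unshelve. all: by end_near. Qed.

End measurable_statistics.

(** * The Stieltjes transform of the Marchenko-Pastur law *)

Section semicircle_primitive.
Context (R : realType).

(** Strict monotonicity of [cos] on [0, pi] handles the endpoint, where [acos] is not
    differentiable; [e'] keeps the comparison inside that interval. *)
Lemma acos_cvg1 (u : nat -> R) : (forall k, -1 <= u k <= 1) ->
  u @ \oo --> (1 : R) -> acos (u k) @[k --> \oo] --> (0 : R).
Proof.
move=> u1 uk; apply/cvgrPdist_lt => e e0.
pose e' := Num.min e pi.
have e'0 : 0 < e' by rewrite lt_min e0 pi_gt0.
have e'p : e' <= pi by rewrite ge_min lexx orbT.
have c1 : cos e' < 1.
  by rewrite -cos0 ltr_cos// in_itv/= ?lexx ?pi_ge0 ?(ltW e'0).
near=> k; have /andP[uk1 uk2] := u1 k.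
rewrite sub0r normrN ger0_norm ?acos_ge0//.
suff : acos (u k) < e' by rewrite lt_min => /andP[].
have : cos e' < u k by near: k; exact: (cvgr_gt _ uk).
rewrite -{1}(@acosK _ (u k)) ?in_itv/= ?uk1// ltr_cos// in_itv/=.
  by rewrite acos_ge0 ?uk1// acos_lepi ?uk1.
by rewrite (ltW e'0).
Unshelve. all: by end_near. Qed.

Lemma acos_cvgN1 (u : nat -> R) : (forall k, -1 <= u k <= 1) ->
  u @ \oo --> (-1 : R) -> acos (u k) @[k --> \oo] --> (pi : R).
Proof.
move=> u1 uk; rewrite -[X in _ --> X]subr0.
rewrite (_ : (fun k => _) = fun k => pi - acos (- u k)); last first.
  by apply/funext => k; rewrite -acosN ?opprK// lerNl opprK lerNl andbC u1.
apply: cvgB; first exact: cvg_cst.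
apply: acos_cvg1; first by move=> k; rewrite lerNl opprK lerNl andbC u1.
by rewrite -[X in _ --> X]opprK; apply: cvgN.
Qed.

Context (a b : R).
Hypothesis ab : a < b.

Let r0 : 0 < b - a. Proof. by rewrite subr_gt0. Qed.

Definition root_prod x : R := Num.sqrt ((b - x) * (x - a)).

Let root_gt0 x : a < x < b -> 0 < root_prod x.
Proof. by move=> /andP[ax xb]; rewrite sqrtr_gt0 mulr_gt0// subr_gt0. Qed.

(* The two angles are twice the arctangents of k w, where w = sqrt ((x - a) / (b - x))
   and k = 1, resp. k = sqrt ((b + t) / (a + t)). *)
Definition angle0_cos x : R := (a + b - 2 * x) / (b - a).

Definition angle_cos t x : R :=
  - (a + b + 2 * t) / (b - a) + 2 * ((a + t) * (b + t)) / (b - a) * (x + t)^-1.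

Lemma angle0_cosP x : a < x < b -> -1 < angle0_cos x < 1.
Proof.
move=> /andP[ax xb]; rewrite /angle0_cos ltr_pdivlMr// ltr_pdivrMr//.
by apply/andP; split; lra.
Qed.

Lemma angle0_sin x : a < x < b ->
  Num.sqrt (1 - angle0_cos x ^+ 2) = 2 * root_prod x / (b - a).
Proof.
move=> xab; have rx := root_gt0 xab; have /andP[ax xb] := xab.
rewrite -[RHS]ger0_norm ?divr_ge0 ?mulr_ge0 ?(ltW rx) ?(ltW r0)// -sqrtr_sqr; congr Num.sqrt.
rewrite !exprMn sqr_sqrtr; last by rewrite mulr_ge0// subr_ge0 ltW.
by rewrite /angle0_cos; field; rewrite gt_eqF.
Qed.

Lemma is_derive_affine (c k x : R) : is_derive x 1 (fun x => c + k * x) k.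
Proof.
have h := is_deriveD (is_derive_cst c x (1 : R)) (is_deriveZ k (is_derive_id x (1 : R))).
rewrite (_ : (fun _ => _) = cst c + k *: (id : R -> R)); last by apply/funext => y.
by apply: (is_derive_eq h); rewrite add0r; exact: mulr1.
Qed.

Lemma is_derive_affineV (c k t x : R) : x + t != 0 ->
  is_derive x 1 (fun x => c + k * (x + t)^-1) (- k / (x + t) ^+ 2).
Proof.
move=> xt0.
have h : is_derive x (1 : R) (fun y : R => (y + t)^-1) (- (x + t) ^- 2 *: (1 : R)).
  apply: is_deriveV => //; rewrite (_ : (fun _ => _) = fun y => t + 1 * y).
    exact: is_derive_affine.
  by apply/funext => y; rewrite mul1r addrC.
have h2 := is_deriveD (is_derive_cst c x (1 : R)) (is_deriveZ k h).
rewrite (_ : (fun _ => _) = cst c + k *: (fun y : R => (y + t)^-1)); last by apply/funext => y.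
by apply: (is_derive_eq h2); rewrite add0r /GRing.scale /= mulr1 mulrN mulNr.
Qed.

Lemma is_derive_angle0 x : a < x < b ->
  is_derive x 1 (fun x => acos (angle0_cos x)) (root_prod x)^-1.
Proof.
move=> xab; have rx := root_gt0 xab.
have h : is_derive x 1 angle0_cos (- 2 / (b - a)).
  rewrite (_ : angle0_cos = fun x => (a + b) / (b - a) + (- 2 / (b - a)) * x).
    exact: is_derive_affine.
  by apply/funext => y; rewrite /angle0_cos; ring.
have := @is_derive1_comp _ (@acos R) angle0_cos x _ _ (is_derive1_acos (angle0_cosP xab)) h.
rewrite angle0_sin// => h2; apply: (is_derive_eq h2).
by field; rewrite !gt_eqF.
Qed.

Section angle.
Context (t x : R).
Hypotheses (at0 : 0 < a + t) (xab : a < x < b).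

Let bt0 : 0 < b + t. Proof. by rewrite (lt_trans at0)// ltrD2r. Qed.

Let xt0 : 0 < x + t.
Proof. by have /andP[ax _] := xab; rewrite (lt_trans at0)// ltrD2r. Qed.

Let xt1 : x + t != 0. Proof. by rewrite gt_eqF. Qed.

Let r1 : b - a != 0. Proof. by rewrite gt_eqF. Qed.

Lemma angle_cosP : -1 < angle_cos t x < 1.
Proof.
have /andP[ax xb] := xab.
have e1 : 1 - angle_cos t x = 2 * (b + t) * (x - a) / ((b - a) * (x + t)).
  by rewrite /angle_cos; field; rewrite xt1 r1.
have e2 : 1 + angle_cos t x = 2 * (a + t) * (b - x) / ((b - a) * (x + t)).
  by rewrite /angle_cos; field; rewrite xt1 r1.
have p1 : 0 < 1 - angle_cos t x by rewrite e1 divr_gt0 ?mulr_gt0// subr_gt0.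
have p2 : 0 < 1 + angle_cos t x by rewrite e2 divr_gt0 ?mulr_gt0// subr_gt0.
by apply/andP; split; lra.
Qed.

Lemma angle_sin : Num.sqrt (1 - angle_cos t x ^+ 2) =
  2 * Num.sqrt ((a + t) * (b + t)) * root_prod x / ((b - a) * (x + t)).
Proof.
have rx := root_gt0 xab; have /andP[ax xb] := xab.
rewrite -[RHS]ger0_norm; last first.
  by rewrite divr_ge0 ?mulr_ge0 ?sqrtr_ge0 ?(ltW r0) ?(ltW xt0).
rewrite -sqrtr_sqr; congr Num.sqrt.
rewrite expr_div_n !exprMn !sqr_sqrtr; last 2 first.
- by rewrite mulr_ge0// subr_ge0 ltW.
- exact: mulr_ge0 (ltW at0) (ltW bt0).
by rewrite /angle_cos; field; rewrite xt1 r1.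
Qed.

Lemma is_derive_angle :
  is_derive x 1 (fun x => acos (angle_cos t x))
    (Num.sqrt ((a + t) * (b + t)) / ((x + t) * root_prod x)).
Proof.
have rx := root_gt0 xab; have h := is_derive_affineV (- (a + b + 2 * t) / (b - a))
  (2 * ((a + t) * (b + t)) / (b - a)) xt1.
have := @is_derive1_comp _ (@acos R) (angle_cos t) x _ _ (is_derive1_acos angle_cosP) h.
rewrite angle_sin => h2; apply: (is_derive_eq h2).
have q0 : 0 < Num.sqrt ((a + t) * (b + t)) by rewrite sqrtr_gt0 mulr_gt0.
have q2 : (a + t) * (b + t) = Num.sqrt ((a + t) * (b + t)) ^+ 2.
  by rewrite sqr_sqrtr//; exact: mulr_ge0 (ltW at0) (ltW bt0).
rewrite {2}q2; move: q0; set q := Num.sqrt _ => q0.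
by field; rewrite xt1 r1 !gt_eqF.
Qed.

End angle.

Context (t : R).
Hypotheses (a0 : 0 <= a) (t0 : 0 < t).

(** The integrand is [1 / root_prod] times [(b - x) (x - a) / (x (x + t))], which equals [- 1 - (a b
    / t) / x + ((a + t) (b + t) / t) / (x + t)]. Each of the three terms integrates to a multiple of
    one of the angles. *)
Definition mp_primitive x : R :=
  - acos (angle0_cos x) - Num.sqrt (a * b) / t * acos (angle_cos 0 x)
  + Num.sqrt ((a + t) * (b + t)) / t * acos (angle_cos t x).

Let b0 : 0 < b. Proof. exact: le_lt_trans ab. Qed.

Lemma is_derive_mp_primitive x : a < x < b ->
  is_derive x 1 mp_primitive (root_prod x / (x * (x + t))).
Proof.
move=> xab; have rx := root_gt0 xab; have /andP[ax xb] := xab.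
have x0 : 0 < x by exact: le_lt_trans ax.
have xt : 0 < x + t by rewrite addr_gt0.
have d0 := is_derive_angle0 xab.
have d1 : is_derive x 1 (fun x => Num.sqrt (a * b) / t * acos (angle_cos 0 x))
    (a * b / t / (x * root_prod x)).
  (* The second angle degenerates when [a = 0], but its coefficient [Num.sqrt (a * b)] vanishes
     then. *)
  have [a1|a1] := eqVneq a 0.
    rewrite a1 !mul0r sqrtr0 !mul0r (_ : (fun _ => _) = cst 0); first exact: is_derive_cst.
    by apply/funext => y; rewrite mul0r.
  have a2 : 0 < a + 0 by rewrite addr0 lt_def a1.
  have := is_derive_angle a2 xab; rewrite !addr0 => h.
  apply: (is_derive_eq (is_deriveZ (Num.sqrt (a * b) / t) h)); rewrite /GRing.scale /= mulrA.
  by congr (_ / _); rewrite mulrAC -expr2 sqr_sqrtr// mulr_ge0// ltW.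
have at0 : 0 < a + t by rewrite ltr_wpDl.
have d2 : is_derive x 1 (fun x => Num.sqrt ((a + t) * (b + t)) / t * acos (angle_cos t x))
    ((a + t) * (b + t) / t / ((x + t) * root_prod x)).
  have h := is_derive_angle at0 xab.
  apply: (is_derive_eq (is_deriveZ (Num.sqrt ((a + t) * (b + t)) / t) h)).
  rewrite /GRing.scale /= mulrA; congr (_ / _).
  by rewrite mulrAC -expr2 sqr_sqrtr// mulr_ge0// ltW// addr_gt0.
apply: (is_derive_eq (is_deriveD (is_deriveB (is_deriveN d0) d1) d2)).
have q2 : (b - x) * (x - a) = root_prod x ^+ 2.
  by rewrite sqr_sqrtr// mulr_ge0// subr_ge0 ltW.
have e : a * b = (a + b) * x - x ^+ 2 - root_prod x ^+ 2 by rewrite -q2; ring.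
have e2 : (a + t) * (b + t) = a * b + (a + b) * t + t ^+ 2 by ring.
rewrite e2 e; field; rewrite !gt_eqF//.
Qed.

Lemma angle_cos_cvg (s l : R) (u : nat -> R) : 0 < l + s ->
  u @ \oo --> l -> angle_cos s (u k) @[k --> \oo] --> angle_cos s l.
Proof.
move=> ls ul; apply: cvgD; first exact: cvg_cst.
apply: cvgM; first exact: cvg_cst.
by apply: cvgV; [rewrite gt_eqF|apply: cvgD => //; exact: cvg_cst].
Qed.

Lemma angle0_cos_cvg (l : R) (u : nat -> R) :
  u @ \oo --> l -> angle0_cos (u k) @[k --> \oo] --> angle0_cos l.
Proof.
move=> ul; apply: cvgM; last exact: cvg_cst.
by apply: cvgB; [exact: cvg_cst|apply: cvgM => //; exact: cvg_cst].
Qed.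

(** All the cosines coincide at an endpoint, so all the angles have the same limit [v] there: 0 at
    [a] and pi at [b]. *)
Lemma mp_primitive_cvg (l v : R) (u : nat -> R) :
  (forall w : nat -> R, (forall k, -1 <= w k <= 1) ->
    w @ \oo --> angle0_cos l -> acos (w k) @[k --> \oo] --> v) ->
  (forall s, 0 < a + s -> angle_cos s l = angle0_cos l) -> a <= l ->
  (forall k, a < u k < b) -> u @ \oo --> l ->
  mp_primitive (u k) @[k --> \oo] -->
    - v - Num.sqrt (a * b) / t * v + Num.sqrt ((a + t) * (b + t)) / t * v.
Proof.
move=> acosv ls al uab ul.
have lim s : 0 < a + s -> acos (angle_cos s (u k)) @[k --> \oo] --> v.
  move=> as0; apply: acosv.
    by move=> k; have /andP[h1 h2] := angle_cosP as0 (uab k); rewrite !ltW.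
  by rewrite -(ls s)//; apply: angle_cos_cvg => //; rewrite (lt_le_trans as0)// lerD2r.
apply: cvgD; last by apply: cvgM; [exact: cvg_cst|apply: lim; rewrite ltr_wpDl].
apply: cvgB.
  apply: cvgN; apply: acosv; last exact: angle0_cos_cvg.
  by move=> k; have /andP[h1 h2] := angle0_cosP (uab k); rewrite !ltW.
have [a1|a1] := eqVneq a 0.
  rewrite a1 !mul0r sqrtr0 !mul0r (_ : (fun _ => _) = cst 0); first exact: cvg_cst.
  by apply/funext => k; rewrite mul0r.
by apply: cvgM; [exact: cvg_cst|apply: lim; rewrite addr0 lt_def a1].
Qed.

Let xpos x : a < x < b -> 0 < x /\ 0 < x + t.
Proof.
move=> /andP[ax _]; have x0 : 0 < x by exact: le_lt_trans ax.
by split => //; exact: addr_gt0.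
Qed.

Lemma continuous_root_prod_quotient x : a < x < b ->
  {for x, continuous (fun x => root_prod x / (x * (x + t)))}.
Proof.
move=> /xpos[x0 xt0]; apply: cvgM.
  apply: (@continuous_comp _ _ _ (fun x => (b - x) * (x - a)) Num.sqrt); last exact: sqrt_continuous.
  by apply: cvgM; apply: cvgB => //; exact: cvg_cst.
apply: cvgV; first by rewrite mulf_neq0// gt_eqF.
by apply: cvgM => //; apply: cvgD => //; exact: cvg_cst.
Qed.

Lemma integral_root_prod :
  (\int[lebesgue_measure]_(x in `]a, b[) (root_prod x / (x * (x + t)))%:E =
   (pi * (Num.sqrt ((a + t) * (b + t)) - Num.sqrt (a * b) - t) / t)%:E)%E.
Proof.
(* The fundamental theorem is applied on [[u k, v k]], away from the endpoints, followed by monotone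
   convergence. The shift [k.+3] makes the margin less than half the length, so that [u k < v k] for
   every [k]. *)
have rk (k : nat) : 0 < (b - a) / k.+3%:R < (b - a) / 2.
  rewrite divr_gt0//= ltr_pM2l// ltf_pV2 ?posrE//.
  by rewrite ltr_nat.
have rcvg : (b - a) / k.+3%:R @[k --> \oo] --> (0 : R).
  apply/cvgrPdist_le => e e0; near=> k.
  rewrite sub0r normrN ger0_norm ?divr_ge0 ?(ltW r0)//.
  rewrite ler_pdivrMr// -ler_pdivrMl// (@le_trans _ _ k.+1%:R)//.
    by rewrite mulrC; near: k; exact: near_ger_nat.
  by rewrite ler_nat (leq_trans (leqnSn _)).
pose u (k : nat) := a + (b - a) / k.+3%:R; pose v (k : nat) := b - (b - a) / k.+3%:R.
have uab k : a < u k < b.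
  have := rk k; rewrite /u; move: (_ / k.+3%:R) => z /andP[h1 h2].
  by apply/andP; split; lra.
have vab k : a < v k < b.
  have := rk k; rewrite /v; move: (_ / k.+3%:R) => z /andP[h1 h2].
  by apply/andP; split; lra.
have uv k : u k < v k.
  by have := rk k; rewrite /u /v; move: (_ / k.+3%:R) => z /andP[h1 h2]; lra.
have ua : u @ \oo --> a.
  by rewrite -[X in _ --> X]addr0; apply: cvgD => //; exact: cvg_cst.
have vb : v @ \oo --> b.
  by rewrite -[X in _ --> X]subr0; apply: cvgB => //; exact: cvg_cst.
have Fu : (mp_primitive (u k)) @[k --> \oo] --> (0 : R).
  have := @mp_primitive_cvg a 0 u; rewrite !mulr0 oppr0 !addr0; apply => //.
  - move=> w w1 wl; apply: acos_cvg1 => //.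
    by rewrite (_ : 1 = angle0_cos a)// /angle0_cos; field; rewrite gt_eqF.
  - move=> s s0; rewrite /angle0_cos /angle_cos; field.
    by rewrite !gt_eqF.
have Fv : (mp_primitive (v k)) @[k --> \oo] -->
    - pi - Num.sqrt (a * b) / t * pi + Num.sqrt ((a + t) * (b + t)) / t * pi.
  apply: (@mp_primitive_cvg b) => //; last exact: ltW.
  - move=> w w1 wl; apply: acos_cvgN1 => //.
    by rewrite (_ : -1 = angle0_cos b)// /angle0_cos; field; rewrite gt_eqF.
  - move=> s s0; rewrite /angle0_cos /angle_cos; field.
    by rewrite !gt_eqF// (lt_trans s0)// ltrD2r.
pose G (x : R) := root_prod x / (x * (x + t)).
have cG x : a < x < b -> {for x, continuous G} by exact: continuous_root_prod_quotient.
have cF x : a < x < b -> {for x, continuous mp_primitive}.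
  move=> /is_derive_mp_primitive xab; apply: differentiable_continuous.
  by apply/derivable1_diffP; exact: ex_derive.
have ftc k : (\int[lebesgue_measure]_(x in `[u k, v k]) (G x)%:E =
    (mp_primitive (v k))%:E - (mp_primitive (u k))%:E)%E.
  have /andP[au ub] := uab k; have /andP[av bv] := vab k.
  apply: continuous_FTC2 => //.
  - apply: continuous_in_subspaceT => x; rewrite inE /= in_itv /= => /andP[h1 h2].
    by apply: cG; rewrite (lt_le_trans au)// (le_lt_trans h2).
  - split.
    + move=> x; rewrite in_itv /= => /andP[h1 h2].
      have xab : a < x < b by rewrite (lt_trans au)// (lt_trans h2).
      by case: (is_derive_mp_primitive xab).
    + by apply: cvg_at_right_filter; apply: cF.
    + by apply: cvg_at_left_filter; apply: cF.
  - move=> x; rewrite in_itv /= => /andP[h1 h2].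
    have xab : a < x < b by rewrite (lt_trans au)// (lt_trans h2).
    by rewrite derive1E; case: (is_derive_mp_primitive xab).
have UE : \bigcup_k `[u k, v k]%classic = `]a, b[%classic.
  apply/seteqP; split => x.
    move=> [k _]; rewrite /= !in_itv /= => /andP[h1 h2].
    by have /andP[au _] := uab k; have /andP[_ bv] := vab k; rewrite (lt_le_trans au)// (le_lt_trans h2).
  rewrite /= in_itv /= => /andP[ax xb].
  have e0 : 0 < Num.min (x - a) (b - x) by rewrite lt_min !subr_gt0 ax.
  have /cvgrPdist_le/(_ _ e0)[k _ hk] := rcvg.
  have := hk k (leqnn k); rewrite sub0r normrN le_min => /andP[].
  have /andP[h0 _] := rk k; rewrite ger0_norm ?(ltW h0)// => h1 h2.
  exists k => //=; rewrite in_itv /= /u /v; move: (_ / k.+3%:R) h1 h2 => z h1 h2.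
  by apply/andP; split; lra.
have lim1 : (\int[lebesgue_measure]_(x in `[u k, v k]) (G x)%:E @[k --> \oo] -->
    \int[lebesgue_measure]_(x in `]a, b[) (G x)%:E)%E.
  rewrite -UE; apply: ge0_nondecreasing_set_cvg_integral => //.
  - move=> m n mn; apply/subsetPset => x; rewrite /= !in_itv /= => /andP[h1 h2].
    have h3 : (b - a) / n.+3%:R <= (b - a) / m.+3%:R.
      by rewrite ler_wpM2l ?(ltW r0)// lef_pV2 ?posrE// ler_nat.
    move: h1 h2 h3; rewrite /u /v; move: (_ / m.+3%:R) (_ / n.+3%:R) => z z' h1 h2 h3.
    by apply/andP; split; lra.
  - move=> k; apply/measurable_EFinP; apply: subspace_continuous_measurable_fun => //.
    apply: continuous_in_subspaceT => x; rewrite inE /= in_itv /= => /andP[h1 h2].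
    have /andP[au _] := uab k; have /andP[_ bv] := vab k.
    by apply: cG; rewrite (lt_le_trans au)// (le_lt_trans h2).
  - move=> k x; rewrite /= in_itv /= => /andP[h1 h2].
    have /andP[au _] := uab k; have /andP[_ bv] := vab k.
    have xab : a < x < b by rewrite (lt_le_trans au)// (le_lt_trans h2).
    have [x0 xt] := xpos xab.
    by rewrite lee_fin divr_ge0 ?mulr_ge0 ?sqrtr_ge0// ltW.
apply: (cvg_unique _ lim1) => //.
rewrite /= (_ : (fun k => _) = fun k => (mp_primitive (v k) - mp_primitive (u k))%:E); last first.
  by apply/funext => k; rewrite ftc.
apply: cvg_EFin; first exact: nearW.
rewrite (_ : pi * _ / t = - pi - Num.sqrt (a * b) / t * pi + Num.sqrt ((a + t) * (b + t)) / t * pi - 0).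
  exact: cvgB.
by field; rewrite gt_eqF.
Unshelve. all: by end_near. Qed.

End semicircle_primitive.

(** * Integration against a measure with density *)

Section density.
Context d (T : measurableType d) (R : realType).
Context (mu nu : {measure set T -> \bar R}) (h : T -> R).
Hypotheses (mh : measurable_fun setT h) (h0 : forall x, 0 <= h x)
  (nuE : forall A, measurable A -> nu A = (\int[mu]_(x in A) (h x)%:E)%E).
Local Open Scope ereal_scope.
Import HBNNSimple.

Let integral_density_indic (E : set T) : measurable E ->
  \int[nu]_x (\1_E x)%:E = \int[mu]_x ((\1_E x)%:E * (h x)%:E).
Proof.
move=> mE; rewrite integral_indic// setIT nuE// integral_mkcond.
apply: eq_integral => x _; rewrite patchE indicE.
by case: (x \in E); rewrite ?mul1e ?mul0e.
Qed.

Let integral_density_nnsfun (f : {nnsfun T >-> R}) :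
  \int[nu]_x (f x)%:E = \int[mu]_x ((f x)%:E * (h x)%:E).
Proof.
under eq_integral do rewrite fimfunE -fsumEFin//.
rewrite ge0_integral_fsum//; last 2 first.
  - by move=> r; exact/measurable_EFinP/measurableT_comp.
  - by move=> n x _; rewrite EFinM nnfun_muleindic_ge0.
transitivity (\int[mu]_x (\sum_(r \in range f) (r * \1_(f @^-1` [set r]) x)%:E * (h x)%:E)).
  rewrite ge0_integral_fsum//; last 2 first.
    - by move=> r; apply: emeasurable_funM; apply/measurable_EFinP => //; exact/measurableT_comp.
    - by move=> r x _; apply: mule_ge0; [rewrite EFinM nnfun_muleindic_ge0|rewrite lee_fin].
  apply: eq_fsbigr => r _; rewrite integralZl_indic_nnsfun//.
  have [r0|r0] := leP 0%R r.
    under [RHS]eq_integral do rewrite EFinM -muleA.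
    rewrite ge0_integralZl//; last 2 first.
      - by apply: emeasurable_funM; apply/measurable_EFinP => //; exact/measurableT_comp.
      - by move=> x _; rewrite mule_ge0// lee_fin.
    by rewrite -integral_density_indic// integral_indic// setIT.
  by rewrite preimage_nnfun0// !integral0_eq ?mule0// => x _; rewrite indic0 ?mulr0 ?mul0e.
apply: eq_integral => x _; rewrite [in RHS]fimfunE -fsumEFin// ge0_mule_fsuml//.
by move=> r; rewrite EFinM nnfun_muleindic_ge0.
Qed.

Lemma integral_density (f : T -> \bar R) : measurable_fun setT f ->
  (forall x, 0 <= f x) -> \int[nu]_x f x = \int[mu]_x (f x * (h x)%:E).
Proof.
move=> mf f0; pose f_ := nnsfun_approx measurableT mf.
transitivity (lim (\int[nu]_x (f_ n x)%:E @[n --> \oo])).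
  rewrite -monotone_convergence//=.
  - apply: eq_integral => x _; apply/esym/cvg_lim => //=.
    exact: cvg_nnsfun_approx.
  - by move=> n; exact/measurable_EFinP/measurable_funTS.
  - by move=> n ? _; rewrite lee_fin.
  - by move=> ? _ ? ? mn; rewrite lee_fin; exact/lefP/nd_nnsfun_approx.
transitivity (lim (\int[mu]_x ((f_ n x)%:E * (h x)%:E) @[n --> \oo])).
  by apply: congr_lim; apply/funext => n; rewrite integral_density_nnsfun.
rewrite -monotone_convergence//=.
- apply: eq_integral => x _; apply/cvg_lim => //=.
  apply: cvgeMr => //; exact: cvg_nnsfun_approx.
- move=> n; apply: emeasurable_funM; exact/measurable_EFinP.
- by move=> n x _; rewrite mule_ge0// lee_fin.
- move=> x _ m n mn; rewrite lee_wpmul2r ?lee_fin//; exact/lefP/nd_nnsfun_approx.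
Qed.

End density.

(** * Transform and total mass of the Marchenko-Pastur law *)

Section marchenko_pastur_stieltjes.
Context (R : realType) (g : R).
Hypothesis g0 : 0 < g.
Local Notation a := (mp_left g).
Local Notation b := (mp_right g).

Let s0 : 0 < Num.sqrt g. Proof. by rewrite sqrtr_gt0. Qed.

Let s2 : Num.sqrt g ^+ 2 = g. Proof. by rewrite sqr_sqrtr// ltW. Qed.

Let a0 : 0 <= a. Proof. exact: sqr_ge0. Qed.

Let ab : a < b.
Proof. by rewrite /mp_left /mp_right -subr_gt0 (_ : _ - _ = 4 * Num.sqrt g) ?mulr_gt0//; ring. Qed.

Let abE : a * b = (1 - g) ^+ 2.
Proof. by rewrite -[in RHS]s2 /mp_left /mp_right; ring. Qed.

Let abD : a + b = 2 + 2 * g.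
Proof. by rewrite -[in RHS]s2 /mp_left /mp_right; ring. Qed.

(** Both the square root of [(a + t) (b + t)], with [a] and [b] the edges of the support, and that
    of the discriminant of the equation in [mp_root_quadratic]. *)
Definition mp_root t : R := Num.sqrt ((t + 1 - g) ^+ 2 + 4 * g * t).

Lemma integral_mp_ac (t : R) : 0 < t ->
  (\int[lebesgue_measure]_x (((`|x| + t)^-1)%:E * (mp_pdf g x)%:E) =
   ((mp_root t - `|1 - g| - t) / (2 * g * t))%:E)%E.
Proof.
move=> t0; transitivity (((2 * pi * g)^-1)%:E *
    \int[lebesgue_measure]_(x in `]a, b[) (root_prod a b x / (x * (x + t)))%:E)%E.
  rewrite -ge0_integralZl//; last 3 first.
  - apply/measurable_EFinP; apply: open_continuous_measurable_fun; first exact: interval_open.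
    by move=> x; rewrite inE /= in_itv /=; exact: continuous_root_prod_quotient.
  - move=> x; rewrite /= in_itv /= => /andP[ax xb]; have x0 : 0 < x by exact: le_lt_trans ax.
    by rewrite lee_fin divr_ge0 ?sqrtr_ge0// mulr_ge0 ?addr_ge0// ltW.
  - by rewrite lee_fin invr_ge0 !mulr_ge0 ?pi_ge0// ltW.
  rewrite [RHS]integral_mkcond; apply: eq_integral => x _; rewrite patchE.
  case: ifPn; rewrite ?inE ?notin_setE /= in_itv /=.
    move=> /andP[ax xb]; have x0 : 0 < x by exact: le_lt_trans ax.
    rewrite -!EFinM; congr EFin; rewrite /mp_pdf indicE mem_set; last first.
      by rewrite /= in_itv /= !ltW.
    rewrite ger0_norm ?ltW// mulr1 /root_prod.
    move: (pi : R) (pi_gt0 R) => q q0.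
    by field; rewrite (gt_eqF (addr_gt0 x0 t0)) !gt_eqF.
  move=> nx; rewrite -EFinM; congr EFin; rewrite /mp_pdf indicE.
  have [|_] := boolP (x \in `[a, b]%classic); last by rewrite !mulr0.
  rewrite inE /= in_itv /= => /andP[ax xb].
  move/negP: nx; rewrite !lt_neqAle ax xb !andbT negb_and !negbK => /orP[] /eqP ->.
    by rewrite subrr mulr0 sqrtr0 !mul0r mulr0.
  by rewrite subrr mul0r sqrtr0 !mul0r mulr0.
rewrite integral_root_prod// -EFinM; congr EFin.
rewrite abE sqrtr_sqr (_ : (a + t) * (b + t) = (t + 1 - g) ^+ 2 + 4 * g * t); last first.
  transitivity (a * b + (a + b) * t + t ^+ 2); first by ring.
  by rewrite abE abD; ring.
by rewrite -/(mp_root t); move: (pi : R) (pi_gt0 R) => q q0; field; rewrite !gt_eqF.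
Qed.

Let measurable_inv_norm (t : R) : 0 < t ->
  measurable_fun [set: R] (fun x : R => ((`|x| + t)^-1)%:E).
Proof.
move=> t0; apply/measurable_EFinP; apply: continuous_measurable_fun => x; apply: cvgV.
  by rewrite gt_eqF// ltr_wpDl.
by apply: cvgD; [exact: norm_continuous|exact: cvg_cst].
Qed.

Let inv_norm_ge0 (t : R) (x : R) : 0 < t -> (0 <= ((`|x| + t)^-1)%:E)%E.
Proof. by move=> t0; rewrite lee_fin invr_ge0 addr_ge0// ltW. Qed.

(** For [g > 1] the atom adds [(1 - 1 / g) / t], which turns the term [- |1 - g| = 1 - g] into
    [g - 1], so one formula covers all shapes. *)
Lemma integral_marchenko_pastur_inv (t : R) : 0 < t ->
  (\int[marchenko_pastur g]_x ((`|x| + t)^-1)%:E =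
   ((mp_root t - (t + 1 - g)) / (2 * g * t))%:E)%E.
Proof.
move=> t0; have mf := measurable_inv_norm t0; have f0 x := inv_norm_ge0 x t0.
have iac : (\int[mp_ac g]_x ((`|x| + t)^-1)%:E =
    ((mp_root t - `|1 - g| - t) / (2 * g * t))%:E)%E.
  rewrite -integral_mp_ac//.
  (* [lebesgue_measure] lives on [measurableTypeR R] and [mp_ac g] on [R], the same
     measurable space with a different display. *)
  have mid : measurable_fun setT (id : R -> measurableTypeR R) by [].
  pose nu : {measure set R -> \bar R} := mp_ac g.
  have h := @integral_density _ _ R lebesgue_measure (pushforward nu (id : R -> measurableTypeR R))
    (mp_pdf g) (measurable_mp_pdf g) (mp_pdf_ge0 g) (fun _ _ => erefl) _ mf f0.
  by rewrite -h ge0_integral_pushforward.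
have [g1|g1] := leP g 1.
  rewrite (eq_measure_integral (mp_ac g)); last first.
    by move=> A mA _; rewrite /= /marchenko_pastur g1.
  by rewrite iac ger0_norm ?subr_ge0//; congr (_ / _)%:E; ring.
have c0 : 0 <= 1 - g^-1 by rewrite subr_ge0 invf_le1 ?ltW.
rewrite (eq_measure_integral (measure_add (mscale (NngNum c0) (\d_(0 : R))) (mp_ac g))); last first.
  by move=> A mA _; rewrite /= /marchenko_pastur leNgt g1; symmetry; exact: measure_addE.
rewrite ge0_integral_measure_add// ge0_integral_mscale// integral_dirac// diracT mul1e iac.
rewrite normr0 add0r -EFinM -EFinD ltr0_norm ?subr_lt0//; congr EFin => /=.
by field; rewrite !gt_eqF.
Qed.

Lemma marchenko_pastur_neg : marchenko_pastur g `]-oo, 0[%classic = 0%E.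
Proof.
have ac0 : mp_ac g `]-oo, 0[%classic = 0%E.
  apply: integral0_eq => x; rewrite /= in_itv /= => x0; congr EFin.
  rewrite /mp_pdf indicE memNset ?mulr0//= in_itv /= => /andP[ax _].
  by have := le_lt_trans ax x0; rewrite ltNge a0.
rewrite /marchenko_pastur ac0 diracE memNset ?mule0 ?adde0; first by case: ifP.
by rewrite /= in_itv /= ltxx.
Qed.

Lemma mp_root_quadratic (t : R) : 0 < t ->
  let s := (mp_root t - (t + 1 - g)) / (2 * g * t) in
  0 <= s /\ g * t * s ^+ 2 + (t + 1 - g) * s = 1.
Proof.
move=> t0 s; have gt0 : 0 < 4 * g * t by rewrite !mulr_gt0.
have S2 : mp_root t ^+ 2 = (t + 1 - g) ^+ 2 + 4 * g * t.
  by rewrite sqr_sqrtr// addr_ge0 ?sqr_ge0// ltW.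
split.
  rewrite /s divr_ge0 ?mulr_ge0 ?(ltW t0) ?(ltW g0)// subr_ge0.
  rewrite (le_trans (ler_norm _))// -sqrtr_sqr ler_sqrt ?lerDl ?ltW//.
  by rewrite ltr_wpDl// sqr_ge0.
transitivity ((mp_root t ^+ 2 - (t + 1 - g) ^+ 2) / (4 * g * t)).
  by rewrite /s; field; rewrite !gt_eqF.
by rewrite S2; field; rewrite !gt_eqF.
Qed.

(** By monotone convergence the mass is the limit of [t] times the transform as [t] tends to
    infinity; the value 1 is read off the quadratic equation. *)
Lemma marchenko_pastur_setT : marchenko_pastur g [set: R] = 1%E.
Proof.
pose s t := (mp_root t - (t + 1 - g)) / (2 * g * t).
have ints (k : nat) : (\int[marchenko_pastur g]_x (k.+1%:R / (`|x| + k.+1%:R))%:E =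
    (k.+1%:R * s k.+1%:R)%:E)%E.
  under eq_integral do rewrite EFinM.
  rewrite ge0_integralZl//; last exact: measurable_inv_norm.
  by rewrite integral_marchenko_pastur_inv.
have lim1 : (\int[marchenko_pastur g]_x (k.+1%:R / (`|x| + k.+1%:R))%:E @[k --> \oo] -->
    \int[marchenko_pastur g]_x (1%:E : \bar R))%E.
  have xk (x : R) (k : nat) : 0 < `|x| + k.+1%:R by rewrite ltr_wpDl.
  rewrite (eq_integral (fun x : R => limn (fun k => (k.+1%:R / (`|x| + k.+1%:R))%:E)))%E.
    apply: cvg_monotone_convergence => //.
    - by move=> k; apply/measurable_EFinP; apply: measurable_funM => //; apply/measurable_EFinP; exact: measurable_inv_norm.
    - move=> x _ m n mn; rewrite lee_fin ler_pdivrMr// mulrAC ler_pdivlMr// !mulrDr.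
      rewrite [X in _ <= _ + X]mulrC lerD2r ler_wpM2r// ler_nat ltnS//.
  move=> x _; apply/esym/cvg_lim => //; apply: cvg_EFin; first exact: nearW.
  apply/cvgrPdist_le => e e0; near=> k; rewrite /=.
  rewrite (_ : 1 - _ = `|x| / (`|x| + k.+1%:R)); last by field; rewrite gt_eqF.
  rewrite ger0_norm ?divr_ge0 ?(ltW (xk _ _))// ler_pdivrMr// -ler_pdivrMl//.
  rewrite (@le_trans _ _ k.+1%:R)// ?lerDr// mulrC.
  by near: k; exact: near_ger_nat.
have lim2 : (k.+1%:R * s k.+1%:R)%:E @[k --> \oo] --> (1%:E : \bar R).
  apply: cvg_EFin; first exact: nearW.
  apply/cvgrPdist_le => e e0; near=> k; rewrite /=.
  have t0 : 0 < k.+1%:R :> R by [].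
  have [] := mp_root_quadratic t0; rewrite -/(s _).
  have k1 : `|1 - g| * 2 <= k.+1%:R by near: k; exact: near_ger_nat.
  have k2 : (`|1 - g| * 2 + g * 4) / e <= k.+1%:R by near: k; exact: near_ger_nat.
  move: (k.+1%:R) (s _) t0 k1 k2 => t u t0 k1 k2 u0 hu.
  have : `|1 - g| * (t * u) + g * (t * u) ^+ 2 <= e * t.
    (* Since [t / 2 <= t + 1 - g], the quadratic equation gives [t u <= 2]. Then
       [(1 - t u) t = (1 - g) (t u) + g (t u)^2] is at most [2 |1 - g| + 4 g] in size, whence the
       constants in [k2]. *)
    have tu : t * u <= 2.
      have : (t / 2) * u <= (t + 1 - g) * u.
        by rewrite ler_wpM2r//; have := ler_norm (g - 1); rewrite distrC; lra.
      have : 0 <= g * t * u ^+ 2 by rewrite !mulr_ge0 ?sqr_ge0 ?(ltW g0) ?(ltW t0).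
      lra.
    have tu0 : 0 <= t * u by rewrite mulr_ge0// ltW.
    have tu2 : (t * u) ^+ 2 <= 2 ^+ 2 by rewrite ler_pXn2r ?nnegrE.
    have h1 := ler_wpM2l (normr_ge0 (1 - g)) tu.
    have h2 := ler_wpM2l (ltW g0) tu2.
    by move: k2; rewrite ler_pdivrMr// [t * e]mulrC; lra.
  rewrite -ler_pdivrMr// => /(le_trans _); apply.
  rewrite ler_pdivlMr// -{2}(ger0_norm (ltW t0)) -normrM.
  rewrite (_ : (1 - t * u) * t = (1 - g) * (t * u) + g * (t * u) ^+ 2).
    rewrite (le_trans (ler_normD _ _))// normrM (ger0_norm (_ : 0 <= t * u)) ?mulr_ge0 ?(ltW t0)//.
    by rewrite lerD2l ger0_norm// mulr_ge0 ?sqr_ge0// ltW.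
  by rewrite -{1}hu; ring.
rewrite integral_cst// mul1e in lim1.
apply: (cvg_unique _ lim1) => //.
by rewrite /= (_ : (fun k => _) = fun k => (k.+1%:R * s k.+1%:R)%:E) //; apply/funext.
Unshelve. all: by end_near. Qed.

End marchenko_pastur_stieltjes.

(** * Convergence of the Stieltjes transforms *)

Section hadamard_gram.
Context (R : realType) (n d p : nat) (x : 'M[R]_(n, d)) (y : 'M[R]_(n, p)).

Definition row_outer_mx : 'M[R]_(n, d * p) := \matrix_i row_outer x y i.

Lemma hadamard_gram :
  hadamard (x *m x^T) (y *m y^T) = row_outer_mx *m row_outer_mx^T.
Proof.
apply/matrixP => i k; rewrite !mxE (reindex _ (curry_mxvec_bij _ _)) /= big_distrl /=.
rewrite (eq_bigr (fun j => \sum_l x i j * y i l * (x k j * y k l))).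
  by rewrite pair_bigA /=; apply: eq_bigr => -[j l] _; rewrite !mxE !outerE !mxE.
by move=> j _; rewrite !mxE mulr_sumr; apply: eq_bigr => l _; rewrite !mxE; ring.
Qed.

Lemma scov_mx_gram :
  scov_mx x y = (d * p)%:R^-1 *: (row_outer_mx^T *m row_outer_mx).
Proof.
congr (_ *: _); apply/matrixP => a b; rewrite summxE !mxE.
by apply: eq_bigr => i _; rewrite !mxE big_ord1 !mxE.
Qed.

Lemma scale_hadamard_gram (sx sy : R) :
  (sx ^+ 2 * sy ^+ 2)^-1 *: hadamard (d%:R^-1 *: (x *m x^T)) (p%:R^-1 *: (y *m y^T)) =
  (d * p)%:R^-1 *: hadamard ((sx^-1 *: x) *m (sx^-1 *: x)^T) ((sy^-1 *: y) *m (sy^-1 *: y)^T).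
Proof.
apply/matrixP => i k; rewrite natrM ![(_ *: _)^T]linearZ /= -!scalemxAl -!scalemxAr !mxE.
by move: (\sum_j _) (\sum_j _) => u v; rewrite !expr2 !invfM; ring.
Qed.

End hadamard_gram.

Section normalized_product.
Context (R : realType) (n d p : nat) (x : 'M[R]_(n, d)) (y : 'M[R]_(n, p)) (sx sy : R).

Definition normalized_product : 'M[R]_n := (sx ^+ 2 * sy ^+ 2)^-1 *:
  hadamard (d%:R^-1 *: (x *m x^T)) (p%:R^-1 *: (y *m y^T)).

Let normalized_productE : normalized_product = (d * p)%:R^-1 *:
  (row_outer_mx (sx^-1 *: x) (sy^-1 *: y) *m (row_outer_mx (sx^-1 *: x) (sy^-1 *: y))^T).
Proof. by rewrite /normalized_product scale_hadamard_gram hadamard_gram. Qed.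

Lemma psd_normalized_product : psd normalized_product.
Proof.
rewrite normalized_productE; apply: psdZ; first by rewrite invr_ge0.
by have := psd_gram (row_outer_mx (sx^-1 *: x) (sy^-1 *: y))^T; rewrite trmxK.
Qed.

Lemma normalized_product_stieltjes t : 0 < t -> (0 < d)%N -> (0 < p)%N ->
  \sum_(z <- eigenvalues normalized_product) (z + t)^-1 =
  (d * p)%:R * stieltjes_mx t (sx^-1 *: x) (sy^-1 *: y) + (n%:R - (d * p)%:R) / t.
Proof.
move=> t0 d0 p0; rewrite -trace_resolvent_eigenvalues//; last exact: psd_normalized_product.
rewrite normalized_productE trace_resolvent_gram ?invr_ge0// -scov_mx_gram; congr (_ + _).
by rewrite mulrC divfK// pnatr_eq0 -lt0n muln_gt0 d0.
Qed.

End normalized_product.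

(** * The limiting fixed-point equation *)

Section companion_equation.
Context (R : realType) (t g : R).
Hypotheses (t0 : 0 < t) (g0 : 0 <= g).

Let h c m : R := 1 - t * m - c * (m / (1 + m)).

(** The difference quotient of [h g] is [- (t + g / ((1 + m) (1 + m')))], at least [t] in size;
    uniqueness and stability come together. *)
Lemma companion_equation_stable m m' : 0 <= m -> 0 <= m' -> h g m' = 0 ->
  `|m - m'| <= `|h g m| / t.
Proof.
move=> m0 m'0 hm'; rewrite ler_pdivlMr// -[h g m]subr0 -hm'.
have m1 : 0 < 1 + m by rewrite ltr_wpDr.
have m'1 : 0 < 1 + m' by rewrite ltr_wpDr.
rewrite (_ : h g m - h g m' = - ((m - m') * (t + g / ((1 + m) * (1 + m'))))); last first.
  by rewrite /h; field; rewrite !gt_eqF.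
have q0 : 0 <= g / ((1 + m) * (1 + m')) by rewrite divr_ge0// mulr_ge0// ltW.
by rewrite normrN normrM ler_wpM2l// ger0_norm ?lerDl// addr_ge0// ltW.
Qed.

(** Replacing the coefficient [gn n] by [g] costs at most [|g - gn n|], because
    [m / (1 + m) <= 1]. *)
Lemma companion_equation_cvg (gn en mn : nat -> R) (m : R) : 0 <= m -> h g m = 0 ->
  (forall n, 0 <= mn n) -> gn @ \oo --> g -> en @ \oo --> (0 : R) ->
  (forall n, (0 < n)%N -> `|h (gn n) (mn n)| <= en n) -> mn @ \oo --> m.
Proof.
move=> m0 hm mn0 gng en0 hen.
have lim : (en n + `|g - gn n|) / t @[n --> \oo] --> (0 : R).
  rewrite -(mul0r t^-1); apply: cvgM; last exact: cvg_cst.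
  rewrite -(addr0 0); apply: cvgD => //; rewrite -(normr0 R); apply: cvg_norm.
  by rewrite -(subrr g); apply: cvgB => //; exact: cvg_cst.
apply/cvgrPdist_le => e e0; near=> n.
have n0 : (0 < n)%N by near: n; exact: nbhs_infty_gt.
rewrite distrC (le_trans (companion_equation_stable (mn0 n) m0 hm))//.
apply: (@le_trans _ _ ((en n + `|g - gn n|) / t)); last first.
  by near: n; exact: (cvgr_le 0 lim).
rewrite ler_pM2r ?invr_gt0//.
rewrite (_ : h g (mn n) = h (gn n) (mn n) - (g - gn n) * (mn n / (1 + mn n))); last by rewrite /h; ring.
rewrite (le_trans (ler_normB _ _))// lerD ?hen// normrM ler_piMr//.
have m1 : 0 < 1 + mn n by rewrite ltr_wpDr.
by rewrite ger0_norm ?divr_ge0 ?(ltW m1)// ler_pdivrMr// mul1r lerDr.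
Unshelve. all: by end_near. Qed.

(** If [s] is the limiting transform of the n x n matrix, [g s + (1 - g) / t] is that of its N x N
    companion, [g] being the limit of n / N. For [g > 1] nonnegativity follows from
    [(t m) (t m + t + g - 1) = t], whose second factor is positive. *)
Lemma companion_equation_root s : 0 <= s ->
  g * t * s ^+ 2 + (t + 1 - g) * s = 1 ->
  0 <= g * s + (1 - g) / t /\ h g (g * s + (1 - g) / t) = 0.
Proof.
move=> s0 hs; set m := _ + _ / _.
have tm : t * m = t * g * s + 1 - g by rewrite /m; field; rewrite gt_eqF.
have hs1 : s * (t * m + t) = 1 by rewrite -hs tm; ring.
have mt : 0 < t * m + t.
  by rewrite ltNge; apply/negP => /(ler_wpM2l s0); rewrite mulr0 hs1 ler10.
have hm : (t * m) * (t * m + t + g - 1) = t.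
  have h1 : g * s * (t * m + t) = g by rewrite -mulrA hs1 mulr1.
  have h2 : t * (g * s) * (t * m + t) = (t * m - 1 + g) * (t * m + t) by rewrite {2}tm; ring.
  move: h2; rewrite -(mulrA t) h1 => h2.
  transitivity ((t * m - 1 + g) * (t * m + t) + t * (1 - g)); first by ring.
  by rewrite -h2; ring.
have m0 : 0 <= m.
  have [g1|g1] := leP g 1.
    by apply: addr_ge0; [exact: mulr_ge0|rewrite divr_ge0 ?subr_ge0// ltW].
  have gm : 0 < t * m + t + g - 1 by rewrite -addrA addr_gt0// subr_gt0.
  by rewrite -(pmulr_rge0 _ t0) -(pmulr_lge0 _ gm) hm ltW.
split=> //; have m1 : 0 < 1 + m by rewrite ltr_wpDr.
apply/eqP; rewrite /h (_ : _ - _ = (t - (t * m) * (t * m + t + g - 1)) / (t * (1 + m))).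
  by rewrite hm subrr mul0r.
by field; rewrite !gt_eqF.
Qed.

End companion_equation.

(** * Chernoff bounds and the Borel-Cantelli lemma *)

Section almost_sure.
Context d0 (T : measurableType d0) (R : realType) (P : probability T R).

(** The events that [|Z k - c| > eps] for some [k >= n] decrease to a set on which convergence
    fails, and [P] is continuous from above. *)
Lemma ae_cvg_in_probability (Z : nat -> T -> R) (c : R) :
  (forall n, measurable_fun setT (Z n)) ->
  {ae P, forall w, Z n w @[n --> \oo] --> c} -> cvg_in_probability P Z c.
Proof.
move=> mZ aeZ eps eps0; pose F n := [set w | eps < `|Z n w - c|].
have mF n : measurable (F n).
  have mf : measurable_fun setT (fun w => `|Z n w - c|).
    by apply: measurableT_comp => //; apply: measurable_funB.
  rewrite (_ : F n = [set: T] `&` (fun w => `|Z n w - c|) @^-1` `]eps, +oo[%classic).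
    exact: mf.
  by apply/seteqP; split => w /=; rewrite in_itv /= andbT//; case.
have mU n : measurable (\bigcup_(k >= n) F k) by apply: bigcup_measurable.
have F0 : P (lim_sup_set F) = 0%E.
  have mL : measurable (lim_sup_set F) by apply: bigcapT_measurable.
  case: aeZ => N [mN N0 subN]; apply/eqP; rewrite eq_le measure_ge0 andbT -N0.
  apply: le_measure; rewrite ?inE//; apply: subset_trans subN => w Fw /= /cvgrPdist_le.
  move=> /(_ _ eps0)[k _ hk]; have [n kn] := Fw k I.
  by rewrite /F /= distrC ltNge hk.
have h : P (\bigcup_(k >= n) F k) @[n --> \oo] --> 0%E.
  by rewrite -F0; apply: lim_sup_set_cvg => //; rewrite (le_lt_trans (probability_le1 _ _))// ltry.
apply: (squeeze_cvge _ _ h); last exact: cvg_cst.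
apply: nearW => n; rewrite measure_ge0 /=; apply: le_measure; rewrite ?inE//.
  exact: mF.
by move=> w Fw; exists n => //=.
Qed.

Lemma chernoff_bound (Z : T -> R) (l e B : R) : measurable_fun setT Z -> 0 <= l ->
  (exists M, forall w, `|Z w| <= M) ->
  \int[P]_w expR (l * Z w) <= B -> (P [set w | (e <= Z w)%R] <= (B * expR (- (l * e)))%:E)%E.
Proof.
move=> mZ l0 [M ZM] hB.
have mE : measurable [set w | e <= Z w].
  rewrite (_ : [set _ | _] = [set: T] `&` Z @^-1` `[e, +oo[%classic); first exact: mZ.
  by apply/seteqP; split => w /=; rewrite in_itv /= andbT//; case.
have mexp : measurable_fun setT (fun w => expR (l * Z w)).
  by apply: measurableT_comp => //; apply: measurable_funM.
have iexp : P.-integrable [set: T] (fun w => (expR (l * Z w))%:E).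
  apply: (@integrable_bounded _ _ _ _ _ (expR (l * M))) => // w.
  rewrite ger0_norm ?expR_ge0// ler_expR ler_wpM2l//.
  by rewrite (le_trans (ler_norm _)).
rewrite expRN EFinM lee_pdivlMr ?expR_gt0//.
apply: (@le_trans _ _ (\int[P]_w (expR (l * Z w))%:E)%E); last first.
  by rewrite -[leLHS]fineK ?lee_fin// integrable_fin_num.
apply: (@le_trans _ _ (\int[P]_(w in [set w | (e <= Z w)%R]) (expR (l * Z w))%:E)%E); last first.
  by apply: ge0_subset_integral => //; exact/measurable_EFinP.
rewrite muleC -integral_cst//; apply: ge0_le_integral => //.
- by move=> w _; rewrite /= lee_fin expR_ge0.
- by apply/measurable_EFinP; exact: measurable_funTS.
- by move=> w /= ew; rewrite lee_fin ler_expR ler_wpM2l.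
Qed.

Lemma borel_cantelli_cvg (Z : nat -> T -> R) (m : nat -> R) (c : R) :
  (forall n, measurable_fun setT (Z n)) -> m @ \oo --> c ->
  (forall e : R, 0 < e -> exists2 r : R, 0 < r & \forall n \near \oo,
     (P [set w | (e <= `|Z n w - m n|)%R] <= (2 * expR (- (n%:R * r)))%:E)%E) ->
  {ae P, forall w, Z n w @[n --> \oo] --> c}.
Proof.
move=> mZ mc tail.
have h (k : nat) : {ae P, forall w, \forall n \near \oo, `|Z n w - m n| < k.+1%:R^-1}.
  have k0 : 0 < k.+1%:R^-1 :> R by rewrite invr_gt0.
  have [r r0 [N _ hN]] := tail _ k0.
  (* The tail bound holds only from [N] on; after the shift the probabilities are dominated by a
     geometric series of ratio [expR (- r)]. *)
  pose F n := [set w | k.+1%:R^-1 <= `|Z (n + N)%N w - m (n + N)%N|].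
  have mF n : measurable (F n).
    have mf : measurable_fun setT (fun w => `|Z (n + N)%N w - m (n + N)%N|).
      by apply: measurableT_comp => //; apply: measurable_funB.
    rewrite (_ : F n = [set: T] `&` (fun w => `|Z (n + N)%N w - m (n + N)%N|) @^-1` `[k.+1%:R^-1, +oo[%classic).
      exact: mf.
    by apply/seteqP; split => w /=; rewrite in_itv /= andbT//; case.
  have F0 : P (lim_sup_set F) = 0%E.
    apply: lim_sup_set_cvg0 => //.
    have q01 : `|expR (- r)| < 1 by rewrite ger0_norm ?expR_ge0// -expR0 ltr_expR oppr_lt0.
    apply: (@le_lt_trans _ _ (\sum_(n <oo) (geometric 2 (expR (- r)) n)%:E)%E).
      apply: lee_nneseries => // n *.
      apply: (le_trans (hN (n + N)%N _)); first by rewrite /= leq_addl.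
      rewrite lee_fin ler_pM2l// -expRM_natl ler_expR mulrN lerN2 ler_wpM2r ?(ltW r0)//.
      by rewrite ler_nat leq_addr.
    apply: (@le_lt_trans _ _ (2 * (1 - expR (- r))^-1)%:E); last exact: ltry.
    apply: lime_le; first by apply: is_cvg_nneseries => n _ _; rewrite lee_fin mulr_ge0// exprn_ge0// expR_ge0.
    apply: nearW => n; rewrite sumEFin lee_fin.
    by apply: geometric_le_lim => //; exact: expR_gt0.
  exists (lim_sup_set F); split => //.
    by apply: bigcapT_measurable => n; apply: bigcup_measurable.
  move=> w /= hw n _; apply: contrapT => hn; apply: hw; exists (n + N)%N => // l /= nl.
  rewrite ltNge; apply/negP => hl; apply: hn; exists (l - N)%N => /=.
    by rewrite leq_subRL ?(leq_trans (leq_addl _ _) nl)// addnC.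
  by rewrite /F /= subnK// (leq_trans (leq_addl _ _) nl).
have := ae_foralln h; apply: filterS => w hw; apply/cvgrPdist_lt => e e0.
have e20 : 0 < e / 2 by rewrite divr_gt0.
have [k _ hk] := @near_ger_nat R (e / 2)^-1.
have /cvgrPdist_lt/(_ _ e20) hm := mc.
near=> n.
have h1 : `|Z n w - m n| < k.+1%:R^-1 by near: n; exact: hw.
have h2 : `|c - m n| < e / 2 by near: n.
have h3 : k.+1%:R^-1 <= e / 2 by rewrite invf_ple ?posrE//; exact: hk (leqnn k).
rewrite (_ : c - Z n w = (c - m n) - (Z n w - m n)); last by ring.
rewrite (le_lt_trans (ler_normB _ _))// [ltRHS](splitr e) ltrD// (lt_le_trans h1)//.
Unshelve. all: by end_near. Qed.

End almost_sure.

Lemma cvg_invn (R : realType) : (n%:R^-1 : R) @[n --> \oo] --> (0 : R).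
Proof.
apply/cvgrPdist_le => e e0; near=> n.
have n0 : 0 < n%:R :> R by rewrite ltr0n; near: n; exact: nbhs_infty_gt.
rewrite sub0r normrN ger0_norm ?invr_ge0 ?(ltW n0)// invf_ple ?posrE//.
by near: n; exact: nbhs_infty_ger.
Unshelve. all: by end_near. Qed.

(** * Convergence along the sequence of random matrices *)

Section stieltjes_sequence.
Context d0 (T : measurableType d0) (R : realType) (P : probability T R).
Context (sx sy gamma a C : R) (d p : nat -> nat).
Context (X : forall n : nat, random_matrix P n (d n)) (Y : forall n : nat, random_matrix P n (p n)).
Arguments X : clear implicits.
Arguments Y : clear implicits.
Hypotheses (sx0 : 0 < sx) (sy0 : 0 < sy) (gamma0 : 0 < gamma) (a0 : 0 < a)
  (dgt0 : forall n, (0 < d n)%N) (pgt0 : forall n, (0 < p n)%N)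
  (cvg_gamma : (n%:R / ((p n)%:R * (d n)%:R) : R) @[n --> \oo] --> gamma)
  (cvg_a : ((p n)%:R / (d n)%:R : R) @[n --> \oo] --> a)
  (iidX : forall n, iid_entries (X n)) (iidY : forall n, iid_entries (Y n))
  (XY : forall n, independent_rmx (X n) (Y n))
  (hX : forall n i j,
    [/\ ('E_P[X n i j] = 0)%E, ('E_P[(fun w => X n i j w ^+ 2)%R] = (sx ^+ 2)%:E)%E
      & ('E_P[(fun w => X n i j w ^+ 4)%R] <= C%:E)%E])
  (hY : forall n i l,
    [/\ ('E_P[Y n i l] = 0)%E, ('E_P[(fun w => Y n i l w ^+ 2)%R] = (sy ^+ 2)%:E)%E
      & ('E_P[(fun w => Y n i l w ^+ 4)%R] <= C%:E)%E]).

Let N n := (d n * p n)%N.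
Let gn n : R := n%:R / (N n)%:R.

Let N0 n : 0 < (N n)%:R :> R. Proof. by rewrite ltr0n muln_gt0 dgt0 pgt0. Qed.
Let dr0 n : 0 < (d n)%:R :> R. Proof. by rewrite ltr0n. Qed.
Let pr0 n : 0 < (p n)%:R :> R. Proof. by rewrite ltr0n. Qed.

Let cvg_gn : gn @ \oo --> gamma.
Proof. by rewrite /gn; under eq_fun do rewrite /N natrM mulrC -mulrC [_ * (p _)%:R]mulrC. Qed.

Let cvg_Ninv : (N n)%:R^-1 @[n --> \oo] --> (0 : R).
Proof.
rewrite -(mulr0 gamma); apply: cvg_trans; last exact: (cvgM cvg_gn (@cvg_invn R)).
apply: near_eq_cvg; near=> n.
have n0 : n%:R != 0 :> R by rewrite pnatr_eq0 -lt0n; near: n; exact: nbhs_infty_gt.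
by rewrite /gn /= mulrAC divff ?mul1r.
Unshelve. all: by end_near. Qed.

(** The dimensions tend to infinity by the two ratio hypotheses: [1 / N = (n / N) / n] tends to 0,
    and [1 / d^2 = (p / d) / N]. *)
Let cvg_dinv : (d n)%:R^-1 @[n --> \oo] --> (0 : R).
Proof.
rewrite (_ : (fun n => _) = fun n => Num.sqrt ((p n)%:R / (d n)%:R * (N n)%:R^-1)).
  rewrite -[X in _ --> X]sqrtr0; apply: continuous_cvg; first exact: sqrt_continuous.
  by rewrite -(mulr0 a); exact: cvgM.
apply/funext => n; rewrite -[LHS]ger0_norm ?invr_ge0// -sqrtr_sqr; congr Num.sqrt.
by rewrite /N natrM; field; rewrite !gt_eqF.
Qed.

Let cvg_pinv : (p n)%:R^-1 @[n --> \oo] --> (0 : R).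
Proof.
rewrite (_ : (fun n => _) = fun n => (d n)%:R^-1 / ((p n)%:R / (d n)%:R)).
  by rewrite -(mul0r a^-1); apply: cvgM => //; apply: cvgV => //; rewrite gt_eqF.
by apply/funext => n; field; rewrite !gt_eqF.
Qed.

Section fixed_t.
Context (t : R).
Hypothesis t0 : 0 < t.

Let g n w := rstieltjes (X n) (Y n) sx sy t w.
Let m n := \int[P]_w g n w.

Let g_ge0 n w : 0 <= g n w.
Proof. by rewrite divr_ge0//; apply: resolvent_trace_ge0 => //; exact: psd_scov_mx. Qed.

Let m_ge0 n : 0 <= m n.
Proof. by apply: Rintegral_ge0 => w _. Qed.

Let g_le n w : g n w <= t^-1.
Proof.
rewrite ler_pdivrMr; last exact: N0.
rewrite mulrC; apply: resolvent_trace_le => //; exact: psd_scov_mx.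
Qed.

Lemma measurable_rstieltjes_seq n : measurable_fun setT (g n).
Proof.
(* With [n = 0] there is no entry to discretise, but the matrices are then constant. *)
case: n => [|n]; last exact: (measurable_rstieltjes sx0 sy0 (ltn0Sn n) (dgt0 n.+1) (pgt0 n.+1) (@hX n.+1) (@hY n.+1) t0).
rewrite (_ : g 0%N = cst (stieltjes_mx t (0 : 'M[R]_(0, d 0%N)) (0 : 'M[R]_(0, p 0%N)))).
  exact: measurable_cst.
by apply/funext => w; rewrite /g /rstieltjes !flatmx0.
Qed.

Let m_le n : m n <= t^-1.
Proof.
have := @le_Rintegral _ _ _ P setT (g n) (cst t^-1); rewrite Rintegral_cst// [X in _ * fine X](probability_setT P) mulr1.
apply => //.
  apply: (@integrable_bounded _ _ _ _ _ t^-1) => [|w]; first exact: measurable_rstieltjes_seq.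
  by rewrite ger0_norm.
exact: finite_measure_integrable_cst.
Qed.

Definition stieltjes_lim : R :=
  gamma * ((mp_root gamma t - (t + 1 - gamma)) / (2 * gamma * t)) + (1 - gamma) / t.

Let cvg_m : m @ \oo --> stieltjes_lim.
Proof.
have [s0 hs] := mp_root_quadratic gamma0 t0.
have [l0 hl] := companion_equation_root t0 (ltW gamma0) s0 hs.
pose en n : R := gn n * Num.sqrt (3 * ((N n)%:R^-1 / t) ^+ 2 *
  (qf_var_bound (d n) (p n) sx sy C + 1 + n%:R)).
apply: (@companion_equation_cvg _ _ _ t0 (ltW gamma0) gn en m _ l0 hl m_ge0 cvg_gn); last first.
  by move=> n n0; exact: (rstieltjes_equation (iidX n) (iidY n) (@XY n) sx0 sy0 n0
    (dgt0 n) (pgt0 n) (@hX n) (@hY n) t0).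
pose C' := C / sx ^+ 4 + C / sy ^+ 4 + 1.
(* [qf_var_bound / N^2] is [2 (2 C' + 8) (C' / d + 1 / p)]; here the growth of both dimensions is
   used. *)
rewrite (_ : en = fun n => gn n * Num.sqrt (3 / t ^+ 2 *
   (2 * (2 * C' + 8) * (C' * (d n)%:R^-1 + (p n)%:R^-1) + (N n)%:R^-1 ^+ 2 + gn n * (N n)%:R^-1))).
  rewrite -(mulr0 gamma); apply: cvgM => //; rewrite -[X in _ --> X]sqrtr0.
  apply: continuous_cvg; first exact: sqrt_continuous.
  rewrite -(mulr0 (3 / t ^+ 2)); apply: cvgM; first exact: cvg_cst.
  rewrite -(addr0 0); apply: cvgD; last by rewrite -(mulr0 gamma); exact: cvgM.
  rewrite -(addr0 0); apply: cvgD.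
    rewrite -(mulr0 (2 * (2 * C' + 8))); apply: cvgM; first exact: cvg_cst.
    rewrite -(addr0 0); apply: cvgD => //.
    by rewrite -(mulr0 C'); apply: cvgM => //; exact: cvg_cst.
  by rewrite -(mulr0 0); exact: cvgM.
apply/funext => n; congr (_ * Num.sqrt _); rewrite /qf_var_bound -/C' /gn /N natrM.
by field; rewrite !gt_eqF.
Qed.

Lemma rstieltjes_tail n (delta e : R) : (0 < n)%N -> 0 < delta -> delta <= 2^-1 ->
  (P [set w | (e <= `|g n w - m n|)%R] <=
   (2 * expR (n%:R * (2 * delta ^+ 2) - delta * t * (N n)%:R * e))%:E)%E.
Proof.
(* [l] is scaled so that [l / (N t) = delta]; Chernoff's bound is applied with [l] and with
   [- l]. *)
move=> n0 delta0 delta1; pose l := delta * t * (N n)%:R.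
have lk : l * ((N n)%:R^-1 / t) = delta by rewrite /l; field; rewrite !gt_eqF.
have l0 : 0 < l by rewrite !mulr_gt0.
have mg : measurable_fun setT (fun w => g n w - m n).
  by apply: measurable_funB => //; exact: measurable_rstieltjes_seq.
have gb w : `|g n w - m n| <= t^-1 + t^-1.
  by rewrite (le_trans (ler_normB _ _))// !ger0_norm// lerD.
have h1 : (P [set w | (e <= g n w - m n)%R] <= (expR (n%:R * (2 * delta ^+ 2)) * expR (- (l * e)))%:E)%E.
  apply: chernoff_bound => //; [exact: ltW|by exists (t^-1 + t^-1)|].
  have := rstieltjes_concentration (iidX n) (iidY n) (@XY n) sx0 sy0 n0 (dgt0 n) (pgt0 n) (@hX n) (@hY n) t0 (l := l).
  by rewrite ger0_norm ?(ltW l0)// lk; exact.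
have h2 : (P [set w | (e <= - (g n w - m n))%R] <= (expR (n%:R * (2 * delta ^+ 2)) * expR (- (l * e)))%:E)%E.
  apply: chernoff_bound => //; [exact: measurableT_comp|exact: ltW| |].
    by exists (t^-1 + t^-1) => w; rewrite normrN.
  have := rstieltjes_concentration (iidX n) (iidY n) (@XY n) sx0 sy0 n0 (dgt0 n) (pgt0 n) (@hX n) (@hY n) t0 (l := - l).
  rewrite normrN ger0_norm ?(ltW l0)// mulNr lk sqrrN => /(_ delta1).
  by under eq_Rintegral do rewrite mulNr -mulrN.
have mset (Z : T -> R) : measurable_fun setT Z -> measurable [set w | e <= Z w].
  move=> mZ; rewrite (_ : [set _ | _] = [set: T] `&` Z @^-1` `[e, +oo[%classic); first exact: mZ.
  by apply/seteqP; split => w /=; rewrite in_itv /= andbT//; case.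
apply: (@le_trans _ _ (P ([set w | (e <= g n w - m n)%R] `|` [set w | (e <= - (g n w - m n))%R]))).
  apply: le_measure; rewrite ?inE.
  - by apply: mset; exact: measurableT_comp.
  - by apply: measurableU; apply: mset => //; exact: measurableT_comp.
  - by move=> w /=; rewrite ler_normr => /orP.
apply: (le_trans (measureU2 _ _ _)); [exact: mset|by apply: mset; exact: measurableT_comp|].
by rewrite expRD mulr_natl mulr2n EFinD; exact: leeD.
Qed.

Lemma ae_cvg_rstieltjes : {ae P, forall w, g n w @[n --> \oo] --> stieltjes_lim}.
Proof.
apply: (borel_cantelli_cvg measurable_rstieltjes_seq cvg_m) => e e0.
(* Let [r = delta e t / (4 gamma)]. As [N >= n / (2 gamma)] for large [n], the linear term of the
   exponent is at least [2 n r], while [8 gamma delta <= e t] bounds the quadratic term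
   [2 n delta^2] by [n r]; the exponent is at most [- n r]. *)
pose delta := Num.min 2^-1 (e * t / (8 * gamma)).
have delta0 : 0 < delta by rewrite lt_min invr_gt0 ltr0n /= divr_gt0 ?mulr_gt0.
have delta1 : delta <= 2^-1 by rewrite ge_min lexx.
have delta2 : delta * (8 * gamma) <= e * t by rewrite -ler_pdivlMr ?mulr_gt0// ge_min lexx orbT.
exists (delta * (e * t) / (4 * gamma)); first by rewrite divr_gt0 ?mulr_gt0.
near=> n; have n0 : (0 < n)%N by near: n; exact: nbhs_infty_gt.
apply: (le_trans (rstieltjes_tail e n0 delta0 delta1)).
rewrite lee_fin ler_pM2l// ler_expR.
have gn2 : gn n <= 2 * gamma by near: n; apply: (cvgr_le gamma cvg_gn); rewrite mulr_natl mulr2n ltrDl.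
have hN : n%:R / (2 * gamma) <= (N n)%:R.
  by rewrite ler_pdivrMr ?mulr_gt0// mulrC -ler_pdivrMr.
have h1 : delta * (e * t) * (n%:R / (2 * gamma)) <= delta * (e * t) * (N n)%:R.
  by rewrite ler_wpM2l// !mulr_ge0// ltW.
have h2 : n%:R * (delta * (delta * (8 * gamma)) / (4 * gamma)) <= n%:R * (delta * (e * t) / (4 * gamma)).
  by rewrite ler_wpM2l// ler_wpM2r ?invr_ge0 ?mulr_ge0 ?(ltW gamma0)// ler_wpM2l ?(ltW delta0).
have e1 : n%:R * (delta * (delta * (8 * gamma)) / (4 * gamma)) = n%:R * (2 * delta ^+ 2).
  by field; rewrite gt_eqF.
have e2 : delta * (e * t) * (n%:R / (2 * gamma)) = n%:R * (delta * (e * t) / (4 * gamma)) + n%:R * (delta * (e * t) / (4 * gamma)).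
  by field; rewrite gt_eqF.
rewrite e1 in h2; rewrite e2 in h1.
rewrite (_ : delta * t * (N n)%:R * e = delta * (e * t) * (N n)%:R); last by ring.
lra.
Unshelve. all: by end_near. Qed.

End fixed_t.

End stieltjes_sequence.

Theorem theorem1p3 (R : realType) (disp : measure_display)
    (T : measurableType disp) (P : probability T R)
    (sx sy gamma a C : R) (d p : nat -> nat)
    (X : forall n : nat, random_matrix P n (d n))
    (Y : forall n : nat, random_matrix P n (p n)) :
  0 < sx -> 0 < sy -> 0 < gamma -> 0 < a -> 0 < C ->
  (forall n, (0 < d n)%N) -> (forall n, (0 < p n)%N) ->
  (n%:R / ((p n)%:R * (d n)%:R) : R) @[n --> \oo] --> gamma ->
  ((p n)%:R / (d n)%:R : R) @[n --> \oo] --> a ->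
  (forall n, iid_entries (X n)) ->
  (forall n, iid_entries (Y n)) ->
  (forall n, independent_rmx (X n) (Y n)) ->
  (forall m n i j k l, same_law (X m i j) (X n k l)) ->
  (forall m n i j k l, same_law (Y m i j) (Y n k l)) ->
  (forall n i j,
    [/\ ('E_P[X n i j] = 0)%E,
        ('E_P[(fun w => X n i j w ^+ 2)%R] = (sx ^+ 2)%:E)%E
      & ('E_P[(fun w => X n i j w ^+ 4)%R] <= C%:E)%E]) ->
  (forall n i l,
    [/\ ('E_P[Y n i l] = 0)%E,
        ('E_P[(fun w => Y n i l w ^+ 2)%R] = (sy ^+ 2)%:E)%E
      & ('E_P[(fun w => Y n i l w ^+ 4)%R] <= C%:E)%E]) ->
  let M n w : 'M[R]_n :=
    hadamard ((d n)%:R^-1 *: (rmx_val (X n) w *m (rmx_val (X n) w)^T))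
             ((p n)%:R^-1 *: (rmx_val (Y n) w *m (rmx_val (Y n) w)^T)) in
  let mu n w : {measure set R -> \bar R} :=
    esd ((sx ^+ 2 * sy ^+ 2)^-1 *: M n w) in
  weak_cvg_in_probability P mu (marchenko_pastur gamma) /\
  ((forall (k n : nat) (i : 'I_n) (j : 'I_(d n)) (l : 'I_(p n)),
      ('E_P[(fun w => `|X n i j w| ^+ k)%R] + 'E_P[(fun w => `|Y n i l w| ^+ k)%R]
        < +oo)%E) ->
   {ae P, forall w, weak_cvg (mu ^~ w) (marchenko_pastur gamma)}).
Proof.
move=> sx0 sy0 gamma0 a0 _ d0 p0 cvg_gamma cvg_a iidX iidY XY _ _ hX hY M mu.
pose A n w : 'M[R]_n := normalized_product (rmx_val (X n) w) (rmx_val (Y n) w) sx sy.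
have pA n w : psd (A n w) by exact: psd_normalized_product.
have muE n (f : R -> R) : continuous f -> (fun w => \int[mu n w]_x f x) =
    fun w => n%:R^-1 * \sum_(x <- eigenvalues (A n w)) f x.
  move=> cf; apply/funext => w; rewrite -Rintegral_esd//.
  exact: continuous_measurable_fun.
have dp0 n : 0 < (d n * p n)%:R :> R by rewrite ltr0n muln_gt0 d0 p0.
have cvg_gn : (n%:R / (d n * p n)%:R : R) @[n --> \oo] --> gamma.
  rewrite (_ : (fun n => _) = fun n => n%:R / ((p n)%:R * (d n)%:R) : R)//.
  by apply/funext => n; rewrite natrM mulrC [(d n)%:R * _]mulrC mulrC.
pose nu : {measure set R -> \bar R} := marchenko_pastur gamma.
pose Q : probability R R := HB.pack (Measure.sort nu)
  (Measure_isProbability.Build _ _ _ nu (marchenko_pastur_setT gamma0)).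
have ae_weak : {ae P, forall w, weak_cvg (mu ^~ w) (marchenko_pastur gamma)}.
  (* Only countably many [t] are involved, so one null set serves them all. *)
  have : {ae P, forall w, forall i j : nat,
      rstieltjes (X n) (Y n) sx sy (i.+1%:R / j.+1%:R) w @[n --> \oo] -->
      stieltjes_lim gamma (i.+1%:R / j.+1%:R)}.
    apply: ae_foralln => i; apply: ae_foralln => j.
    have t0 : 0 < i.+1%:R / j.+1%:R :> R by rewrite divr_gt0.
    exact: (ae_cvg_rstieltjes sx0 sy0 gamma0 a0 d0 p0 cvg_gamma cvg_a iidX iidY XY hX hY t0).
  apply: filterS => w hw f cf bf.
  rewrite (_ : (fun n => _) = fun n => n%:R^-1 * \sum_(x <- eigenvalues (A n w)) f x); last first.
    by apply/funext => n; rewrite -[RHS]/((fun w => _) w) -muE.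
  apply: (@resolvent_weak_cvg _ (fun n => eigenvalues (A n w)) Q) => //.
  - by move=> n; exact: size_eigenvalues.
  - by move=> n x; exact: eigenvalues_ge0.
  - exact: marchenko_pastur_neg.
  move=> i j; set t := _ / _; have t0 : 0 < t by rewrite divr_gt0.
  have gt0 : gamma != 0 by rewrite gt_eqF.
  rewrite (_ : \int[Q]_x _ = stieltjes_lim gamma t / gamma + (1 - gamma^-1) / t); last first.
    rewrite /Rintegral (integral_marchenko_pastur_inv gamma0 t0) /stieltjes_lim /=.
    by field; rewrite !gt_eqF.
  (* For [n > 0] the mean of [1 / (x + t)] over the eigenvalues is [g / (n / N) + (1 - N / n) / t],
     where [g] is the value of [rstieltjes]; the last term accounts for the zero eigenvalues by
     which the two Gram matrices differ. *)
  apply: (@cvg_trans _ ((rstieltjes (X n) (Y n) sx sy t w / (n%:R / (d n * p n)%:R) +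
      (1 - (n%:R / (d n * p n)%:R)^-1) / t) @[n --> \oo])); last first.
    apply: cvgD; first by apply: cvgM; [exact: hw|exact: cvgV].
    apply: cvgM; last exact: cvg_cst.
    by apply: cvgB; [exact: cvg_cst|exact: cvgV].
  apply: near_eq_cvg; near=> n.
  have n0 : n%:R != 0 :> R by rewrite pnatr_eq0 -lt0n; near: n; exact: nbhs_infty_gt.
  rewrite normalized_product_stieltjes// -/(rstieltjes (X n) (Y n) sx sy t w).
  move: (dp0 n) n0 t0; clearbody t; move: (rstieltjes _ _ _ _ _ _) => g.
  move: (n%:R : R) ((d n * p n)%:R : R) => u v v0 u0 t0.
  by field; rewrite u0 !gt_eqF.
split=> // f cf bf; apply: ae_cvg_in_probability; last by apply: filterS ae_weak => w; exact.
move=> n; rewrite (muE n f cf); apply: measurable_funM; first exact: measurable_cst.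
apply: (@measurable_statistic _ _ _ n) => //.
- by move=> w; exact: size_eigenvalues.
- by move=> w x; exact: eigenvalues_ge0.
move=> i j; set t := _ / _; have t0 : 0 < t by rewrite divr_gt0.
rewrite (_ : (fun w => _) = fun w => (d n * p n)%:R * rstieltjes (X n) (Y n) sx sy t w +
    (n%:R - (d n * p n)%:R) / t).
  apply: measurable_funD => //; apply: measurable_funM => //.
  exact: (measurable_rstieltjes_seq sx0 sy0 d0 p0 hX hY t0).
by apply/funext => w; rewrite normalized_product_stieltjes.
Unshelve. all: by end_near. Qed.
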